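(* Let $M$ be a smooth surface and let $\phi: M\to\mathbb{C}^2$ be a Hamiltonian stationary Lagrangian immersion which is a self-similar solution for mean curvature flow, i.e. $H=a\,\phi^\perp$ for some real constant $a\neq 0$. (a) If $\phi$ is a self-expander, i.e. $H=a\phi^\perp$ with $a>0$, then $\phi$ is locally congruent to some $\Phi_\delta:\mathbb{R}^2\to\mathbb{C}^2$, $\delta>0$, where $$\Phi_\delta(s,t)=\frac{1}{\sqrt{2a}}\Big(i\sinh\delta\,\cosh t\;e^{-\frac{is}{\cosh\delta}},\ \tanh\delta\,\sinh t\;e^{i\,\cosh\delta\, s}\Big).$$ (b) If $\phi$ is a self-shrinker, i.e. $H=a\phi^\perp$ with $a<0$, then $\phi$ is locally congruent to one of the following: (i) the right circular cylinder $\mathbb{S}^1\big(\tfrac{1}{\sqrt{-2a}}\big)\times\mathbb{R}$; (ii) the Clifford torus $\mathbb{S}^1\big(\tfrac{1}{\sqrt{-2a}}\big)\times\mathbb{S}^1\big(\tfrac{1}{\sqrt{-2a}}\big)$; (iii) some $\Upsilon_\gamma:\mathbb{R}^2\to\mathbb{C}^2$, $0<\gamma<\pi/2$, where $$\Upsilon_\gamma(s,t)=\frac{1}{\sqrt{-2a}}\Big(-i\sin\gamma\,\cosh t\;e^{\frac{is}{\cos\gamma}},\ \tan\gamma\,\sinh t\;e^{-i\,\cos\gamma\, s}\Big);$$ (iv) some $\Psi_\nu:\mathbb{S}^1\times\mathbb{R}\to\mathbb{C}^2$, $\nu>0$, where $$\Psi_\nu(e^{is},t)=\frac{1}{\sqrt{-2a}}\Big(\cosh\nu\,\cos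 s\;e^{\frac{it}{\sinh\nu}},\ \coth\nu\,\sin s\;e^{i\,\sinh\nu\, t}\Big).$$
   Context: $\mathbb{C}^2\equiv\mathbb{R}^4$ carries the Hermitian product $(z,w)=z_1\bar w_1+z_2\bar w_2$, the Euclidean metric $\langle\cdot,\cdot\rangle=\mathrm{Re}(\cdot,\cdot)$, the complex structure $J$ (multiplication by $i$) and the Kähler form $\omega=\langle J\cdot,\cdot\rangle$. An immersion $\phi:M\to\mathbb{C}^2$ of a surface is Lagrangian if $\phi^*\omega=0$; $M$ carries the induced metric. The mean curvature vector is $H=\tfrac12\,\mathrm{trace}\,\sigma$, with $\sigma$ the second fundamental form (note the factor $1/2$), and $\phi^\perp$ denotes the normal projection of the position vector $\phi$. Locally (choosing a local orientation with area form $\omega_M$) the Lagrangian angle $\beta$ is defined, modulo $2\pi$, by $\phi^*(dz_1\wedge dz_2)=e^{i\beta}\omega_M$. The Lagrangian immersion is Hamiltonian stationary if $\beta$ is harmonic, $\Delta\beta=0$, for the Laplacian $\Delta$ of the induced metric. An immersion is a self-similar solution for mean curvature flow if $H=a\phi^\perp$ for some nonzero constant $a$; it is a self-expander if $a>0$ and a self-shrinker if $a<0$. $\mathbb{S}^1(r)$ is the circle of radius $r$ in $\mathbb{C}$. The cylinder in (i) is $\mathbb{S}^1(r)\times\mathbb{R}\subset\mathbb{C}\times\mathbb{C}$ and the torus in (ii) is $\mathbb{S}^1(r)\times\mathbb{S}^1(r)\subset\mathbb{C}\times\mathbb{C}$. ''Locally congruent'' means locally equal, up to an isometry of $\mathbb{C}^2$,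 to an open piece of the model immersed surface.
   Formalization: The formal statement adds that H vanishes identically on no nonempty open set of M: Lagrangian planes through the origin have H = 0 = φ^⊥ and constant β, so they meet all hypotheses for every a but are congruent to no model. *)

(* Defs.v *)
From Stdlib Require Import Reals.
From Coquelicot Require Import Coquelicot.
Open Scope R_scope.

(** * Calculus on open subsets of the plane *)

Definition D1 (f : R * R -> R) (p : R * R) : R :=
  Derive (fun x => f (x, snd p)) (fst p).
Definition D2 (f : R * R -> R) (p : R * R) : R :=
  Derive (fun y => f (fst p, y)) (snd p).

Fixpoint Ck (n : nat) (O : R * R -> Prop) (f : R * R -> R) : Prop :=
  (forall p, O p -> continuous f p) /\
  match n with
  | 0%nat => True
  | S m =>
      (forall p, O p -> ex_derive (fun x => f (x, snd p)) (fst p)) /\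
      (forall p, O p -> ex_derive (fun y => f (fst p, y)) (snd p)) /\
      Ck m O (D1 f) /\ Ck m O (D2 f)
  end.

Definition smooth (O : R * R -> Prop) (f : R * R -> R) : Prop :=
  forall n, Ck n O f.

Definition smooth_map (O : R * R -> Prop) (h : R * R -> R * R) : Prop :=
  smooth O (fun p => fst (h p)) /\ smooth O (fun p => snd (h p)).

Definition diffeomorphism (O W : R * R -> Prop) (h : R * R -> R * R) : Prop :=
  open O /\ open W /\ smooth_map O h /\ (forall p, O p -> W (h p)) /\
  exists k : R * R -> R * R,
    smooth_map W k /\ (forall q, W q -> O (k q)) /\
    (forall p, O p -> k (h p) = p) /\ (forall q, W q -> h (k q) = q).

(** * The complex plane [C^2] as a Euclidean and Kähler vector space *)

Definition C2 : Type := (C * C)%type.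

Definition vzero : C2 := (RtoC 0, RtoC 0).
Definition vadd (z w : C2) : C2 := (fst z + fst w, snd z + snd w)%C.
Definition vscal (a : R) (z : C2) : C2 := (RtoC a * fst z, RtoC a * snd z)%C.
Definition vsub (z w : C2) : C2 := (fst z - fst w, snd z - snd w)%C.

Definition herm (z w : C2) : C :=
  (fst z * Cconj (fst w) + snd z * Cconj (snd w))%C.
Definition inner (z w : C2) : R := Re (herm z w).
Definition J (z : C2) : C2 := (Ci * fst z, Ci * snd z)%C.
Definition kahler (z w : C2) : R := inner (J z) w.
Definition vnorm (z : C2) : R := sqrt (inner z z).

Definition isometry (F : C2 -> C2) : Prop :=
  forall z w, vnorm (vsub (F z) (F w)) = vnorm (vsub z w).

Definition dz1_dz2 (z w : C2) : C := (fst z * snd w - snd z * fst w)%C.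

Definition expi (x : R) : C := (cos x, sin x).

(** * Geometry of a parametrized surface [f : R^2 -> C^2] *)

Definition coordinatewise (D : (R * R -> R) -> R * R -> R)
    (f : R * R -> C2) (p : R * R) : C2 :=
  ((D (fun q => Re (fst (f q))) p, D (fun q => Im (fst (f q))) p),
   (D (fun q => Re (snd (f q))) p, D (fun q => Im (snd (f q))) p)).

Definition V1 : (R * R -> C2) -> R * R -> C2 := coordinatewise D1.
Definition V2 : (R * R -> C2) -> R * R -> C2 := coordinatewise D2.

Definition smooth_C2 (O : R * R -> Prop) (f : R * R -> C2) : Prop :=
  smooth O (fun q => Re (fst (f q))) /\ smooth O (fun q => Im (fst (f q))) /\
  smooth O (fun q => Re (snd (f q))) /\ smooth O (fun q => Im (snd (f q))).

Definition differential (f : R * R -> C2) (p X : R * R) : C2 :=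
  vadd (vscal (fst X) (V1 f p)) (vscal (snd X) (V2 f p)).

(** Coefficients of the induced metric and its area density. *)
Definition g11 (f : R * R -> C2) (p : R * R) : R := inner (V1 f p) (V1 f p).
Definition g12 (f : R * R -> C2) (p : R * R) : R := inner (V1 f p) (V2 f p).
Definition g22 (f : R * R -> C2) (p : R * R) : R := inner (V2 f p) (V2 f p).
Definition gdet (f : R * R -> C2) (p : R * R) : R :=
  g11 f p * g22 f p - g12 f p * g12 f p.
Definition area (f : R * R -> C2) (p : R * R) : R := sqrt (gdet f p).

(** Coefficients of the inverse matrix of the metric. *)
Definition gi11 (f : R * R -> C2) (p : R * R) : R := g22 f p / gdet f p.
Definition gi12 (f : R * R -> C2) (p : R * R) : R := - g12 f p / gdet f p.
Definition gi22 (f : R * R -> C2) (p : R * R) : R := g11 f p / gdet f p.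

(** [w^T = sum_ij g^ij <w, d_i f> d_j f] *)
Definition tangent_part (f : R * R -> C2) (p : R * R) (w : C2) : C2 :=
  let w1 := inner w (V1 f p) in
  let w2 := inner w (V2 f p) in
  vadd (vscal (gi11 f p * w1 + gi12 f p * w2) (V1 f p))
       (vscal (gi12 f p * w1 + gi22 f p * w2) (V2 f p)).
Definition normal_part (f : R * R -> C2) (p : R * R) (w : C2) : C2 :=
  vsub w (tangent_part f p w).

(** Coefficients of the second fundamental form in the coordinate frame:
    [sigma (d_i, d_j)] is the normal part of [d_i d_j f]. *)
Definition sigma11 (f : R * R -> C2) (p : R * R) : C2 :=
  normal_part f p (V1 (V1 f) p).
Definition sigma12 (f : R * R -> C2) (p : R * R) : C2 :=
  normal_part f p (V1 (V2 f) p).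
Definition sigma22 (f : R * R -> C2) (p : R * R) : C2 :=
  normal_part f p (V2 (V2 f) p).

Definition trace_sigma (f : R * R -> C2) (p : R * R) : C2 :=
  vadd (vscal (gi11 f p) (sigma11 f p))
       (vadd (vscal (2 * gi12 f p) (sigma12 f p))
             (vscal (gi22 f p) (sigma22 f p))).

Definition mean_curvature (f : R * R -> C2) (p : R * R) : C2 :=
  vscal (1 / 2) (trace_sigma f p).

(** [sum_ij d_i (sqrt (det g) g^ij d_j u) / sqrt (det g)] *)
Definition laplacian (f : R * R -> C2) (u : R * R -> R) (p : R * R) : R :=
  (D1 (fun q => area f q * (gi11 f q * D1 u q + gi12 f q * D2 u q)) p +
   D2 (fun q => area f q * (gi12 f q * D1 u q + gi22 f q * D2 u q)) p)
  / area f p.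

(** The area form of the chart orientation is [area f du /\ dv]; the opposite
    orientation only shifts the angle by [PI]. *)
Definition lagrangian_angle (O : R * R -> Prop) (f : R * R -> C2)
    (b : R * R -> R) : Prop :=
  smooth O b /\
  forall p, O p -> forall X Y : R * R,
    dz1_dz2 (differential f p X) (differential f p Y) =
    (expi (b p) * RtoC (area f p * (fst X * snd Y - snd X * fst Y)))%C.

(** * Smooth surfaces *)

(** A surface is given by local parametrizations [x i : dom i -> M] with open
    domains; its topology is the one they induce. *)
Definition atlas_open {M I : Type} (dom : I -> R * R -> Prop)
    (x : I -> R * R -> M) (U : M -> Prop) : Prop :=
  forall i, open (fun p : R * R => dom i p /\ U (x i p)).

Record surface : Type := Surface {
  carrier :> Type;
  chart : Type;
  dom : chart -> R * R -> Prop;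
  par : chart -> R * R -> carrier;
  dom_open : forall i, open (dom i);
  par_inj : forall i p q, dom i p -> dom i q -> par i p = par i q -> p = q;
  par_cover : forall m : carrier, exists i p, dom i p /\ par i p = m;
  transition : forall i j,
    let overlap := fun p : R * R =>
      dom i p /\ exists q, dom j q /\ par j q = par i p in
    open overlap /\
    exists h : R * R -> R * R,
      smooth_map overlap h /\
      forall p, overlap p -> dom j (h p) /\ par j (h p) = par i p;
  hausdorff : forall m n : carrier, m <> n ->
    exists U V : carrier -> Prop,
      atlas_open dom par U /\ atlas_open dom par V /\ U m /\ V n /\
      forall z, ~ (U z /\ V z);
  second_countable : exists B : nat -> carrier -> Prop,
    (forall k, atlas_open dom par (B k)) /\
    forall (U : carrier -> Prop) (m : carrier), atlas_open dom par U -> U m ->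
      exists k, B k m /\ forall z, B k z -> U z
}.

Arguments dom {s} _ _.
Arguments par {s} _ _.

Definition surface_open (M : surface) (U : M -> Prop) : Prop :=
  atlas_open (@dom M) (@par M) U.

Definition connected_subset (M : surface) (A : M -> Prop) : Prop :=
  forall U V : M -> Prop, surface_open M U -> surface_open M V ->
    (forall m, A m -> U m \/ V m) ->
    (exists m, A m /\ U m) -> (exists m, A m /\ V m) ->
    exists m, A m /\ U m /\ V m.

Definition in_chart (M : surface) (phi : M -> C2) (i : chart M) : R * R -> C2 :=
  fun p => phi (par i p).

Definition immersion (M : surface) (phi : M -> C2) : Prop :=
  forall i : chart M,
    smooth_C2 (dom i) (in_chart M phi i) /\
    forall p, dom i p -> forall X : R * R,
      differential (in_chart M phi i) p X = vzero -> X = (0, 0).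

Definition lagrangian (M : surface) (phi : M -> C2) : Prop :=
  forall (i : chart M) p, dom i p -> forall X Y : R * R,
    kahler (differential (in_chart M phi i) p X)
           (differential (in_chart M phi i) p Y) = 0.

Definition hamiltonian_stationary (M : surface) (phi : M -> C2) : Prop :=
  forall (i : chart M) p, dom i p ->
    exists (O : R * R -> Prop) (b : R * R -> R),
      open O /\ O p /\ (forall q, O q -> dom i q) /\
      lagrangian_angle O (in_chart M phi i) b /\
      forall q, O q -> laplacian (in_chart M phi i) b q = 0.

(** [H = a phi^perp] *)
Definition self_similar (M : surface) (phi : M -> C2) (a : R) : Prop :=
  forall (i : chart M) p, dom i p ->
    mean_curvature (in_chart M phi i) p =
    vscal a (normal_part (in_chart M phi i) p (phi (par i p))).

(** [H] vanishes identically on no nonempty open set.  This excludes the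
    Lagrangian planes through the origin, for which [H] and [phi^perp] are both
    zero, so that [H = a phi^perp] for every [a]. *)
Definition nowhere_minimal (M : surface) (phi : M -> C2) : Prop :=
  forall (i : chart M) (O : R * R -> Prop),
    open O -> (forall p, O p -> dom i p) -> (exists p, O p) ->
    exists p, O p /\ mean_curvature (in_chart M phi i) p <> vzero.

(** Near each point of [A], up to an isometry of [C^2] and a change of
    parameters, [phi] is the restriction of [Psi] to an open set. *)
Definition locally_congruent_on (M : surface) (A : M -> Prop) (phi : M -> C2)
    (Psi : R * R -> C2) : Prop :=
  forall m, A m ->
    exists (i : chart M) (O W : R * R -> Prop) (h : R * R -> R * R)
           (F : C2 -> C2),
      (forall p, O p -> dom i p) /\ (exists p, O p /\ par i p = m) /\
      diffeomorphism O W h /\ isometry F /\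
      forall p, O p -> phi (par i p) = F (Psi (h p)).

(** * The models *)

(** Circles, here and in [Psi_model], are parametrized by their universal
    covers, which has no effect on local congruence. *)
Definition cylinder (r : R) (st : R * R) : C2 :=
  (RtoC r * expi (fst st), RtoC (snd st))%C.

Definition torus (r : R) (st : R * R) : C2 :=
  (RtoC r * expi (fst st), RtoC r * expi (snd st))%C.

Definition Phi_model (a delta : R) (st : R * R) : C2 :=
  let s := fst st in let t := snd st in
  vscal (1 / sqrt (2 * a))
    (Ci * RtoC (sinh delta * cosh t) * expi (- (s / cosh delta)),
     RtoC (tanh delta * sinh t) * expi (cosh delta * s))%C.

Definition Upsilon_model (a gamma : R) (st : R * R) : C2 :=
  let s := fst st in let t := snd st in
  vscal (1 / sqrt (- 2 * a))
    (- Ci * RtoC (sin gamma * cosh t) * expi (s / cos gamma),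
     RtoC (tan gamma * sinh t) * expi (- (cos gamma * s)))%C.

Definition Psi_model (a nu : R) (st : R * R) : C2 :=
  let s := fst st in let t := snd st in
  vscal (1 / sqrt (- 2 * a))
    (RtoC (cosh nu * cos s) * expi (t / sinh nu),
     RtoC (cosh nu / sinh nu * sin s) * expi (sinh nu * t))%C.

(* Main.v *)
Require Import Defs.
From Stdlib Require Import Reals Lra Classical ClassicalEpsilon FunctionalExtensionality.
From Coquelicot Require Import Coquelicot.
Open Scope R_scope.
Set Bullet Behavior "Strict Subproofs".

(** Writing [beta] for the Lagrangian angle, [H = a phi^perp] means
    [d beta = 2 a <phi, J dphi>].  Where [H <> 0], [beta] and a harmonic conjugate
    of it are isothermal coordinates [(x, y)], in which the Lagrangian condition
    becomes the linear equation [phi_y = T phi_x] with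
    [T v = e^(i x) (- conj v_2, conj v_1)].  Differentiating it together with
    [<phi, J phi_x> = 1 / (2 a)] and [<phi, J phi_y> = 0] gives
    [phi_xx = i phi_x + kappa phi] and [phi_xy = kappa T phi], where the number
    [kappa = - (|phi_x|^2 + 1 / (2 a)) / |phi|^2] is locally constant and at most
    [1 / 4].  With [lambda + mu = 1] and [lambda mu = kappa], the solutions of this
    linear system are [phi = A(y) e^(i lambda x) e_1 + B(y) e^(i mu x) e_2] for a
    unitary frame [e_1, e_2] and real [A, B] with [A' = mu B], [B' = - lambda A] and
    [lambda A^2 + mu B^2 = - 1 / (2 a)].  The signs of [a] and [mu] select the model;
    the Clifford torus is the case [kappa = 1 / 4], where it is congruent to
    [Psi_nu] with [sinh nu = 1].

    Since [|phi_x|^2 = 1 / (4 |H|^2)], the definition of [kappa] bounds [|H|] away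
    from zero as long as [kappa] stays constant; as [H] does not vanish on an open
    set, it vanishes nowhere, and [kappa] is constant on connected sets. *)

(** * Partial derivatives and smooth functions *)

(** [T v] is the vector hermitian-orthogonal to [v], of equal length, with
    [det (v, T v) = e^(i x) |v|^2]; so [phi_y = T phi_x] says at once that the coordinates are
    conformal, that the surface is Lagrangian and that its angle is [x]. It is linear because the
    unknown angle has become a coordinate. The harmonic conjugate exists because [Delta beta = 0] is
    closedness of the dual form of [d beta]. The exponents are the roots of [z^2 - z + kappa], found
    by inserting [e^(i z x)], and are real because [|phi_x - i phi / 2|^2 = (1 / 4 - kappa)
    |phi|^2]. No existence theorem for differential equations enters: [phi] and [phi_x] at one point
    determine the solution of the overdetermined system, so a model only has to match these values.
    The obstacle is global: adapted coordinates exist only where [H <> 0], yet one model parameter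
    must serve a whole connected set. Hence [kappa] is traded for an equation in [|phi|^2] and
    [|phi^perp|^2] alone, which makes sense in every chart and also at zeros of [H], where it reads
    [1 = 0]. *)

Definition slice (d : bool) (p : R * R) (t : R) : R * R :=
  if d then (t, snd p) else (fst p, t).
Definition coord (d : bool) (p : R * R) : R := if d then fst p else snd p.
Definition DD (d : bool) : (R * R -> R) -> R * R -> R := if d then D1 else D2.
(** The boolean selects the variable ([true] for the first), so that each differentiation rule
    serves both partial derivatives. *)
Definition is_pd (d : bool) (f : R * R -> R) (p : R * R) (l : R) : Prop :=
  is_derive (fun t => f (slice d p t)) (coord d p) l.

Lemma slice_coord d p : slice d p (coord d p) = p.
Proof. destruct d, p; reflexivity. Qed.

Lemma DD_Derive d f p : DD d f p = Derive (fun t => f (slice d p t)) (coord d p).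
Proof. destruct d; reflexivity. Qed.

Lemma is_pd_unique d f p l : is_pd d f p l -> DD d f p = l.
Proof. intros H. rewrite DD_Derive. apply is_derive_unique, H. Qed.

Lemma continuous_slice d p t : continuous (slice d p) t.
Proof.
  apply filterlim_locally; intros eps; exists eps; intros s Hs.
  destruct d; (split; [| ]); simpl; try apply ball_center; exact Hs.
Qed.

Lemma locally_slice d (O : R * R -> Prop) p :
  open O -> O p -> locally (coord d p) (fun t => O (slice d p t)).
Proof.
  intros oO Op.
  apply (continuous_slice d p (coord d p)).
  rewrite slice_coord. now apply oO.
Qed.

Lemma is_pd_ext_open d (O : R * R -> Prop) f g p l :
  open O -> O p -> (forall q, O q -> f q = g q) -> is_pd d f p l -> is_pd d g p l.
Proof.
  intros oO Op E. apply is_derive_ext_loc.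
  generalize (locally_slice d O p oO Op).
  apply filter_imp. intros; now apply E.
Qed.

Lemma DD_ext_open d (O : R * R -> Prop) f g p :
  open O -> O p -> (forall q, O q -> f q = g q) -> DD d f p = DD d g p.
Proof.
  intros oO Op E. rewrite !DD_Derive. apply Derive_ext_loc.
  generalize (locally_slice d O p oO Op).
  apply filter_imp. intros; now apply E.
Qed.

Lemma continuous_ext_open (O : R * R -> Prop) (f g : R * R -> R) p :
  open O -> O p -> (forall q, O q -> f q = g q) -> continuous f p -> continuous g p.
Proof.
  intros oO Op E. apply continuous_ext_loc.
  apply (filter_imp O); [exact E | now apply oO].
Qed.

Lemma Ck_S n O f :
  Ck (S n) O f <->
  (forall p, O p -> continuous f p) /\
  (forall d p, O p -> is_pd d f p (DD d f p)) /\ (forall d, Ck n O (DD d f)).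
Proof.
  simpl; split.
  - intros (C & E1 & E2 & K1 & K2). split; [exact C|]. split.
    + intros [] p Op; apply Derive_correct; [exact (E1 p Op) | exact (E2 p Op)].
    + intros []; [exact K1 | exact K2].
  - intros (C & E & K). split; [exact C|]. repeat split; intros.
    + exists (D1 f p). apply (E true p H).
    + exists (D2 f p). apply (E false p H).
    + apply (K true).
    + apply (K false).
Qed.

Lemma Ck_continuous n O f p : Ck n O f -> O p -> continuous f p.
Proof. destruct n; intros [H _]; auto. Qed.

Lemma Ck_sub n : forall (O O' : R * R -> Prop) f,
  (forall p, O' p -> O p) -> Ck n O f -> Ck n O' f.
Proof.
  induction n; intros O O' f S.
  - intros [C _]; split; auto.
  - rewrite !Ck_S. intros (C & E & K). split; [auto|]. split; [auto|].
    intros d; now apply (IHn O).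
Qed.

Lemma Ck_ext n : forall (O : R * R -> Prop) f g,
  open O -> (forall q, O q -> f q = g q) -> Ck n O f -> Ck n O g.
Proof.
  induction n; intros O f g oO E.
  - intros [C _]; split; [|exact I].
    intros p Op; apply (continuous_ext_open O f); auto.
  - rewrite !Ck_S. intros (C & D & K). split; [|split].
    + intros p Op; apply (continuous_ext_open O f); auto.
    + intros d p Op. rewrite <- (DD_ext_open d O f g p); auto.
      apply (is_pd_ext_open d O f); auto.
    + intros d. apply (IHn O (DD d f)); auto.
      intros q Oq; now apply (DD_ext_open d O).
Qed.

Lemma Ck_pred n : forall O f, Ck (S n) O f -> Ck n O f.
Proof.
  induction n; intros O f.
  - intros [C _]; now split.
  - intros H. rewrite Ck_S in H. rewrite Ck_S. destruct H as (C & D & K).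
    split; [exact C|]. split; [exact D|]. intros d; apply IHn, K.
Qed.

(** [Ck] refers to the total functions [D1 f] and [D2 f]; they agree with the given [f'] on the open
    set, and regularity is insensitive to values elsewhere. *)
Lemma Ck_intro n O f (f' : bool -> R * R -> R) :
  open O -> (forall p, O p -> continuous f p) ->
  (forall d p, O p -> is_pd d f p (f' d p)) -> (forall d, Ck n O (f' d)) ->
  Ck (S n) O f.
Proof.
  intros oO C D K. rewrite Ck_S. split; [exact C|]. split.
  - intros d p Op. rewrite (is_pd_unique _ _ _ _ (D d p Op)); auto.
  - intros d. apply (Ck_ext n O (f' d)); auto.
    intros q Oq. symmetry. apply is_pd_unique; auto.
Qed.

Section Rules.
Variables (d : bool) (p : R * R).

Lemma is_pd_const c : is_pd d (fun _ => c) p 0.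
Proof. exact (is_derive_const (K := R_AbsRing) (V := R_NormedModule) c _). Qed.

Lemma is_pd_eq f l l' : is_pd d f p l -> l = l' -> is_pd d f p l'.
Proof. now intros H <-. Qed.

Lemma is_pd_plus f g l m :
  is_pd d f p l -> is_pd d g p m -> is_pd d (fun q => f q + g q) p (l + m).
Proof. intros Hf Hg; exact (is_derive_plus (K := R_AbsRing) (V := R_NormedModule) _ _ _ _ _ Hf Hg). Qed.

Lemma is_pd_minus f g l m :
  is_pd d f p l -> is_pd d g p m -> is_pd d (fun q => f q - g q) p (l - m).
Proof. intros Hf Hg; exact (is_derive_minus (K := R_AbsRing) (V := R_NormedModule) _ _ _ _ _ Hf Hg). Qed.

Lemma is_pd_opp f l : is_pd d f p l -> is_pd d (fun q => - f q) p (- l).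
Proof. intros H; exact (is_derive_opp (K := R_AbsRing) (V := R_NormedModule) _ _ _ H). Qed.

Lemma is_pd_mult f g l m :
  is_pd d f p l -> is_pd d g p m ->
  is_pd d (fun q => f q * g q) p (l * g p + f p * m).
Proof.
  intros Hf Hg.
  generalize (is_derive_mult (K := R_AbsRing) _ _ _ _ _ Hf Hg Rmult_comm).
  now rewrite slice_coord.
Qed.

Lemma is_pd_comp (F : R -> R) f l m :
  is_derive F (f p) m -> is_pd d f p l -> is_pd d (fun q => F (f q)) p (m * l).
Proof.
  intros HF Hf. rewrite Rmult_comm. unfold is_pd.
  apply (is_derive_comp (K := R_AbsRing) (V := R_NormedModule) F); [|exact Hf].
  now rewrite slice_coord.
Qed.

Lemma is_pd_cos f l :
  is_pd d f p l -> is_pd d (fun q => cos (f q)) p (- sin (f p) * l).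
Proof. apply is_pd_comp, is_derive_Reals, derivable_pt_lim_cos. Qed.

Lemma is_pd_sin f l :
  is_pd d f p l -> is_pd d (fun q => sin (f q)) p (cos (f p) * l).
Proof. apply is_pd_comp, is_derive_Reals, derivable_pt_lim_sin. Qed.

Lemma is_pd_inv f l :
  f p <> 0 -> is_pd d f p l -> is_pd d (fun q => / f q) p (- (/ f p * / f p) * l).
Proof.
  intros nz. apply (is_pd_comp Rinv).
  auto_derive; [exact nz|]. now field.
Qed.

Lemma is_pd_sqrt f l :
  0 < f p -> is_pd d f p l -> is_pd d (fun q => sqrt (f q)) p (/ 2 * / sqrt (f p) * l).
Proof.
  intros pos. apply (is_pd_comp sqrt).
  auto_derive; [exact pos|]. field. now apply Rgt_not_eq, sqrt_lt_R0.
Qed.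

End Rules.

Lemma is_pd_fst d p : is_pd d fst p (if d then 1 else 0).
Proof.
  destruct d; unfold is_pd; simpl.
  - exact (is_derive_id (K := R_AbsRing) _).
  - exact (is_derive_const (K := R_AbsRing) (V := R_NormedModule) _ _).
Qed.

Lemma is_pd_snd d p : is_pd d snd p (if d then 0 else 1).
Proof.
  destruct d; unfold is_pd; simpl.
  - exact (is_derive_const (K := R_AbsRing) (V := R_NormedModule) _ _).
  - exact (is_derive_id (K := R_AbsRing) _).
Qed.

Lemma Ck_const n : forall O c, Ck n O (fun _ => c).
Proof.
  induction n; intros O c; [split; [intros; apply continuous_const | exact I]|].
  rewrite Ck_S. split; [intros; apply continuous_const|]. split.
  - intros d p _. rewrite (is_pd_unique d _ p 0); apply is_pd_const.
  - intros d. assert (E : DD d (fun _ : R * R => c) = fun _ => 0).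
    { apply FunctionalExtensionality.functional_extensionality; intros p.
      apply is_pd_unique, is_pd_const. }
    rewrite E; apply IHn.
Qed.

Lemma Ck_plus n : forall O f g, open O ->
  Ck n O f -> Ck n O g -> Ck n O (fun q => f q + g q).
Proof.
  induction n; intros O f g oO.
  - intros [Cf _] [Cg _]; split; [|exact I].
    intros; apply (continuous_plus f g); auto.
  - rewrite !(Ck_S n O f), (Ck_S n O g). intros (Cf & Df & Kf) (Cg & Dg & Kg).
    apply Ck_intro with (f' := fun d q => DD d f q + DD d g q); auto.
    + intros; apply (continuous_plus f g); auto.
    + intros; apply is_pd_plus; auto.
Qed.

Lemma Ck_mult n : forall O f g, open O ->
  Ck n O f -> Ck n O g -> Ck n O (fun q => f q * g q).
Proof.
  induction n; intros O f g oO.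
  - intros [Cf _] [Cg _]; split; [|exact I].
    intros; apply (continuous_mult (K := R_AbsRing) f g); auto.
  - intros Hf Hg. assert (Hf' := Ck_pred _ _ _ Hf). assert (Hg' := Ck_pred _ _ _ Hg).
    rewrite Ck_S in Hf, Hg. destruct Hf as (Cf & Df & Kf), Hg as (Cg & Dg & Kg).
    apply Ck_intro with (f' := fun d q => DD d f q * g q + f q * DD d g q); auto.
    + intros; apply (continuous_mult (K := R_AbsRing) f g); auto.
    + intros; apply is_pd_mult; auto.
    + intros d. apply Ck_plus; auto.
Qed.

Lemma Ck_opp n O f : open O -> Ck n O f -> Ck n O (fun q => - f q).
Proof.
  intros oO H. apply (Ck_ext n O (fun q => -1 * f q)); auto.
  - intros; ring.
  - apply Ck_mult; auto using Ck_const.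
Qed.

Lemma Ck_minus n O f g :
  open O -> Ck n O f -> Ck n O g -> Ck n O (fun q => f q - g q).
Proof. intros; apply Ck_plus; auto using Ck_opp. Qed.

Lemma Ck_inv n : forall O f, open O -> (forall p, O p -> f p <> 0) ->
  Ck n O f -> Ck n O (fun q => / f q).
Proof.
  induction n; intros O f oO nz H.
  - destruct H as [Cf _]; split; [|exact I].
    intros p Op. apply (continuous_comp f Rinv); auto.
    apply continuous_Rinv; auto.
  - assert (H' := Ck_pred _ _ _ H). rewrite Ck_S in H. destruct H as (Cf & Df & Kf).
    apply Ck_intro with (f' := fun d q => - (/ f q * / f q) * DD d f q); auto.
    + intros p Op. apply (continuous_comp f Rinv); auto.
      apply continuous_Rinv; auto.
    + intros; apply is_pd_inv; auto.
    + intros d; apply Ck_mult; auto. apply Ck_opp; auto. apply Ck_mult; auto.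
Qed.

Lemma Ck_sqrt n : forall O f, open O -> (forall p, O p -> 0 < f p) ->
  Ck n O f -> Ck n O (fun q => sqrt (f q)).
Proof.
  assert (CS : forall O f, (forall p, O p -> continuous f p) -> forall p : R * R,
     O p -> continuous (fun q => sqrt (f q)) p).
  { intros O f Cf p Op. apply (continuous_comp f sqrt); auto. apply continuous_sqrt. }
  induction n; intros O f oO pos H.
  - destruct H as [Cf _]; split; [|exact I]. now apply CS.
  - assert (H' := Ck_pred _ _ _ H). rewrite Ck_S in H. destruct H as (Cf & Df & Kf).
    apply Ck_intro with (f' := fun d q => / 2 * / sqrt (f q) * DD d f q); auto.
    + now apply CS.
    + intros; apply is_pd_sqrt; auto.
    + intros d; apply Ck_mult; auto. apply Ck_mult; auto using Ck_const.
      apply Ck_inv; auto. intros p Op. now apply Rgt_not_eq, sqrt_lt_R0, pos.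
Qed.

Lemma Ck_fst n O : open O -> Ck n O fst.
Proof.
  intros oO; destruct n.
  - split; [intros; apply continuous_fst | exact I].
  - apply Ck_intro with (f' := fun (d : bool) (_ : R * R) => if d then 1 else 0); auto.
    + intros; apply continuous_fst.
    + intros; apply is_pd_fst.
    + intros; apply Ck_const.
Qed.

Lemma Ck_snd n O : open O -> Ck n O snd.
Proof.
  intros oO; destruct n.
  - split; [intros; apply continuous_snd | exact I].
  - apply Ck_intro with (f' := fun (d : bool) (_ : R * R) => if d then 0 else 1); auto.
    + intros; apply continuous_snd.
    + intros; apply is_pd_snd.
    + intros; apply Ck_const.
Qed.

(** Mean value theorem in the first variable, differentiability in the second; this is why
    continuity is asked of the first partial derivative only. *)
Lemma partials_differentiable (O : R * R -> Prop) f (f' : bool -> R * R -> R) p :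
  open O -> (forall d q, O q -> is_pd d f q (f' d q)) ->
  (forall q, O q -> continuous (f' true) q) -> O p ->
  differentiable_pt_lim (fun x y => f (x, y)) (fst p) (snd p) (f' true p) (f' false p).
Proof.
  intros oO D C Op.
  apply filterdiff_differentiable_pt_lim.
  generalize (is_derive_filterdiff (fun x y => f (x, y)) (fst p) (snd p)
            (fun x y => f' true (x, y)) (f' false p)).
  rewrite <- surjective_pairing. intros X; apply X; clear X.
  - apply (filter_imp O); [|now apply oO].
    intros q Oq. generalize (D true q Oq). now destruct q.
  - exact (D false p Op).
  - apply (continuous_ext (f' true)); [now intros [] | auto].
Qed.

Lemma C1_differentiable O f p : open O -> Ck 1 O f -> O p ->
  differentiable_pt_lim (fun x y => f (x, y)) (fst p) (snd p) (DD true f p) (DD false f p).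
Proof.
  intros oO H Op. rewrite Ck_S in H. destruct H as (C & D & K).
  apply (partials_differentiable O f (fun d => DD d f)); auto.
  intros q Oq. now apply (Ck_continuous 0 O).
Qed.

Lemma differentiable_continuous f p l1 l2 :
  differentiable_pt_lim (fun x y => f (x, y)) (fst p) (snd p) l1 l2 -> continuous f p.
Proof.
  intros H. assert (C : continuity_2d_pt (fun x y => f (x, y)) (fst p) (snd p)).
  { apply differentiable_continuity_pt. now exists l1, l2. }
  apply continuity_2d_pt_filterlim in C. rewrite <- surjective_pairing in C.
  revert C. apply filterlim_ext. intros q; now rewrite <- surjective_pairing.
Qed.

Lemma differentiable_is_pd d f p l1 l2 :
  differentiable_pt_lim (fun x y => f (x, y)) (fst p) (snd p) l1 l2 ->
  is_pd d f p (if d then l1 else l2).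
Proof.
  intros H. apply is_derive_Reals. destruct d; simpl.
  - replace l1 with (l1 * 1 + l2 * 0) by ring.
    apply (derivable_pt_lim_comp_2d (fun x y => f (x, y)) (fun t => t) (fun _ => snd p)); auto.
    + apply derivable_pt_lim_id.
    + apply derivable_pt_lim_const.
  - replace l2 with (l1 * 0 + l2 * 1) by ring.
    apply (derivable_pt_lim_comp_2d (fun x y => f (x, y)) (fun _ => fst p) (fun t => t)); auto.
    + apply derivable_pt_lim_const.
    + apply derivable_pt_lim_id.
Qed.

(** Serves the primitive of a closed form, whose partial derivatives are known before its continuity
    is. *)
Lemma smooth_of_partials O f (f' : bool -> R * R -> R) : open O ->
  (forall d q, O q -> is_pd d f q (f' d q)) -> (forall d, smooth O (f' d)) -> smooth O f.
Proof.
  intros oO D S.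
  assert (C : forall p, O p -> continuous f p).
  { intros p Op. eapply differentiable_continuous.
    apply (partials_differentiable O f f'); auto.
    intros q Oq; now apply (Ck_continuous 0 O); [apply S|]. }
  intros [|n]; [now split|].
  apply Ck_intro with (f' := f'); auto. intros d; apply S.
Qed.

Lemma is_derive_chain O f (c1 c2 : R -> R) t l1 l2 : open O -> Ck 1 O f ->
  O (c1 t, c2 t) -> is_derive c1 t l1 -> is_derive c2 t l2 ->
  is_derive (fun s => f (c1 s, c2 s)) t
    (DD true f (c1 t, c2 t) * l1 + DD false f (c1 t, c2 t) * l2).
Proof.
  intros oO H Op H1 H2. apply is_derive_Reals.
  apply (derivable_pt_lim_comp_2d (fun x y => f (x, y))).
  - apply (C1_differentiable O f (c1 t, c2 t)); auto.
  - now apply is_derive_Reals.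
  - now apply is_derive_Reals.
Qed.

Lemma is_pd_chain d W f (h : R * R -> R * R) p l1 l2 : open W -> Ck 1 W f ->
  W (h p) -> is_pd d (fun q => fst (h q)) p l1 -> is_pd d (fun q => snd (h q)) p l2 ->
  is_pd d (fun q => f (h q)) p (DD true f (h p) * l1 + DD false f (h p) * l2).
Proof.
  intros oW H Wp H1 H2.
  generalize (is_derive_chain W f (fun t => fst (h (slice d p t)))
    (fun t => snd (h (slice d p t))) (coord d p) l1 l2 oW H).
  cbv beta. rewrite slice_coord, <- surjective_pairing.
  intros X. apply (is_derive_ext (fun t => f (fst (h (slice d p t)), snd (h (slice d p t))))).
  - intros t. now rewrite <- surjective_pairing.
  - exact (X Wp H1 H2).
Qed.

Lemma Ck_comp n : forall O W f (h : R * R -> R * R), open O -> open W ->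
  (forall p, O p -> W (h p)) ->
  Ck n O (fun q => fst (h q)) -> Ck n O (fun q => snd (h q)) -> Ck n W f ->
  Ck n O (fun q => f (h q)).
Proof.
  assert (CC : forall O W (f : R * R -> R) (h : R * R -> R * R), 
    (forall p, O p -> W (h p)) -> forall p, O p -> continuous (fun q => fst (h q)) p ->
    continuous (fun q => snd (h q)) p -> continuous f (h p) ->
    continuous (fun q => f (h q)) p).
  { intros O W f h m p Op C1 C2 Cf.
    apply (continuous_ext (fun q => f (fst (h q), snd (h q)))).
    { intros q; now rewrite <- surjective_pairing. }
    apply (continuous_comp_2 (fun q => fst (h q)) (fun q => snd (h q)) (fun x y => f (x, y))); auto.
    apply (continuous_ext f).
    { now intros []. }
    now rewrite <- surjective_pairing. }
  induction n; intros O W f h oO oW m H1 H2 Hf.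
  - split; [|exact I]. intros p Op. apply (CC O W); auto.
    + now apply (Ck_continuous 0 O (fun q => fst (h q))).
    + now apply (Ck_continuous 0 O (fun q => snd (h q))).
    + now apply (Ck_continuous 0 W); auto.
  - assert (Hf1 : Ck 1 W f).
    { clear - Hf. revert f Hf. induction n; auto using Ck_pred. }
    assert (H1' := Ck_pred _ _ _ H1). assert (H2' := Ck_pred _ _ _ H2).
    rewrite Ck_S in H1, H2, Hf. destruct H1 as (C1 & D1 & K1), H2 as (C2 & D2 & K2),
      Hf as (Cf & Df & Kf).
    apply Ck_intro with (f' := fun d q =>
      DD true f (h q) * DD d (fun q => fst (h q)) q +
      DD false f (h q) * DD d (fun q => snd (h q)) q); auto.
    + intros p Op. apply (CC O W); auto.
    + intros d p Op. apply (is_pd_chain d W f h); auto.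
    + intros d. apply Ck_plus; auto; apply Ck_mult; auto.
      * apply (IHn O W (DD true f)); auto.
      * apply (IHn O W (DD false f)); auto.
Qed.

Lemma smooth_pd O f d p : smooth O f -> O p -> is_pd d f p (DD d f p).
Proof. intros H Op. specialize (H 1%nat). rewrite Ck_S in H. now apply H. Qed.

Lemma smooth_DD O f d : smooth O f -> smooth O (DD d f).
Proof. intros H n. specialize (H (S n)). rewrite Ck_S in H. now apply H. Qed.

Lemma smooth_continuous O f p : smooth O f -> O p -> continuous f p.
Proof. intros H. apply (Ck_continuous 0), H. Qed.

Lemma smooth_sub (O O' : R * R -> Prop) f :
  (forall p, O' p -> O p) -> smooth O f -> smooth O' f.
Proof. intros S H n; now apply (Ck_sub n O). Qed.

Lemma smooth_ext O f g :
  open O -> (forall q, O q -> f q = g q) -> smooth O f -> smooth O g.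
Proof. intros oO E H n; now apply (Ck_ext n O f). Qed.

Lemma smooth_comp O W f (h : R * R -> R * R) : open O -> open W ->
  (forall p, O p -> W (h p)) -> smooth_map O h -> smooth W f ->
  smooth O (fun q => f (h q)).
Proof. intros oO oW m [H1 H2] Hf n; now apply (Ck_comp n O W). Qed.

Lemma continuity_2d_continuous (f : R * R -> R) x y :
  continuous f (x, y) -> continuity_2d_pt (fun u v => f (u, v)) x y.
Proof.
  intros H. apply continuity_2d_pt_filterlim.
  now apply (filterlim_ext f); [intros []|].
Qed.

Lemma DD_comm O f p : open O -> smooth O f -> O p ->
  DD true (DD false f) p = DD false (DD true f) p.
Proof.
  intros oO H Op. destruct p as [x y].
  apply (Schwarz (fun x y => f (x, y)) x y).
  - apply (locally_2d_locally (fun u v => _ /\ _)).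
    apply (filter_imp O); [|now apply oO].
    intros [u v] Ouv; simpl. repeat split; eexists.
    + exact (smooth_pd O f true (u, v) H Ouv).
    + exact (smooth_pd O f false (u, v) H Ouv).
    + exact (smooth_pd O (DD false f) true (u, v) (smooth_DD O f _ H) Ouv).
    + exact (smooth_pd O (DD true f) false (u, v) (smooth_DD O f _ H) Ouv).
  - apply (continuity_2d_continuous (DD true (DD false f))).
    apply (smooth_continuous O); auto using smooth_DD.
  - apply (continuity_2d_continuous (DD false (DD true f))).
    apply (smooth_continuous O); auto using smooth_DD.
Qed.

(** * Squares: mean value estimates and a fixed point theorem *)

Definition box (p : R * R) (r : R) (q : R * R) : Prop :=
  Rabs (fst q - fst p) < r /\ Rabs (snd q - snd p) < r.

Lemma box_center p r : 0 < r -> box p r p.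
Proof. intros; split; now rewrite Rminus_diag, Rabs_R0. Qed.

Lemma locally_box p (O : R * R -> Prop) :
  locally p O <-> exists r, 0 < r /\ forall q, box p r q -> O q.
Proof.
  split.
  - intros [e H]. exists e. split; [apply cond_pos|].
    intros q [H1 H2]. apply H. split; [exact H1 | exact H2].
  - intros (r & pos & H). exists (mkposreal r pos). intros q [H1 H2].
    apply H; split; [exact H1 | exact H2].
Qed.

Lemma open_box p r : open (box p r).
Proof.
  enough (X : forall q : R * R, box p r q -> locally q (box p r)) by exact X.
  intros q [H1 H2]. apply locally_box.
  exists (Rmin (r - Rabs (fst q - fst p)) (r - Rabs (snd q - snd p))).
  split; [apply Rmin_pos; lra|].
  intros z [Z1 Z2].
  assert (A1 := Rmin_l (r - Rabs (fst q - fst p)) (r - Rabs (snd q - snd p))).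
  assert (A2 := Rmin_r (r - Rabs (fst q - fst p)) (r - Rabs (snd q - snd p))).
  split.
  - replace (fst z - fst p) with ((fst z - fst q) + (fst q - fst p)) by ring.
    generalize (Rabs_triang (fst z - fst q) (fst q - fst p)); lra.
  - replace (snd z - snd p) with ((snd z - snd q) + (snd q - snd p)) by ring.
    generalize (Rabs_triang (snd z - snd q) (snd q - snd p)); lra.
Qed.

Lemma continuous_box (f : R * R -> R) p : continuous f p -> forall e, 0 < e ->
  exists r, 0 < r /\ forall q, box p r q -> Rabs (f q - f p) < e.
Proof.
  intros C e pos. apply locally_box.
  apply (C (fun z => Rabs (z - f p) < e)). exists (mkposreal e pos).
  intros z Hz; exact Hz.
Qed.

Lemma locally_nz (f : R * R -> R) p :
  continuous f p -> f p <> 0 -> locally p (fun q => f q <> 0).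
Proof.
  intros C nz. apply locally_box.
  destruct (continuous_box f p C (Rabs (f p)) (Rabs_pos_lt _ nz)) as (r & pos & H).
  exists r; split; [exact pos|]. intros q Hq E. specialize (H q Hq).
  rewrite E, Rminus_0_l, Rabs_Ropp in H. lra.
Qed.

Lemma open_preimage_box (O : R * R -> Prop) (h : R * R -> R * R) w r : open O ->
  (forall p, O p -> continuous (fun q => fst (h q)) p) ->
  (forall p, O p -> continuous (fun q => snd (h q)) p) ->
  open (fun p => O p /\ box w r (h p)).
Proof.
  intros oO C1 C2 p [Op Bp]. apply filter_and; [now apply oO|].
  destruct (proj1 (locally_box (h p) (box w r)) (open_box w r (h p) Bp)) as (e & pos & H).
  destruct (continuous_box _ p (C1 p Op) e pos) as (r1 & pos1 & H1).
  destruct (continuous_box _ p (C2 p Op) e pos) as (r2 & pos2 & H2).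
  apply locally_box. exists (Rmin r1 r2); split; [now apply Rmin_pos|].
  intros q [Q1 Q2]. generalize (Rmin_l r1 r2) (Rmin_r r1 r2); intros.
  apply H; split; [apply H1 | apply H2]; split; lra.
Qed.

Lemma slice_mean_value d (O : R * R -> Prop) f q s t c e : Ck 1 O f ->
  (forall x, Rmin s t <= x <= Rmax s t ->
     O (slice d q x) /\ Rabs (DD d f (slice d q x) - c) <= e) ->
  Rabs (f (slice d q t) - f (slice d q s) - c * (t - s)) <= e * Rabs (t - s).
Proof.
  intros K H. rewrite Ck_S in K. destruct K as (_ & D & _).
  assert (DD' : forall x, Rmin s t <= x <= Rmax s t ->
    is_derive (fun x => f (slice d q x)) x (DD d f (slice d q x))).
  { intros x Hx. generalize (D d (slice d q x) (proj1 (H x Hx))). unfold is_pd.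
    now destruct d. }
  destruct (MVT_gen (fun x => f (slice d q x)) s t (fun x => DD d f (slice d q x)))
    as (x & Hx & E).
  - intros x Hx; apply DD'; lra.
  - intros x Hx. apply continuity_pt_filterlim.
    apply (ex_derive_continuous (K := R_AbsRing) (V := R_NormedModule)).
    eexists. now apply DD'.
  - cbv beta in E. rewrite E.
    replace (DD d f (slice d q x) * (t - s) - c * (t - s))
      with ((DD d f (slice d q x) - c) * (t - s)) by ring.
    rewrite Rabs_mult. apply Rmult_le_compat_r; [apply Rabs_pos|]. now apply H.
Qed.

Lemma between_abs s t x c r : Rmin s t <= x <= Rmax s t ->
  Rabs (s - c) < r -> Rabs (t - c) < r -> Rabs (x - c) < r.
Proof.
  intros H Hs Ht. apply Rabs_def2 in Hs, Ht. apply Rabs_def1.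
  - generalize (Rmax_lub_lt s t (c + r)). lra.
  - generalize (Rmin_glb_lt s t (c - r)). lra.
Qed.

(** The increment is split along a horizontal and then a vertical segment, both of which stay in the
    square. *)
Lemma box_mean_value f p r c1 c2 e q q' : Ck 1 (box p r) f ->
  (forall z, box p r z -> Rabs (DD true f z - c1) <= e /\ Rabs (DD false f z - c2) <= e) ->
  box p r q -> box p r q' ->
  Rabs (f q' - f q - (c1 * (fst q' - fst q) + c2 * (snd q' - snd q))) <=
  e * (Rabs (fst q' - fst q) + Rabs (snd q' - snd q)).
Proof.
  intros K H [Q1 Q2] [Q1' Q2'].
  assert (A := slice_mean_value true _ f q (fst q) (fst q') c1 e K).
  assert (B := slice_mean_value false _ f (fst q', snd q) (snd q) (snd q') c2 e K).
  simpl in A, B. rewrite <- !surjective_pairing in A, B.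
  lapply A; [clear A; intros A | intros x Hx].
  2: { assert (Bx : box p r (x, snd q)).
       { split; [eapply between_abs; eauto | exact Q2]. }
       split; [exact Bx | now apply (H (x, snd q))]. }
  lapply B; [clear B; intros B | intros x Hx].
  2: { assert (Bx : box p r (fst q', x)).
       { split; [exact Q1' | eapply between_abs; eauto]. }
       split; [exact Bx | now apply (H (fst q', x))]. }
  eapply Rle_trans; [|eapply Rle_trans; [apply (Rplus_le_compat _ _ _ _ A B)|right; ring]].
  eapply Rle_trans; [|apply Rabs_triang]. right; f_equal; ring.
Qed.

(** Banach's theorem for the sum norm on a closed diamond: a first step of at most [e / 2] and the
    ratio [1 / 2] keep every iterate within [e] of the centre. *)
Lemma contraction_fixpoint (G : R * R -> R * R) (p0 : R * R) (e : R) : 0 < e ->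
  let dia p := Rabs (fst p - fst p0) + Rabs (snd p - snd p0) <= e in
  (forall p q, dia p -> dia q ->
     Rabs (fst (G p) - fst (G q)) + Rabs (snd (G p) - snd (G q)) <=
     / 2 * (Rabs (fst p - fst q) + Rabs (snd p - snd q))) ->
  Rabs (fst (G p0) - fst p0) + Rabs (snd (G p0) - snd p0) <= e / 2 ->
  exists p, dia p /\ G p = p.
Proof.
  intros pos dia L S0.
  assert (D0 : dia p0).
  { unfold dia. rewrite !Rminus_diag, Rabs_R0. lra. }
  pose (P := fun n => Nat.iter n G p0).
  assert (PD : forall n, dia (P n)).
  { induction n; [exact D0|]. simpl. fold (P n).
    assert (X := L (P n) p0 IHn D0). unfold dia in IHn |- *.
    assert (T1 := Rabs_triang (fst (G (P n)) - fst (G p0)) (fst (G p0) - fst p0)).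
    assert (T2 := Rabs_triang (snd (G (P n)) - snd (G p0)) (snd (G p0) - snd p0)).
    replace (fst (G (P n)) - fst p0)
      with ((fst (G (P n)) - fst (G p0)) + (fst (G p0) - fst p0)) by ring.
    replace (snd (G (P n)) - snd p0)
      with ((snd (G (P n)) - snd (G p0)) + (snd (G p0) - snd p0)) by ring.
    lra. }
  assert (PS : forall n, Rabs (fst (P (S n)) - fst (P n)) + Rabs (snd (P (S n)) - snd (P n))
                 <= e * (/ 2) ^ n).
  { induction n.
    - simpl. lra.
    - assert (X := L (P (S n)) (P n) (PD (S n)) (PD n)).
      change (G (P (S n))) with (P (S (S n))) in X. change (G (P n)) with (P (S n)) in X.
      simpl pow. lra. }
  (* The sequence is a telescoping series dominated by a geometric one. *)
  assert (CV : forall x : nat -> R, (forall n, Rabs (x (S n) - x n) <= e * (/ 2) ^ n) ->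
            exists l : R, is_lim_seq x l).
  { intros x Hx.
    assert (ES : ex_series (fun n => x (S n) - x n)).
    { apply (ex_series_le (K := R_AbsRing) (V := R_CompleteNormedModule)
               _ (fun n => e * (/ 2) ^ n)).
      - exact Hx.
      - apply (ex_series_scal_l (K := R_AbsRing) (V := R_NormedModule) e).
        apply ex_series_geom. rewrite Rabs_pos_eq; lra. }
    destruct ES as [l Hl]. exists (l + x 0%nat).
    apply is_lim_seq_incr_1.
    apply (is_lim_seq_ext (fun n => sum_n (fun n => x (S n) - x n) n + x 0%nat)).
    - induction n.
      + rewrite sum_O. ring.
      + rewrite sum_Sn. unfold plus; simpl. lra.
    - apply is_lim_seq_plus'; [exact Hl | apply is_lim_seq_const]. }
  destruct (CV (fun n => fst (P n))) as [x Hx].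
  { intros n. generalize (PS n) (Rabs_pos (snd (P (S n)) - snd (P n))); lra. }
  destruct (CV (fun n => snd (P n))) as [y Hy].
  { intros n. generalize (PS n) (Rabs_pos (fst (P (S n)) - fst (P n))); lra. }
  assert (Dx : forall c, is_lim_seq (fun n => Rabs (fst (P n) - c)) (Rabs (x - c))).
  { intros c. apply (is_lim_seq_abs _ (Finite (x - c))).
    apply is_lim_seq_minus'; [exact Hx | apply is_lim_seq_const]. }
  assert (Dy : forall c, is_lim_seq (fun n => Rabs (snd (P n) - c)) (Rabs (y - c))).
  { intros c. apply (is_lim_seq_abs _ (Finite (y - c))).
    apply is_lim_seq_minus'; [exact Hy | apply is_lim_seq_const]. }
  assert (Dl : dia (x, y)).
  { unfold dia; simpl.
    apply (is_lim_seq_le (fun n => Rabs (fst (P n) - fst p0) + Rabs (snd (P n) - snd p0))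
             (fun _ => e) (Rabs (x - fst p0) + Rabs (y - snd p0)) e).
    - intros n; apply PD.
    - apply is_lim_seq_plus'; auto.
    - apply is_lim_seq_const. }
  exists (x, y). split; [exact Dl|].
  (* The contraction inequality between [P n] and the limit passes to the limit, where its right
     side is zero. *)
  assert (Z : Rabs (x - fst (G (x, y))) + Rabs (y - snd (G (x, y))) <=
              / 2 * (Rabs (x - x) + Rabs (y - y))).
  { apply (is_lim_seq_le
      (fun n => Rabs (fst (P (S n)) - fst (G (x, y))) + Rabs (snd (P (S n)) - snd (G (x, y))))
      (fun n => / 2 * (Rabs (fst (P n) - x) + Rabs (snd (P n) - y)))
      (Rabs (x - fst (G (x, y))) + Rabs (y - snd (G (x, y))))
      (/ 2 * (Rabs (x - x) + Rabs (y - y)))).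
    - intros n. apply (L (P n) (x, y)); auto.
    - apply is_lim_seq_plus'.
      + apply (is_lim_seq_incr_1 (fun n => Rabs (fst (P n) - fst (G (x, y))))), Dx.
      + apply (is_lim_seq_incr_1 (fun n => Rabs (snd (P n) - snd (G (x, y))))), Dy.
    - apply (is_lim_seq_scal_l _ (/ 2) (Finite (Rabs (x - x) + Rabs (y - y)))).
      apply is_lim_seq_plus'; auto. }
  rewrite !Rminus_diag, Rabs_R0 in Z.
  rewrite (surjective_pairing (G (x, y))).
  generalize (Rabs_pos (x - fst (G (x, y)))) (Rabs_pos (y - snd (G (x, y)))); intros.
  f_equal; symmetry; apply Rminus_diag_uniq; apply Rabs_eq_0; lra.
Qed.

(** * Inverse functions and closed forms in the plane *)

Definition jac (h : R * R -> R * R) (p : R * R) : R :=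
  DD true (fun q => fst (h q)) p * DD false (fun q => snd (h q)) p -
  DD false (fun q => fst (h q)) p * DD true (fun q => snd (h q)) p.

(* [A] is the inverse of the derivative at [p], so that [id - A o h] is a contraction. *)
Lemma inverse_function_estimate (O : R * R -> Prop) h (p : R * R) : open O -> O p -> smooth_map O h -> jac h p <> 0 ->
  exists r a a11 a12 a21 a22, 0 < r /\ 0 < a /\ (forall q, box p r q -> O q) /\
    (forall x y, Rabs (a11 * x + a12 * y) + Rabs (a21 * x + a22 * y) <= a * (Rabs x + Rabs y)) /\
    (forall x y, a11 * x + a12 * y = 0 -> a21 * x + a22 * y = 0 -> x = 0 /\ y = 0) /\
    forall q q', box p r q -> box p r q' ->
    let du := fst (h q') - fst (h q) in let dv := snd (h q') - snd (h q) in
    Rabs (fst q' - fst q - (a11 * du + a12 * dv)) +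
    Rabs (snd q' - snd q - (a21 * du + a22 * dv)) <=
    / 2 * (Rabs (fst q' - fst q) + Rabs (snd q' - snd q)).
Proof.
  intros oO Op [Su Sv] nz. unfold jac in nz.
  pose (u := fun q => fst (h q)). pose (v := fun q => snd (h q)).
  fold u v in Su, Sv, nz.
  set (ux := DD true u p) in *. set (uy := DD false u p) in *.
  set (vx := DD true v p) in *. set (vy := DD false v p) in *.
  set (J := ux * vy - uy * vx) in *.
  pose (a11 := vy / J). pose (a12 := - uy / J). pose (a21 := - vx / J). pose (a22 := ux / J).
  pose (a := Rabs a11 + Rabs a12 + Rabs a21 + Rabs a22 + 1).
  assert (apos : 0 < a).
  { unfold a. generalize (Rabs_pos a11) (Rabs_pos a12) (Rabs_pos a21) (Rabs_pos a22); lra. }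
  (* Chosen so that [a * e = 1 / 2]: [e] bounds the oscillation of the partial derivatives, [a] the
     inverse of the derivative at [p]. *)
  pose (e := / (2 * a)).
  assert (epos : 0 < e) by (apply Rinv_0_lt_compat; lra).
  assert (NB : forall f, smooth O f -> forall d, exists r, 0 < r /\
     forall q, box p r q -> Rabs (DD d f q - DD d f p) < e).
  { intros f Sf d. apply continuous_box; [|exact epos].
    apply (smooth_continuous O); auto using smooth_DD. }
  destruct (NB u Su true) as (r1 & p1 & H1). destruct (NB u Su false) as (r2 & p2 & H2).
  destruct (NB v Sv true) as (r3 & p3 & H3). destruct (NB v Sv false) as (r4 & p4 & H4).
  destruct (proj1 (locally_box p O) (oO p Op)) as (r5 & p5 & H5).
  pose (r := Rmin r1 (Rmin r2 (Rmin r3 (Rmin r4 r5)))).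
  assert (rpos : 0 < r) by (unfold r; repeat apply Rmin_pos; auto).
  assert (rle : r <= r1 /\ r <= r2 /\ r <= r3 /\ r <= r4 /\ r <= r5).
  { generalize (Rmin_l r1 (Rmin r2 (Rmin r3 (Rmin r4 r5))))
      (Rmin_r r1 (Rmin r2 (Rmin r3 (Rmin r4 r5))))
      (Rmin_l r2 (Rmin r3 (Rmin r4 r5))) (Rmin_r r2 (Rmin r3 (Rmin r4 r5)))
      (Rmin_l r3 (Rmin r4 r5)) (Rmin_r r3 (Rmin r4 r5)) (Rmin_l r4 r5) (Rmin_r r4 r5).
    fold r. lra. }
  assert (mono : forall r', r <= r' -> forall q, box p r q -> box p r' q).
  { intros r' Hr q [B1 B2]; split; lra. }
  exists r, a, a11, a12, a21, a22.
  split; [exact rpos|]. split; [exact apos|].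
  split; [intros q Bq; apply H5, (mono r5); tauto|].
  assert (SUM : forall x y b c, Rabs (b * x + c * y) <= Rabs b * Rabs x + Rabs c * Rabs y).
  { intros. rewrite <- !Rabs_mult. apply Rabs_triang. }
  split; [|split].
  - intros x y. generalize (SUM x y a11 a12) (SUM x y a21 a22). unfold a.
    generalize (Rabs_pos a11) (Rabs_pos a12) (Rabs_pos a21) (Rabs_pos a22)
      (Rabs_pos x) (Rabs_pos y). nra.
  - intros x y E1 E2. unfold a11, a12, a21, a22 in E1, E2.
    assert (F1 : vy * x - uy * y = 0).
    { replace (vy * x - uy * y) with (J * (vy / J * x + - uy / J * y)) by now field.
      rewrite E1; ring. }
    assert (F2 : - vx * x + ux * y = 0).
    { replace (- vx * x + ux * y) with (J * (- vx / J * x + ux / J * y)) by now field.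
      rewrite E2; ring. }
    split; apply (Rmult_eq_reg_l J); auto; unfold J.
    + transitivity (ux * (vy * x - uy * y) + uy * (- vx * x + ux * y)); [ring|].
      rewrite F1, F2; ring.
    + transitivity (vx * (vy * x - uy * y) + vy * (- vx * x + ux * y)); [ring|].
      rewrite F1, F2; ring.
  - intros q q' Bq Bq' du dv.
    assert (sub : forall z, box p r z -> O z) by (intros z Bz; apply H5, (mono r5); tauto).
    assert (Eu := box_mean_value u p r ux uy e q q' (Ck_sub 1 O _ u sub (Su 1%nat))).
    assert (Ev := box_mean_value v p r vx vy e q q' (Ck_sub 1 O _ v sub (Sv 1%nat))).
    lapply Eu; [clear Eu; intros Eu | intros z Bz; split; apply Rlt_le;
      [apply H1, (mono r1) | apply H2, (mono r2)]; tauto].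
    lapply Ev; [clear Ev; intros Ev | intros z Bz; split; apply Rlt_le;
      [apply H3, (mono r3) | apply H4, (mono r4)]; tauto].
    specialize (Eu Bq Bq'). specialize (Ev Bq Bq').
    change (u q' - u q) with du in Eu. change (v q' - v q) with dv in Ev.
    set (dx := fst q' - fst q) in *. set (dy := snd q' - snd q) in *.
    set (s := Rabs dx + Rabs dy) in *.
    set (ru := du - (ux * dx + uy * dy)) in *. set (rv := dv - (vx * dx + vy * dy)) in *.
    replace (dx - (a11 * du + a12 * dv)) with (- (a11 * ru + a12 * rv))
      by (unfold ru, rv, a11, a12, J; field; exact nz).
    replace (dy - (a21 * du + a22 * dv)) with (- (a21 * ru + a22 * rv))
      by (unfold ru, rv, a21, a22, J; field; exact nz).
    rewrite !Rabs_Ropp.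
    apply Rle_trans with (a * (e * s)).
    + generalize (SUM ru rv a11 a12) (SUM ru rv a21 a22). unfold a.
      generalize (Rabs_pos a11) (Rabs_pos a12) (Rabs_pos a21) (Rabs_pos a22)
        (Rabs_pos ru) (Rabs_pos rv). nra.
    + right. unfold e. field. lra.
Qed.

(** The image is a full square, so that arguments along axis-parallel paths apply in the new
    coordinates. Bijectivity comes from the contraction estimate, smoothness of the inverse from
    differentiability followed by a bootstrap. *)
Lemma inverse_function (O : R * R -> Prop) h (p : R * R) : open O -> O p -> smooth_map O h ->
  (forall q, O q -> jac h q <> 0) ->
  exists (O' : R * R -> Prop) r, 0 < r /\ (forall q, O' q -> O q) /\ O' p /\
    diffeomorphism O' (box (h p) r) h.
Proof.
  intros oO Op S nz.
  destruct (inverse_function_estimate O h p oO Op S (nz p Op)) as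
    (r & a & a11 & a12 & a21 & a22 & rpos & apos & sub & bnd & inj & est).
  (* With [r / 2] the closed diamond lies in the open square; with this [rho] the first iteration
     step is at most [2 * a * rho = e / 4]. *)
  pose (e := r / 2). pose (rho := e / (8 * a)).
  assert (epos : 0 < e) by (unfold e; lra).
  assert (rhopos : 0 < rho) by (apply Rdiv_lt_0_compat; lra).
  assert (rhoE : a * rho = e / 8) by (unfold rho; field; lra).
  pose (W := box (h p) rho).
  assert (LIP : forall q q', box p r q -> box p r q' ->
    Rabs (fst q' - fst q) + Rabs (snd q' - snd q) <=
    2 * a * (Rabs (fst (h q') - fst (h q)) + Rabs (snd (h q') - snd (h q)))).
  { intros q q' Bq Bq'. assert (E := est q q' Bq Bq'). cbv zeta in E.
    assert (B := bnd (fst (h q') - fst (h q)) (snd (h q') - snd (h q))).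
    set (c1 := a11 * _ + _) in E, B. set (c2 := a21 * _ + _) in E, B.
    assert (T1 := Rabs_triang (fst q' - fst q - c1) c1).
    assert (T2 := Rabs_triang (snd q' - snd q - c2) c2).
    replace (fst q' - fst q - c1 + c1) with (fst q' - fst q) in T1 by ring.
    replace (snd q' - snd q - c2 + c2) with (snd q' - snd q) in T2 by ring. lra. }
  assert (INJ : forall q q', box p r q -> box p r q' -> h q = h q' -> q = q').
  { intros q q' Bq Bq' E. assert (L := LIP q q' Bq Bq'). rewrite E in L.
    rewrite !Rminus_diag, Rabs_R0 in L.
    generalize (Rabs_pos (fst q' - fst q)) (Rabs_pos (snd q' - snd q)); intros.
    rewrite (surjective_pairing q), (surjective_pairing q').
    f_equal; symmetry; apply Rminus_diag_uniq, Rabs_eq_0; lra. }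
  assert (SUR : forall w, W w -> exists q, box p r q /\ h q = w).
  { intros w [W1 W2].
    pose (G := fun q => (fst q - (a11 * (fst (h q) - fst w) + a12 * (snd (h q) - snd w)),
                         snd q - (a21 * (fst (h q) - fst w) + a22 * (snd (h q) - snd w)))).
    assert (dia_box : forall q, Rabs (fst q - fst p) + Rabs (snd q - snd p) <= e -> box p r q).
    { intros q Hq. generalize (Rabs_pos (fst q - fst p)) (Rabs_pos (snd q - snd p)).
      intros; unfold e in Hq; split; lra. }
    destruct (contraction_fixpoint G p e epos) as (q & Dq & Eq).
    - intros q1 q2 B1 B2. apply dia_box in B1, B2.
      assert (E := est q2 q1 B2 B1). cbv zeta in E.
      eapply Rle_trans; [|exact E]. right. unfold G; simpl. f_equal; apply f_equal; ring.
    - unfold G; simpl.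
      assert (B := bnd (fst (h p) - fst w) (snd (h p) - snd w)).
      rewrite (Rabs_minus_sym (fst (h p))), (Rabs_minus_sym (snd (h p))) in B.
      set (c1 := a11 * _ + _) in B |- *. set (c2 := a21 * _ + _) in B |- *.
      replace (fst p - c1 - fst p) with (- c1) by ring.
      replace (snd p - c2 - snd p) with (- c2) by ring.
      rewrite !Rabs_Ropp. nra.
    - exists q. split; [now apply dia_box|].
      unfold G in Eq. apply (f_equal fst) in Eq as E1. apply (f_equal snd) in Eq as E2.
      simpl in E1, E2.
      destruct (inj (fst (h q) - fst w) (snd (h q) - snd w)); try lra.
      rewrite (surjective_pairing (h q)), (surjective_pairing w). f_equal; lra. }
  pose (O' := fun q => box p r q /\ W (h q)).
  assert (oO' : open O').
  { apply open_preimage_box; [apply open_box| |]; intros q Bq;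
    apply (smooth_continuous O); auto; apply S. }
  pose (k := fun w => epsilon (inhabits p) (fun q => box p r q /\ h q = w)).
  assert (kP : forall w, W w -> box p r (k w) /\ h (k w) = w).
  { intros w Ww. apply epsilon_spec, SUR, Ww. }
  assert (kO' : forall w, W w -> O' (k w)).
  { intros w Ww. destruct (kP w Ww) as [B E]. split; [exact B | now rewrite E]. }
  exists O', rho. split; [exact rhopos|]. split; [intros q [Bq _]; auto|].
  split; [split; now apply box_center|].
  pose (u := fun q => fst (h q)). pose (v := fun q => snd (h q)).
  destruct S as [Su Sv].
  assert (Su' : smooth O' u) by (apply (smooth_sub O); [intros q [Bq _]; auto | exact Su]).
  assert (Sv' : smooth O' v) by (apply (smooth_sub O); [intros q [Bq _]; auto | exact Sv]).
  assert (nz' : forall q, O' q -> jac h q <> 0) by (intros q [Bq _]; auto).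
  split; [exact oO'|]. split; [apply open_box|]. split; [now split|].
  split; [intros q [_ Hq]; exact Hq|].
  exists k. split; [|split; [exact kO'|split]].
  2: { intros q [Bq Wq]. destruct (kP (h q) Wq). now apply INJ. }
  2: { intros w Ww. now apply kP. }
  assert (DIF : forall w, W w ->
    differentiable_pt_lim (fun x y => fst (k (x, y))) (fst w) (snd w)
      (DD false v (k w) / jac h (k w)) (- DD false u (k w) / jac h (k w)) /\
    differentiable_pt_lim (fun x y => snd (k (x, y))) (fst w) (snd w)
      (- DD true v (k w) / jac h (k w)) (DD true u (k w) / jac h (k w))).
  { intros w Ww. assert (Ok := kO' w Ww). assert (Jk := nz' _ Ok).
    destruct (kP w Ww) as [Bk Ek].
    assert (Ju : jac h (k w) = DD true u (k w) * DD false v (k w) -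
                               DD false u (k w) * DD true v (k w)) by reflexivity.
    assert (DU := C1_differentiable O' u (k w) oO' (Su' 1%nat) Ok).
    assert (DV := C1_differentiable O' v (k w) oO' (Sv' 1%nat) Ok).
    set (ux := DD true u (k w)) in *. set (uy := DD false u (k w)) in *.
    set (vx := DD true v (k w)) in *. set (vy := DD false v (k w)) in *.
    set (J := jac h (k w)) in *.
    pose (m := Rabs ux + Rabs uy + Rabs vx + Rabs vy + 1).
    assert (mp : Rabs ux <= m /\ Rabs uy <= m /\ Rabs vx <= m /\ Rabs vy <= m /\ 0 < m).
    { unfold m. generalize (Rabs_pos ux) (Rabs_pos uy) (Rabs_pos vx) (Rabs_pos vy).
      repeat split; lra. }
    assert (Jp := Rabs_pos_lt J Jk).
    (* The remainder of [k] at [w] is the inverse Jacobian matrix applied to the remainder of [h] at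
       [k w], up to sign; the Lipschitz bound measures it in terms of the increment of [w]. *)
    assert (KEY : forall eps : posreal, locally_2d (fun x y =>
      Rabs (fst (k (x, y)) - fst (k w) - (vy / J * (x - fst w) + - uy / J * (y - snd w)))
        <= eps * Rmax (Rabs (x - fst w)) (Rabs (y - snd w)) /\
      Rabs (snd (k (x, y)) - snd (k w) - (- vx / J * (x - fst w) + ux / J * (y - snd w)))
        <= eps * Rmax (Rabs (x - fst w)) (Rabs (y - snd w))) (fst w) (snd w)).
    { intros eps.
      (* Solves [2 * m * c * 4 * a / |J| = eps]: two remainders, matrix entries at most [m], and the
         Lipschitz factor [4 * a] relative to the maximum norm. *)
      pose (c := eps * Rabs J / (8 * a * m)).
      assert (cp : 0 < c).
      { unfold c. apply Rdiv_lt_0_compat; [apply Rmult_lt_0_compat; [apply cond_pos|lra]|].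
        repeat apply Rmult_lt_0_compat; lra. }
      destruct (DU (mkposreal c cp)) as [d1 H1]. destruct (DV (mkposreal c cp)) as [d2 H2].
      simpl in H1, H2.
      destruct (proj1 (locally_box w W) (open_box _ _ w Ww)) as (d3 & p3 & H3).
      pose (d := Rmin d3 (Rmin (d1 / (4 * a)) (d2 / (4 * a)))).
      assert (dp : 0 < d).
      { unfold d. repeat apply Rmin_pos; auto; apply Rdiv_lt_0_compat; try lra; apply cond_pos. }
      exists (mkposreal d dp). intros x y Hx Hy. simpl in Hx, Hy.
      assert (dl : d <= d3 /\ d <= d1 / (4 * a) /\ d <= d2 / (4 * a)).
      { generalize (Rmin_l d3 (Rmin (d1 / (4 * a)) (d2 / (4 * a))))
          (Rmin_r d3 (Rmin (d1 / (4 * a)) (d2 / (4 * a))))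
          (Rmin_l (d1 / (4 * a)) (d2 / (4 * a))) (Rmin_r (d1 / (4 * a)) (d2 / (4 * a))).
        fold d. lra. }
      assert (Wxy : W (x, y)) by (apply H3; split; simpl; lra).
      destruct (kP (x, y) Wxy) as [Bk' Ek'].
      assert (L := LIP (k w) (k (x, y)) Bk Bk'). rewrite Ek, Ek' in L. simpl in L.
      set (M := Rmax (Rabs (x - fst w)) (Rabs (y - snd w))).
      assert (M1 : Rabs (x - fst w) <= M) by apply Rmax_l.
      assert (M2 : Rabs (y - snd w) <= M) by apply Rmax_r.
      assert (M3 : M < d) by (apply Rmax_lub_lt; auto).
      assert (M0 : 0 <= M) by (eapply Rle_trans; [apply Rabs_pos | exact M1]).
      set (q := k (x, y)) in *.
      set (dx := fst q - fst (k w)) in *. set (dy := snd q - snd (k w)) in *.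
      assert (L' : Rabs dx + Rabs dy <= 4 * a * M).
      { eapply Rle_trans; [exact L|].
        replace (4 * a * M) with (2 * a * (M + M)) by ring.
        apply Rmult_le_compat_l; lra. }
      assert (F : forall z, d <= z / (4 * a) -> 4 * a * M < z).
      { intros z Hz. apply Rlt_le_trans with (4 * a * (z / (4 * a))).
        - apply Rmult_lt_compat_l; lra.
        - right; field; lra. }
      assert (F1 := F d1 (proj1 (proj2 dl))). assert (F2 := F d2 (proj2 (proj2 dl))).
      assert (Xp := Rabs_pos dx). assert (Yp := Rabs_pos dy).
      assert (G1 := H1 (fst q) (snd q)). assert (G2 := H2 (fst q) (snd q)).
      fold dx dy in G1, G2. rewrite <- !surjective_pairing in G1, G2.
      lapply G1; [clear G1; intros G1; lapply G1; [clear G1; intros G1|lra] | lra].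
      lapply G2; [clear G2; intros G2; lapply G2; [clear G2; intros G2|lra] | lra].
      unfold u in G1. unfold v in G2.
      rewrite Ek, Ek' in G1, G2. simpl in G1, G2.
      set (ru := x - fst w - (ux * dx + uy * dy)) in *.
      set (rv := y - snd w - (vx * dx + vy * dy)) in *.
      assert (MM : Rmax (Rabs dx) (Rabs dy) <= 4 * a * M) by (apply Rmax_lub; lra).
      assert (R1 : Rabs ru <= c * (4 * a * M)).
      { eapply Rle_trans; [exact G1|]. apply Rmult_le_compat_l; lra. }
      assert (R2 : Rabs rv <= c * (4 * a * M)).
      { eapply Rle_trans; [exact G2|]. apply Rmult_le_compat_l; lra. }
      assert (FIN : forall b1 b2, Rabs b1 <= m -> Rabs b2 <= m ->
                Rabs ((b1 * ru + b2 * rv) / J) <= eps * M).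
      { intros b1 b2 Hb1 Hb2. unfold Rdiv. rewrite Rabs_mult, Rabs_inv.
        apply Rle_trans with ((m * (c * (4 * a * M)) + m * (c * (4 * a * M))) * / Rabs J).
        - apply Rmult_le_compat_r; [apply Rlt_le, Rinv_0_lt_compat, Jp|].
          eapply Rle_trans; [apply Rabs_triang|]. rewrite !Rabs_mult.
          apply Rplus_le_compat; apply Rmult_le_compat; auto using Rabs_pos.
        - right. unfold c. field. repeat split; lra. }
      split.
      - replace (dx - (vy / J * (x - fst w) + - uy / J * (y - snd w)))
          with ((- vy * ru + uy * rv) / J).
        + apply FIN; [rewrite Rabs_Ropp|]; tauto.
        + unfold ru, rv. rewrite Ju in Jk |- *. now field.
      - replace (dy - (- vx / J * (x - fst w) + ux / J * (y - snd w)))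
          with ((vx * ru + - ux * rv) / J).
        + apply FIN; [|rewrite Rabs_Ropp]; tauto.
        + unfold ru, rv. rewrite Ju in Jk |- *. now field. }
    split; intros eps; generalize (KEY eps);
      apply locally_2d_impl, locally_2d_forall; intros x y [K1 K2];
      rewrite <- surjective_pairing; assumption. }
  assert (Ck' : forall n, Ck n W (fun w => fst (k w)) /\ Ck n W (fun w => snd (k w))).
  { assert (oW : open W) by apply open_box.
    assert (C1 : forall w, W w -> continuous (fun w => fst (k w)) w).
    { intros w Ww. eapply differentiable_continuous, DIF, Ww. }
    assert (C2 : forall w, W w -> continuous (fun w => snd (k w)) w).
    { intros w Ww. eapply differentiable_continuous, DIF, Ww. }
    (* Bootstrap: the partial derivatives of [k] are smooth functions composed with [k], so [k]
       gains one order of differentiability. *)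
    induction n as [|n [I1 I2]]; [repeat split; auto|].
    assert (Q : forall f, smooth O' f -> Ck n W (fun w => f (k w) / jac h (k w))).
    { intros f Sf. apply (Ck_comp n W O' (fun q => f q / jac h q) k); auto.
      apply Ck_mult; [exact oO' | apply Sf |]. apply Ck_inv; [exact oO' | exact nz' |].
      apply Ck_minus; auto; apply Ck_mult; auto; apply smooth_DD; assumption. }
    assert (Qm : forall f, smooth O' f -> Ck n W (fun w => - f (k w) / jac h (k w))).
    { intros f Sf. apply (Q (fun q => - f q)). intros m; apply Ck_opp; auto. }
    split.
    - apply Ck_intro with (f' := fun (d : bool) w => if d then DD false v (k w) / jac h (k w)
                                 else - DD false u (k w) / jac h (k w)); auto.
      + intros d w Ww. apply differentiable_is_pd. now apply DIF.
      + intros []; [apply Q | apply Qm]; now apply smooth_DD.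
    - apply Ck_intro with (f' := fun (d : bool) w => if d then - DD true v (k w) / jac h (k w)
                                 else DD true u (k w) / jac h (k w)); auto.
      + intros d w Ww. apply differentiable_is_pd. now apply DIF.
      + intros []; [apply Qm | apply Q]; now apply smooth_DD. }
  split; intros n; apply Ck'.
Qed.

Lemma box_between_fst (p : R * R) r x y t :
  box p r (x, y) -> Rmin (fst p) x <= t <= Rmax (fst p) x -> box p r (t, y).
Proof.
  intros [H1 H2] Ht; split; [|exact H2]. simpl in *.
  apply (between_abs (fst p) x); auto.
  rewrite Rminus_diag, Rabs_R0. generalize (Rabs_pos (x - fst p)); lra.
Qed.

Lemma box_between_snd (p : R * R) r x y t :
  box p r (x, y) -> Rmin (snd p) y <= t <= Rmax (snd p) y -> box p r (x, t).
Proof.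
  intros [H1 H2] Ht; split; [exact H1|]. simpl in *.
  apply (between_abs (snd p) y); auto.
  rewrite Rminus_diag, Rabs_R0. generalize (Rabs_pos (y - snd p)); lra.
Qed.

Lemma continuous_slice_comp d (O : R * R -> Prop) (f : R * R -> R) p t :
  (forall q, O q -> continuous f q) -> O (slice d p t) ->
  continuous (fun s => f (slice d p s)) t.
Proof.
  intros C H. apply (continuous_comp (slice d p) f); [apply continuous_slice | auto].
Qed.

Lemma poincare (p : R * R) r (P Q : R * R -> R) : 0 < r ->
  smooth (box p r) P -> smooth (box p r) Q ->
  (forall q, box p r q -> DD false P q = DD true Q q) ->
  exists B, smooth (box p r) B /\
    forall q, box p r q -> is_pd true B q (P q) /\ is_pd false B q (Q q).
Proof.
  intros rpos SP SQ cl. set (O := box p r) in *.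
  assert (oO : open O) by apply open_box.
  (* Integral of the form along the horizontal and then the vertical segment from the centre. *)
  pose (B := fun q : R * R => RInt (fun t => P (t, snd p)) (fst p) (fst q) +
                    RInt (fun t => Q (fst q, t)) (snd p) (snd q)).
  assert (Oy0 : forall x y, O (x, y) -> O (x, snd p)).
  { intros x y [H1 H2]; split; [exact H1|]. simpl. now rewrite Rminus_diag, Rabs_R0. }
  assert (IP : forall x y, O (x, y) -> ex_RInt (fun t => P (t, snd p)) (fst p) x).
  { intros x y H. apply (ex_RInt_continuous (V := R_CompleteNormedModule)). intros t Ht.
    apply (continuous_slice_comp true O P (0, snd p)).
    - intros; now apply (smooth_continuous O).
    - apply (box_between_fst p r x); [now apply (Oy0 x y) | exact Ht]. }
  assert (IQ : forall x y, O (x, y) -> ex_RInt (fun t => Q (x, t)) (snd p) y).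
  { intros x y H. apply (ex_RInt_continuous (V := R_CompleteNormedModule)). intros t Ht.
    apply (continuous_slice_comp false O Q (x, 0)).
    - intros; now apply (smooth_continuous O).
    - now apply (box_between_snd p r x y). }
  assert (D : forall q, O q -> is_pd true B q (P q) /\ is_pd false B q (Q q)).
  { intros [x y] Oq. split.
    - replace (P (x, y)) with (P (x, snd p) + (P (x, y) - P (x, snd p))) by ring.
      apply (is_derive_plus (K := R_AbsRing) (V := R_NormedModule)
        (fun t => RInt (fun t => P (t, snd p)) (fst p) t)
        (fun s => RInt (fun t => Q (s, t)) (snd p) y)).
      + apply (is_derive_RInt (V := R_NormedModule) (fun t => P (t, snd p)) _ (fst p)).
        * generalize (locally_slice true O (x, y) oO Oq). apply filter_imp.
          intros t Ht. apply (RInt_correct (V := R_CompleteNormedModule)).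
          now apply (IP t y).
        * apply (continuous_slice_comp true O P (0, snd p)).
          -- intros; now apply (smooth_continuous O).
          -- now apply (Oy0 x y).
      (* Differentiation under the integral sign: closedness replaces [Q_x] by [P_y], whose integral
         is the missing difference of values of [P]. *)
      + assert (E : RInt (fun t => Derive (fun u => Q (u, t)) x) (snd p) y =
                    P (x, y) - P (x, snd p)).
        { apply is_RInt_unique.
          apply (is_RInt_ext (fun t => DD false P (x, t))).
          - intros t Ht. rewrite cl; [reflexivity|].
            apply (box_between_snd p r x y); [exact Oq | lra].
          - apply (is_RInt_derive (V := R_CompleteNormedModule) (fun t => P (x, t))).
            + intros t Ht.
              apply (smooth_pd O P false (x, t)); [exact SP|].
              now apply (box_between_snd p r x y).
            + intros t Ht. apply (continuous_slice_comp false O (DD false P) (x, 0)).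
              * intros; apply (smooth_continuous O); auto using smooth_DD.
              * now apply (box_between_snd p r x y). }
        rewrite <- E.
        apply (is_derive_RInt_param (fun s t => Q (s, t))).
        * generalize (locally_slice true O (x, y) oO Oq). apply filter_imp.
          intros s Hs t Ht. eexists.
          apply (smooth_pd O Q true (s, t)); [exact SQ|].
          now apply (box_between_snd p r s y).
        * intros t Ht. apply (continuity_2d_continuous (DD true Q)).
          apply (smooth_continuous O); [now apply smooth_DD|].
          now apply (box_between_snd p r x y).
        * generalize (locally_slice true O (x, y) oO Oq). apply filter_imp.
          intros s Hs. now apply IQ.
    - replace (Q (x, y)) with (0 + Q (x, y)) by ring.
      apply (is_derive_plus (K := R_AbsRing) (V := R_NormedModule)
        (fun _ => RInt (fun t => P (t, snd p)) (fst p) x)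
        (fun s => RInt (fun t => Q (x, t)) (snd p) s)).
      + exact (is_derive_const (K := R_AbsRing) (V := R_NormedModule) _ _).
      + apply (is_derive_RInt (V := R_NormedModule) (fun t => Q (x, t)) _ (snd p)).
        * generalize (locally_slice false O (x, y) oO Oq). apply filter_imp.
          intros t Ht. apply (RInt_correct (V := R_CompleteNormedModule)).
          now apply (IQ x t).
        * apply (continuous_slice_comp false O Q (x, 0)).
          -- intros; now apply (smooth_continuous O).
          -- exact Oq. }
  exists B. split; [|exact D].
  apply (smooth_of_partials O B (fun d => if d then P else Q)); auto.
  - intros [] q Oq; now apply D.
  - now intros [].
Qed.

(** * Uniqueness along axis-parallel paths, and connectedness of an interval *)

Lemma box_path_induction (p : R * R) r (P : R * R -> Prop) : 0 < r -> P p ->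
  (forall x, box p r (x, snd p) -> P (x, snd p)) ->
  (forall x, box p r (x, snd p) -> P (x, snd p) -> forall y, box p r (x, y) -> P (x, y)) ->
  forall q, box p r q -> P q.
Proof.
  intros rp P0 H1 H2 [x y] B.
  assert (B' : box p r (x, snd p)).
  { destruct B; split; [assumption|]. simpl. now rewrite Rminus_diag, Rabs_R0. }
  apply H2; auto.
Qed.

Lemma gronwall_zero (s : R -> R) (s' : R -> R) c t0 t1 :
  (forall t, Rmin t0 t1 <= t <= Rmax t0 t1 -> is_derive s t (s' t)) ->
  (forall t, Rmin t0 t1 <= t <= Rmax t0 t1 -> 0 <= s t /\ Rabs (s' t) <= c * s t) ->
  s t0 = 0 -> s t1 = 0.
Proof.
  intros D B Z.
  assert (I : Rmin t0 t1 <= t1 <= Rmax t0 t1).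
  { split; [apply Rmin_r | apply Rmax_r]. }
  destruct (B t1 I) as [B1 _].
  (* This sign makes [s t * exp (k * t)] nonincreasing away from [t0] in either direction; being
     nonnegative and zero at [t0], it stays zero. *)
  pose (k := if Rle_dec t0 t1 then - c else c).
  destruct (MVT_gen (fun t => s t * exp (k * t)) t0 t1
     (fun t => (s' t + k * s t) * exp (k * t))) as (x & Hx & E).
  - intros x Hx.
    assert (Hx' : Rmin t0 t1 <= x <= Rmax t0 t1) by lra.
    specialize (D x Hx'). auto_derive; [now exists (s' x)|].
    replace (Derive (fun x0 => s x0) x) with (s' x) by (symmetry; now apply is_derive_unique).
    ring.
  - intros x Hx. apply continuity_pt_filterlim.
    apply (ex_derive_continuous (K := R_AbsRing) (V := R_NormedModule)
             (fun t => s t * exp (k * t)) x).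
    auto_derive. now exists (s' x); apply D.
  - cbv beta in E. rewrite Z in E. rewrite Rmult_0_l, Rminus_0_r in E.
    destruct (B x Hx) as [B2 B3]. apply Rabs_le_between in B3.
    assert (e1 := exp_pos (k * t1)). assert (e2 := exp_pos (k * x)).
    assert (X : (s' x + k * s x) * (t1 - t0) <= 0).
    { unfold k. destruct (Rle_dec t0 t1); nra. }
    assert (Y : s t1 * exp (k * t1) <= 0).
    { rewrite E. replace ((s' x + k * s x) * exp (k * x) * (t1 - t0))
        with (((s' x + k * s x) * (t1 - t0)) * exp (k * x)) by ring. nra. }
    nra.
Qed.

(** Gronwall with rate 0 for the square of [f q - f p]; squaring supplies the nonnegativity required
    there. *)
Lemma box_constant (p : R * R) r f : 0 < r ->
  (forall d q, box p r q -> is_pd d f q 0) -> forall q, box p r q -> f q = f p.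
Proof.
  intros rp D. apply box_path_induction; auto.
  - intros x B.
    enough (Z : (f (x, snd p) - f p) * (f (x, snd p) - f p) = 0) by (apply Rminus_diag_uniq, Rsqr_0_uniq, Z).
    apply (gronwall_zero (fun t => (f (t, snd p) - f p) * (f (t, snd p) - f p)) (fun _ => 0) 0 (fst p) x).
    + intros t Ht. assert (B' := box_between_fst p r x (snd p) t B Ht).
      assert (X := is_pd_minus true (t, snd p) _ _ _ _ (D true _ B') (is_pd_const true _ (f p))).
      refine (is_pd_eq true (t, snd p) _ _ _ (is_pd_mult true _ _ _ _ _ X X) _). ring.
    + intros t Ht. rewrite Rabs_R0. split; [apply Rle_0_sqr | lra].
    + rewrite <- surjective_pairing. ring.
  - intros x B E y By.
    enough (Z : (f (x, y) - f p) * (f (x, y) - f p) = 0) by (apply Rminus_diag_uniq, Rsqr_0_uniq, Z).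
    apply (gronwall_zero (fun t => (f (x, t) - f p) * (f (x, t) - f p)) (fun _ => 0) 0 (snd p) y).
    + intros t Ht. assert (B' := box_between_snd p r x y t By Ht).
      assert (X := is_pd_minus false (x, t) _ _ _ _ (D false _ B') (is_pd_const false _ (f p))).
      refine (is_pd_eq false (x, t) _ _ _ (is_pd_mult false _ _ _ _ _ X X) _). ring.
    + intros t Ht. rewrite Rabs_R0. split; [apply Rle_0_sqr | lra].
    + rewrite E. ring.
Qed.

(** The supremum of the initial segments on which [c] vanishes is a zero by continuity, and local
    persistence of zeros forces it to be 1. *)
Lemma open_closed_interval (c : R -> R) :
  (forall t, 0 <= t <= 1 -> continuous c t) -> c 0 = 0 ->
  (forall t, 0 <= t <= 1 -> c t = 0 -> locally t (fun s => c s = 0)) -> c 1 = 0.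
Proof.
  intros C Z L.
  pose (E := fun t => 0 <= t <= 1 /\ forall s, 0 <= s <= t -> c s = 0).
  assert (E0 : E 0).
  { split; [lra|]. intros s Hs. now replace s with 0 by lra. }
  destruct (completeness E) as [m [U M]].
  - exists 1. intros t [Ht _]; lra.
  - now exists 0.
  - assert (m0 : 0 <= m) by now apply U.
    assert (m1 : m <= 1) by (apply M; intros t [Ht _]; lra).
    assert (below : forall s, 0 <= s < m -> c s = 0).
    { intros s Hs. apply NNPP; intros nz.
      assert (m <= s); [|lra]. apply M. intros t [Ht Et].
      apply Rnot_lt_le; intros lt. apply nz, Et; lra. }
    assert (cm : c m = 0).
    { destruct (Req_dec m 0) as [->|nm]; [exact Z|].
      apply NNPP; intros nz.
      assert (X := C m (conj m0 m1) (fun z => z <> 0)).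
      destruct X as [e He].
      { exists (mkposreal _ (Rabs_pos_lt _ nz)). intros z Hz E1. rewrite E1 in Hz.
        unfold ball in Hz; simpl in Hz; unfold AbsRing_ball, abs, minus, plus, opp in Hz; simpl in Hz.
        rewrite Rplus_0_l, Rabs_Ropp in Hz. lra. }
      pose (s := Rmax 0 (m - e / 2)).
      assert (ep := cond_pos e).
      assert (Hs : 0 <= s < m /\ m - s < e).
      { unfold s. generalize (Rmax_l 0 (m - e / 2)) (Rmax_r 0 (m - e / 2)).
        assert (Rmax 0 (m - e / 2) < m) by (apply Rmax_lub_lt; lra). lra. }
      apply (He s); [|apply below, Hs].
      apply Rabs_def1; unfold minus, plus, opp; simpl; lra. }
    destruct (Req_dec m 1) as [<-|n1]; [exact cm|exfalso].
    destruct (L m (conj m0 m1) cm) as [e He].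
    assert (ep := cond_pos e).
    pose (t := Rmin 1 (m + e / 2)).
    assert (Ht : m < t <= 1 /\ t - m < e).
    { unfold t. generalize (Rmin_l 1 (m + e / 2)) (Rmin_r 1 (m + e / 2)).
      assert (m < Rmin 1 (m + e / 2)) by (apply Rmin_glb_lt; lra). lra. }
    assert (t <= m); [|lra]. apply U. split; [lra|].
    intros s Hs. destruct (Rlt_or_le s m) as [l|l]; [apply below; lra|].
    apply He. apply Rabs_def1; unfold minus, plus, opp; simpl; lra.
Qed.

(** * The Lagrangian angle of a self-similar surface *)

Lemma inner_components z w : inner z w =
  Re (fst z) * Re (fst w) + Im (fst z) * Im (fst w) +
  Re (snd z) * Re (snd w) + Im (snd z) * Im (snd w).
Proof. destruct z as [[] []], w as [[] []]. unfold inner, herm; simpl. ring. Qed.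

Ltac c2 := intros;
  repeat match goal with z : C2 |- _ => destruct z as [[? ?] [? ?]] end;
  unfold kahler; rewrite ?inner_components;
  unfold J, vadd, vsub, vscal, dz1_dz2; simpl.

Ltac split4 := split; [|split; [|split]].

Lemma C2_eq (z w : C2) : Re (fst z) = Re (fst w) -> Im (fst z) = Im (fst w) ->
  Re (snd z) = Re (snd w) -> Im (snd z) = Im (snd w) -> z = w.
Proof. destruct z as [[] []], w as [[] []]; simpl; congruence. Qed.

Lemma inner_sym z w : inner z w = inner w z.
Proof. c2; ring. Qed.
Lemma inner_vadd_l u v w : inner (vadd u v) w = inner u w + inner v w.
Proof. c2; ring. Qed.
Lemma inner_vsub_l u v w : inner (vsub u v) w = inner u w - inner v w.
Proof. c2; ring. Qed.
Lemma inner_vscal_l a u w : inner (vscal a u) w = a * inner u w.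
Proof. c2; ring. Qed.
Lemma inner_vadd_r u v w : inner w (vadd u v) = inner w u + inner w v.
Proof. c2; ring. Qed.
Lemma inner_vscal_r a u w : inner w (vscal a u) = a * inner w u.
Proof. c2; ring. Qed.
Lemma inner_J_r u v : inner u (J v) = - inner v (J u).
Proof. c2; ring. Qed.
Lemma inner_J_self u : inner u (J u) = 0.
Proof. c2; ring. Qed.
Lemma kahler_inner u v : kahler u v = - inner u (J v).
Proof. c2; ring. Qed.
Lemma J_vadd u v : J (vadd u v) = vadd (J u) (J v).
Proof. apply C2_eq; c2; ring. Qed.
Lemma J_vscal a u : J (vscal a u) = vscal a (J u).
Proof. apply C2_eq; c2; ring. Qed.
Lemma inner_pos u : 0 <= inner u u.
Proof. c2; nra. Qed.

Definition VV (d : bool) : (R * R -> C2) -> R * R -> C2 := coordinatewise (DD d).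

Definition is_vpd (d : bool) (F : R * R -> C2) (p : R * R) (L : C2) : Prop :=
  is_pd d (fun q => Re (fst (F q))) p (Re (fst L)) /\
  is_pd d (fun q => Im (fst (F q))) p (Im (fst L)) /\
  is_pd d (fun q => Re (snd (F q))) p (Re (snd L)) /\
  is_pd d (fun q => Im (snd (F q))) p (Im (snd L)).

Lemma is_vpd_unique d F p L : is_vpd d F p L -> VV d F p = L.
Proof.
  intros (A & B & C & D). apply C2_eq; simpl; now apply is_pd_unique.
Qed.

Lemma smooth_vpd O F d p : smooth_C2 O F -> O p -> is_vpd d F p (VV d F p).
Proof. intros (A & B & C & D) Op. split4; now apply (smooth_pd O _ d). Qed.

Lemma smooth_VV O F d : smooth_C2 O F -> smooth_C2 O (VV d F).
Proof. intros (A & B & C & D). split4; now apply smooth_DD. Qed.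

Lemma VV_comm O F p : open O -> smooth_C2 O F -> O p ->
  VV false (VV true F) p = VV true (VV false F) p.
Proof.
  intros oO (A & B & C & D) Op. apply C2_eq; simpl; symmetry; now apply (DD_comm O).
Qed.

Lemma VV_ext_open d (O : R * R -> Prop) F G p :
  open O -> O p -> (forall q, O q -> F q = G q) -> VV d F p = VV d G p.
Proof.
  intros oO Op E. apply C2_eq; simpl; apply (DD_ext_open d O); auto;
  intros q Oq; now rewrite (E q Oq).
Qed.

Lemma is_pd_inner d F G p L M : is_vpd d F p L -> is_vpd d G p M ->
  is_pd d (fun q => inner (F q) (G q)) p (inner L (G p) + inner (F p) M).
Proof.
  intros (A & B & C & D) (A' & B' & C' & D').
  eapply is_pd_eq.
  - eapply (is_derive_ext (fun t => (fun q => Re (fst (F q)) * Re (fst (G q)) + Im (fst (F q)) * Im (fst (G q)) +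
      Re (snd (F q)) * Re (snd (G q)) + Im (snd (F q)) * Im (snd (G q))) (slice d p t))).
    { intros t. now rewrite inner_components. }
    exact (is_pd_plus d p _ _ _ _ (is_pd_plus d p _ _ _ _ (is_pd_plus d p _ _ _ _
      (is_pd_mult d p _ _ _ _ A A') (is_pd_mult d p _ _ _ _ B B'))
      (is_pd_mult d p _ _ _ _ C C')) (is_pd_mult d p _ _ _ _ D D')).
  - rewrite !inner_components. ring.
Qed.

Lemma is_pd_ext d f g p l : (forall q, f q = g q) -> is_pd d f p l -> is_pd d g p l.
Proof. intros E. apply is_derive_ext. intros t; apply E. Qed.

Lemma is_vpd_ext d F G p L : (forall q, F q = G q) -> is_vpd d F p L -> is_vpd d G p L.
Proof.
  intros E (A & B & C & D). split4.
  - apply (is_pd_ext d (fun q => Re (fst (F q)))); [intros; now rewrite E | exact A].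
  - apply (is_pd_ext d (fun q => Im (fst (F q)))); [intros; now rewrite E | exact B].
  - apply (is_pd_ext d (fun q => Re (snd (F q)))); [intros; now rewrite E | exact C].
  - apply (is_pd_ext d (fun q => Im (snd (F q)))); [intros; now rewrite E | exact D].
Qed.

Lemma is_vpd_J d F p L : is_vpd d F p L -> is_vpd d (fun q => J (F q)) p (J L).
Proof.
  intros (A & B & C & D). split4; simpl.
  - apply (is_pd_ext d (fun q => - Im (fst (F q)))).
    { intros q; destruct (F q) as [[] []]; simpl; ring. }
    eapply is_pd_eq; [exact (is_pd_opp d p _ _ B)|]. unfold Im; ring.
  - apply (is_pd_ext d (fun q => Re (fst (F q)))).
    { intros q; destruct (F q) as [[] []]; simpl; ring. }
    eapply is_pd_eq; [exact A|]. unfold Re; ring.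
  - apply (is_pd_ext d (fun q => - Im (snd (F q)))).
    { intros q; destruct (F q) as [[] []]; simpl; ring. }
    eapply is_pd_eq; [exact (is_pd_opp d p _ _ D)|]. unfold Im; ring.
  - apply (is_pd_ext d (fun q => Re (snd (F q)))).
    { intros q; destruct (F q) as [[] []]; simpl; ring. }
    eapply is_pd_eq; [exact C|]. unfold Re; ring.
Qed.

Lemma is_pd_det d F G p L M : is_vpd d F p L -> is_vpd d G p M ->
  is_pd d (fun q => Re (dz1_dz2 (F q) (G q))) p (Re (dz1_dz2 L (G p)) + Re (dz1_dz2 (F p) M)) /\
  is_pd d (fun q => Im (dz1_dz2 (F q) (G q))) p (Im (dz1_dz2 L (G p)) + Im (dz1_dz2 (F p) M)).
Proof.
  intros (A & B & C & D) (A' & B' & C' & D'). split.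
  - eapply is_pd_eq; [eapply is_pd_ext|].
    2: exact (is_pd_minus d p _ _ _ _
      (is_pd_minus d p _ _ _ _ (is_pd_mult d p _ _ _ _ A C') (is_pd_mult d p _ _ _ _ B D'))
      (is_pd_minus d p _ _ _ _ (is_pd_mult d p _ _ _ _ C A') (is_pd_mult d p _ _ _ _ D B'))).
    + intros q; simpl; unfold Re, Im; ring.
    + simpl; unfold Re, Im; ring.
  - eapply is_pd_eq; [eapply is_pd_ext|].
    2: exact (is_pd_minus d p _ _ _ _
      (is_pd_plus d p _ _ _ _ (is_pd_mult d p _ _ _ _ A D') (is_pd_mult d p _ _ _ _ B C'))
      (is_pd_plus d p _ _ _ _ (is_pd_mult d p _ _ _ _ C B') (is_pd_mult d p _ _ _ _ D A'))).
    + intros q; simpl; unfold Re, Im; ring.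
    + simpl; unfold Re, Im; ring.
Qed.

(* Cauchy-Binet: [det (u, v) conj (det (w, z)) = (u, w) (v, z) - (u, z) (v, w)],
   with [(u, w) = <u, w> + i <u, J w>]. *)
Lemma det_conj_Im u v w z :
  Im (dz1_dz2 u v) * Re (dz1_dz2 w z) - Re (dz1_dz2 u v) * Im (dz1_dz2 w z) =
  inner u (J w) * inner v z + inner u w * inner v (J z)
  - inner u (J z) * inner v w - inner u z * inner v (J w).
Proof. c2; ring. Qed.

(** Lagrange's identity [|det|^2 = |u|^2 |v|^2 - |(u, v)|^2] for the hermitian product; on a
    Lagrangian frame the right side is [gdet]. *)
Lemma det_norm u v :
  Re (dz1_dz2 u v) * Re (dz1_dz2 u v) + Im (dz1_dz2 u v) * Im (dz1_dz2 u v) =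
  inner u u * inner v v - inner u v * inner u v - inner u (J v) * inner u (J v).
Proof. c2; ring. Qed.

Lemma angle_det O f b p : lagrangian_angle O f b -> O p ->
  Re (dz1_dz2 (V1 f p) (V2 f p)) = area f p * cos (b p) /\
  Im (dz1_dz2 (V1 f p) (V2 f p)) = area f p * sin (b p).
Proof.
  intros [_ Hb] Op. specialize (Hb p Op (1, 0) (0, 1)).
  assert (E1 : Defs.differential f p (1, 0) = V1 f p).
  { unfold Defs.differential. generalize (V1 f p) (V2 f p). intros [[] []] [[] []].
    apply C2_eq; simpl; ring. }
  assert (E2 : Defs.differential f p (0, 1) = V2 f p).
  { unfold Defs.differential. generalize (V1 f p) (V2 f p). intros [[] []] [[] []].
    apply C2_eq; simpl; ring. }
  rewrite E1, E2 in Hb. rewrite Hb. split; simpl; ring.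
Qed.

Section Chart.
Variables (O : R * R -> Prop) (f : R * R -> C2) (a : R).
Hypothesis O_open : open O.
Hypothesis f_smooth : smooth_C2 O f.
Hypothesis f_lagrangian : forall p, O p -> inner (V1 f p) (J (V2 f p)) = 0.
Hypothesis f_gdet : forall p, O p -> 0 < gdet f p.

Lemma inner_V_JV d e p : O p -> inner (VV d f p) (J (VV e f p)) = 0.
Proof.
  intros Op. destruct d, e; try apply inner_J_self.
  - now apply f_lagrangian.
  - rewrite inner_J_r.
    rewrite (f_lagrangian p Op : inner (VV true f p) (J (VV false f p)) = 0). ring.
Qed.

Lemma inner_tangent_J p w d : O p -> inner (tangent_part f p w) (J (VV d f p)) = 0.
Proof.
  intros Op. unfold tangent_part.
  rewrite inner_vadd_l, !inner_vscal_l.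
  rewrite (inner_V_JV true d p Op : inner (V1 f p) _ = 0),
    (inner_V_JV false d p Op : inner (V2 f p) _ = 0). ring.
Qed.

Lemma inner_normal_J p w d : O p ->
  inner (normal_part f p w) (J (VV d f p)) = inner w (J (VV d f p)).
Proof.
  intros Op. unfold normal_part. rewrite inner_vsub_l, inner_tangent_J by exact Op. ring.
Qed.

(** Derivative of the Lagrangian condition. Together with equality of mixed partial derivatives it
    makes the cubic form [<f_ij, J f_k>] totally symmetric. *)
Lemma second_fundamental_sym d p : O p ->
  inner (VV d (V1 f) p) (J (V2 f p)) = inner (VV d (V2 f) p) (J (V1 f p)).
Proof.
  intros Op.
  assert (X : is_pd d (fun q => inner (V1 f q) (J (V2 f q))) p
    (inner (VV d (V1 f) p) (J (V2 f p)) + inner (V1 f p) (J (VV d (V2 f) p)))).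
  { apply is_pd_inner.
    - apply (smooth_vpd O); [apply (smooth_VV O f true)|]; auto.
    - apply is_vpd_J. apply (smooth_vpd O); [apply (smooth_VV O f false)|]; auto. }
  assert (Z : is_pd d (fun q => inner (V1 f q) (J (V2 f q))) p 0).
  { apply (is_pd_ext_open d O (fun _ => 0)); auto.
    - intros q Oq; symmetry; auto.
    - apply is_pd_const. }
  apply is_pd_unique in X. apply is_pd_unique in Z. rewrite Z in X.
  rewrite (inner_J_r (V1 f p)) in X. lra.
Qed.

(** The angle is the argument of [det (f_1, f_2)], so its differential is
    [Im (det' conj det) / |det|^2], which Cauchy-Binet turns into inner products of the frame. *)
Lemma angle_derivative b d p : lagrangian_angle O f b -> O p ->
  gdet f p * DD d b p =
    g22 f p * inner (VV d (V1 f) p) (J (V1 f p))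
    - 2 * g12 f p * inner (VV d (V1 f) p) (J (V2 f p))
    + g11 f p * inner (VV d (V2 f) p) (J (V2 f p)).
Proof.
  intros Hb Op. assert (Sb := proj1 Hb).
  assert (Hd := fun q (Oq : O q) => angle_det O f b q Hb Oq).
  assert (VP1 : is_vpd d (V1 f) p (VV d (V1 f) p)).
  { apply (smooth_vpd O); [apply (smooth_VV O f true)|]; auto. }
  assert (VP2 : is_vpd d (V2 f) p (VV d (V2 f) p)).
  { apply (smooth_vpd O); [apply (smooth_VV O f false)|]; auto. }
  destruct (is_pd_det d _ _ p _ _ VP1 VP2) as [DR DI].
  assert (Pb := smooth_pd O b d p Sb Op).
  (* The function [Re det * sin b - Im det * cos b] vanishes identically; differentiating it avoids
     the derivative of [area]. *)
  assert (X := is_pd_minus d p _ _ _ _ (is_pd_mult d p _ _ _ _ DR (is_pd_sin d p _ _ Pb))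
    (is_pd_mult d p _ _ _ _ DI (is_pd_cos d p _ _ Pb))). cbv beta in X.
  assert (Z : is_pd d (fun q => Re (dz1_dz2 (V1 f q) (V2 f q)) * sin (b q) -
    Im (dz1_dz2 (V1 f q) (V2 f q)) * cos (b q)) p 0).
  { apply (is_pd_ext_open d O (fun _ => 0)); auto.
    - intros q Oq. destruct (Hd q Oq) as [-> ->]. ring.
    - apply is_pd_const. }
  apply is_pd_unique in X. apply is_pd_unique in Z. rewrite Z in X. clear Z.
  destruct (Hd p Op) as [HR HI].
  assert (CB1 := det_conj_Im (VV d (V1 f) p) (V2 f p) (V1 f p) (V2 f p)).
  assert (CB2 := det_conj_Im (V1 f p) (VV d (V2 f) p) (V1 f p) (V2 f p)).
  assert (N := det_norm (V1 f p) (V2 f p)).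
  rewrite f_lagrangian in N by exact Op.
  rewrite HR, HI in *.
  rewrite (inner_J_self (V1 f p)), (inner_J_self (V2 f p)), (f_lagrangian p Op),
    (inner_J_r (V2 f p) (V1 f p)), (f_lagrangian p Op),
    (inner_sym (V2 f p) (V1 f p)) in *.
  rewrite <- (second_fundamental_sym d p Op) in *.
  change (inner (V1 f p) (V1 f p)) with (g11 f p) in *.
  change (inner (V1 f p) (V2 f p)) with (g12 f p) in *.
  change (inner (V2 f p) (V2 f p)) with (g22 f p) in *.
  assert (T := sin2_cos2 (b p)). unfold Rsqr in T.
  set (c := cos (b p)) in *. set (s := sin (b p)) in *. set (A := area f p) in *.
  assert (G : gdet f p = A * A).
  { transitivity (A * A * (s * s + c * c)); [|rewrite T; ring].
    unfold gdet. lra. }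
  rewrite G. clear G N HR HI Hd Hb.
  transitivity (A * (A * DD d b p * (s * s + c * c))); [rewrite T; ring|].
  replace (A * DD d b p * (s * s + c * c)) with
    ((Im (dz1_dz2 (VV d (V1 f) p) (V2 f p)) + Im (dz1_dz2 (V1 f p) (VV d (V2 f) p))) * c -
     (Re (dz1_dz2 (VV d (V1 f) p) (V2 f p)) + Re (dz1_dz2 (V1 f p) (VV d (V2 f) p))) * s) by lra.
  lra.
Qed.

(** [J] maps tangent to normal vectors, so normal projections disappear in products with [J f_d]. By
    total symmetry of the cubic form the derivative of the angle is then [2 <H, J f_d>], and
    [H = a phi^perp] is inserted. *)
Lemma angle_self_similar b d p : lagrangian_angle O f b -> O p ->
  mean_curvature f p = vscal a (normal_part f p (f p)) ->
  DD d b p = 2 * a * inner (f p) (J (VV d f p)).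
Proof.
  intros Hb Op H.
  assert (G := f_gdet p Op).
  apply (f_equal (fun w => inner w (J (VV d f p)))) in H.
  rewrite inner_vscal_l, inner_normal_J in H by exact Op.
  unfold mean_curvature, trace_sigma, sigma11, sigma12, sigma22 in H.
  rewrite inner_vscal_l, !inner_vadd_l, !inner_vscal_l, !inner_normal_J in H by exact Op.
  assert (A := angle_derivative b d p Hb Op).
  assert (S1 : inner (V1 (V1 f) p) (J (V2 f p)) = inner (V1 (V2 f) p) (J (V1 f p)))
    by exact (second_fundamental_sym true p Op).
  assert (S2 : inner (V2 (V1 f) p) (J (V2 f p)) = inner (V2 (V2 f) p) (J (V1 f p)))
    by exact (second_fundamental_sym false p Op).
  assert (CM := VV_comm O f p O_open f_smooth Op : V2 (V1 f) p = V1 (V2 f) p).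
  rewrite CM in S2.
  apply (Rmult_eq_reg_l (gdet f p)); [|lra]. rewrite A.
  replace (gdet f p * (2 * a * inner (f p) (J (VV d f p)))) with
    (2 * gdet f p * (a * inner (f p) (J (VV d f p)))) by ring.
  rewrite <- H. unfold gi11, gi12, gi22.
  destruct d.
  - change (VV true) with V1. rewrite S1, S2. field. lra.
  - change (VV false) with V2. rewrite CM, <- S1. field. lra.
Qed.

End Chart.

(** * Isothermal coordinates adapted to the angle *)

Section SmoothRules.
Variable O : R * R -> Prop.
Hypothesis O_open : open O.

Lemma smooth_plus f g : smooth O f -> smooth O g -> smooth O (fun q => f q + g q).
Proof. intros Hf Hg n; now apply Ck_plus. Qed.
Lemma smooth_minus f g : smooth O f -> smooth O g -> smooth O (fun q => f q - g q).
Proof. intros Hf Hg n; now apply Ck_minus. Qed.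
Lemma smooth_mult f g : smooth O f -> smooth O g -> smooth O (fun q => f q * g q).
Proof. intros Hf Hg n; now apply Ck_mult. Qed.
Lemma smooth_opp f : smooth O f -> smooth O (fun q => - f q).
Proof. intros Hf n; now apply Ck_opp. Qed.
Lemma smooth_const c : smooth O (fun _ => c).
Proof. intros n; apply Ck_const. Qed.
Lemma smooth_div f g : (forall p, O p -> g p <> 0) ->
  smooth O f -> smooth O g -> smooth O (fun q => f q / g q).
Proof. intros nz Hf Hg n; apply Ck_mult; auto. apply Ck_inv; auto. Qed.
Lemma smooth_sqrt f : (forall p, O p -> 0 < f p) ->
  smooth O f -> smooth O (fun q => sqrt (f q)).
Proof. intros pos Hf n; apply Ck_sqrt; auto. Qed.

Lemma smooth_inner F G : smooth_C2 O F -> smooth_C2 O G ->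
  smooth O (fun q => inner (F q) (G q)).
Proof.
  intros (A & B & C & D) (A' & B' & C' & D').
  apply (smooth_ext O (fun q => Re (fst (F q)) * Re (fst (G q)) + Im (fst (F q)) * Im (fst (G q)) +
      Re (snd (F q)) * Re (snd (G q)) + Im (snd (F q)) * Im (snd (G q)))); auto.
  - intros; now rewrite inner_components.
  - repeat apply smooth_plus; apply smooth_mult; assumption.
Qed.

Lemma smooth_J F : smooth_C2 O F -> smooth_C2 O (fun q => J (F q)).
Proof.
  intros (A & B & C & D). split4.
  - apply (smooth_ext O (fun q => - Im (fst (F q)))); auto using smooth_opp.
    intros q _; destruct (F q) as [[] []]; simpl; ring.
  - apply (smooth_ext O (fun q => Re (fst (F q)))); auto.
    intros q _; destruct (F q) as [[] []]; simpl; ring.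
  - apply (smooth_ext O (fun q => - Im (snd (F q)))); auto using smooth_opp.
    intros q _; destruct (F q) as [[] []]; simpl; ring.
  - apply (smooth_ext O (fun q => Re (snd (F q)))); auto.
    intros q _; destruct (F q) as [[] []]; simpl; ring.
Qed.

End SmoothRules.

Lemma smooth_C2_sub (O O' : R * R -> Prop) F :
  (forall p, O' p -> O p) -> smooth_C2 O F -> smooth_C2 O' F.
Proof. intros S (A & B & C & D). split4; eapply smooth_sub; eauto. Qed.

(* The Liouville form [<phi, J dphi>] and its squared norm, which is [|phi^perp|^2]
   for a Lagrangian immersion. *)
Definition liouville (d : bool) (f : R * R -> C2) (p : R * R) : R :=
  inner (f p) (J (VV d f p)).
Definition normal_sq (f : R * R -> C2) (p : R * R) : R :=
  (g22 f p * (liouville true f p * liouville true f p)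
   - 2 * g12 f p * (liouville true f p * liouville false f p)
   + g11 f p * (liouville false f p * liouville false f p)) / gdet f p.

Section SmoothGeometry.
Variables (O : R * R -> Prop) (f : R * R -> C2).
Hypothesis O_open : open O.
Hypothesis f_smooth : smooth_C2 O f.
Hypothesis f_gdet : forall p, O p -> 0 < gdet f p.

Let nz p (Op : O p) : gdet f p <> 0 := Rgt_not_eq _ _ (f_gdet p Op).
Let s1 : smooth_C2 O (V1 f) := smooth_VV O f true f_smooth.
Let s2 : smooth_C2 O (V2 f) := smooth_VV O f false f_smooth.

Lemma smooth_g11 : smooth O (g11 f).
Proof. now apply smooth_inner. Qed.
Lemma smooth_g12 : smooth O (g12 f).
Proof. now apply smooth_inner. Qed.
Lemma smooth_g22 : smooth O (g22 f).
Proof. now apply smooth_inner. Qed.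
Lemma smooth_gdet : smooth O (gdet f).
Proof.
  apply smooth_minus; auto; apply smooth_mult; auto using smooth_g11, smooth_g12, smooth_g22.
Qed.
Lemma smooth_area : smooth O (area f).
Proof. apply smooth_sqrt; auto using smooth_gdet. Qed.
Lemma smooth_gi11 : smooth O (gi11 f).
Proof. apply smooth_div; auto using smooth_g22, smooth_gdet. Qed.
Lemma smooth_gi12 : smooth O (gi12 f).
Proof. apply smooth_div; auto using smooth_g12, smooth_gdet, smooth_opp. Qed.
Lemma smooth_gi22 : smooth O (gi22 f).
Proof. apply smooth_div; auto using smooth_g11, smooth_gdet. Qed.
Lemma smooth_liouville d : smooth O (liouville d f).
Proof. apply smooth_inner; auto. apply smooth_J; auto using smooth_VV. Qed.
Lemma smooth_normal_sq : smooth O (normal_sq f).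
Proof.
  apply smooth_div; auto using smooth_gdet.
  apply smooth_plus; auto; [apply smooth_minus; auto|]; apply smooth_mult;
    auto using smooth_g11, smooth_g22, smooth_mult, smooth_liouville.
  apply smooth_mult; auto using smooth_const, smooth_g12.
Qed.
End SmoothGeometry.

(** An antilinear complex structure of [C^2], hence anticommuting with [J]: a quaternionic structure
    turned by the phase [x]. *)
Definition twist (x : R) (v : C2) : C2 :=
  (expi x * - Cconj (snd v), expi x * Cconj (fst v))%C.

Lemma twist_linear x a b u v :
  twist x (vadd (vscal a u) (vscal b v)) = vadd (vscal a (twist x u)) (vscal b (twist x v)).
Proof. destruct u as [[] []], v as [[] []]. apply C2_eq; simpl; ring. Qed.

(* The coefficients of [T F1] and [T F2] in the frame [F1, F2] are hermitian products
   of the frame, hence real if it is Lagrangian. *)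
Lemma twist_frame x A F1 F2 : inner F1 (J F2) = 0 ->
  Re (dz1_dz2 F1 F2) = A * cos x -> Im (dz1_dz2 F1 F2) = A * sin x ->
  vscal A (twist x F1) = vadd (vscal (inner F1 F1) F2) (vscal (- inner F1 F2) F1) /\
  vscal A (twist x F2) = vadd (vscal (inner F1 F2) F2) (vscal (- inner F2 F2) F1).
Proof.
  intros L HR HI.
  assert (E1 : vscal A (twist x F1) =
    (dz1_dz2 F1 F2 * - Cconj (snd F1), dz1_dz2 F1 F2 * Cconj (fst F1))%C).
  { rewrite (surjective_pairing (dz1_dz2 F1 F2)).
    change (fst (dz1_dz2 F1 F2)) with (Re (dz1_dz2 F1 F2)).
    change (snd (dz1_dz2 F1 F2)) with (Im (dz1_dz2 F1 F2)). rewrite HR, HI.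
    destruct F1 as [[] []]; apply C2_eq; simpl; ring. }
  assert (E2 : vscal A (twist x F2) =
    (dz1_dz2 F1 F2 * - Cconj (snd F2), dz1_dz2 F1 F2 * Cconj (fst F2))%C).
  { rewrite (surjective_pairing (dz1_dz2 F1 F2)).
    change (fst (dz1_dz2 F1 F2)) with (Re (dz1_dz2 F1 F2)).
    change (snd (dz1_dz2 F1 F2)) with (Im (dz1_dz2 F1 F2)). rewrite HR, HI.
    destruct F2 as [[] []]; apply C2_eq; simpl; ring. }
  split.
  - transitivity (vadd (vadd (vscal (inner F1 F1) F2) (vscal (- inner F1 F2) F1))
                    (vscal (inner F1 (J F2)) (J F1))).
    + rewrite E1. clear. destruct F1 as [[] []], F2 as [[] []].
      rewrite !inner_components; apply C2_eq; simpl; ring.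
    + rewrite L. generalize (vadd (vscal (inner F1 F1) F2) (vscal (- inner F1 F2) F1)) (J F1).
      intros [[] []] [[] []]; apply C2_eq; simpl; ring.
  - transitivity (vadd (vadd (vscal (inner F1 F2) F2) (vscal (- inner F2 F2) F1))
                    (vscal (inner F1 (J F2)) (J F2))).
    + rewrite E2. clear. destruct F1 as [[] []], F2 as [[] []].
      rewrite !inner_components; apply C2_eq; simpl; ring.
    + rewrite L. generalize (vadd (vscal (inner F1 F2) F2) (vscal (- inner F2 F2) F1)) (J F2).
      intros [[] []] [[] []]; apply C2_eq; simpl; ring.
Qed.

(* [psi] is the immersion in the coordinates given by the Lagrangian angle [beta] and a
   harmonic conjugate; the last two clauses say [d beta = 2 a <phi, J dphi>]. *)
Definition normal_form (a : R) (W : R * R -> Prop) (psi : R * R -> C2) : Prop :=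
  smooth_C2 W psi /\
  forall q, W q -> V2 psi q = twist (fst q) (V1 psi q) /\
    inner (psi q) (J (V1 psi q)) = 1 / (2 * a) /\ inner (psi q) (J (V2 psi q)) = 0.

Lemma VV_chain d O W F (h : R * R -> R * R) p : open O -> open W -> smooth_C2 W F ->
  smooth_map O h -> O p -> W (h p) ->
  VV d (fun q => F (h q)) p =
  vadd (vscal (DD d (fun q => fst (h q)) p) (V1 F (h p)))
       (vscal (DD d (fun q => snd (h q)) p) (V2 F (h p))).
Proof.
  intros oO oW (A & B & C & D) [S1 S2] Op Wp. apply is_vpd_unique.
  assert (X : forall f, smooth W f -> is_pd d (fun q => f (h q)) p
    (DD true f (h p) * DD d (fun q => fst (h q)) p +
     DD false f (h p) * DD d (fun q => snd (h q)) p)).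
  { intros f Sf. apply (is_pd_chain d W f h); auto; apply (smooth_pd O); auto. }
  split4; (eapply is_pd_eq;
    [first [exact (X _ A) | exact (X _ B) | exact (X _ C) | exact (X _ D)] | simpl; ring]).
Qed.

Lemma solve_frame (F1 F2 X Y : C2) b1 b2 P Q :
  F1 = vadd (vscal b1 X) (vscal P Y) -> F2 = vadd (vscal b2 X) (vscal Q Y) ->
  vscal (b1 * Q - b2 * P) X = vadd (vscal Q F1) (vscal (- P) F2) /\
  vscal (b1 * Q - b2 * P) Y = vadd (vscal (- b2) F1) (vscal b1 F2).
Proof.
  intros -> ->. destruct X as [[] []], Y as [[] []].
  split; apply C2_eq; simpl; ring.
Qed.

Lemma vscal_inj c u v : c <> 0 -> vscal c u = vscal c v -> u = v.
Proof.
  intros nz E.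
  assert (X : forall w, w = vscal (/ c) (vscal c w)).
  { intros [[] []]; apply C2_eq; simpl; field; exact nz. }
  now rewrite (X u), E, <- X.
Qed.

Lemma vscal_vscal c d u : vscal c (vscal d u) = vscal (c * d) u.
Proof. destruct u as [[] []]; apply C2_eq; simpl; ring. Qed.

Lemma twist_vscal x c u : twist x (vscal c u) = vscal c (twist x u).
Proof. destruct u as [[] []]; apply C2_eq; simpl; ring. Qed.

(* [X, Y] are the derivatives in the coordinates [beta] and [beta'], where [beta'] is a
   harmonic conjugate of [beta], and [(b1, b2)], [(P, Q)] are the gradients of [beta]
   and [beta'] in the chart. *)
Lemma normal_form_pointwise a x A g (f F1 F2 X Y : C2) b1 b2 P Q :
  a <> 0 -> 0 < A -> g = A * A ->
  g = inner F1 F1 * inner F2 F2 - inner F1 F2 * inner F1 F2 ->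
  inner F1 (J F2) = 0 ->
  Re (dz1_dz2 F1 F2) = A * cos x -> Im (dz1_dz2 F1 F2) = A * sin x ->
  b1 = 2 * a * inner f (J F1) -> b2 = 2 * a * inner f (J F2) ->
  A * P = inner F1 F2 * b1 - inner F1 F1 * b2 ->
  A * Q = inner F2 F2 * b1 - inner F1 F2 * b2 ->
  b1 * Q - b2 * P <> 0 ->
  F1 = vadd (vscal b1 X) (vscal P Y) -> F2 = vadd (vscal b2 X) (vscal Q Y) ->
  Y = twist x X /\ inner f (J X) = 1 / (2 * a) /\ inner f (J Y) = 0 /\
  inner X X * (b1 * Q - b2 * P) = A.
Proof.
  intros anz Apos gA gE L HR HI B1 B2 HP HQ jnz E1 E2.
  destruct (solve_frame F1 F2 X Y b1 b2 P Q E1 E2) as [SX SY].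
  destruct (twist_frame x A F1 F2 L HR HI) as [T1 T2].
  set (j := b1 * Q - b2 * P) in *.
  assert (Anz : A <> 0) by lra.
  split; [|split; [|split]].
  - apply (vscal_inj (A * j)); [now apply Rmult_integral_contrapositive|].
    rewrite <- !vscal_vscal, SY, <- twist_vscal, SX, twist_linear.
    replace (vscal A (vadd (vscal Q (twist x F1)) (vscal (- P) (twist x F2)))) with
      (vadd (vscal Q (vscal A (twist x F1))) (vscal (- P) (vscal A (twist x F2)))).
    2: { generalize (twist x F1) (twist x F2). intros [[] []] [[] []].
         apply C2_eq; simpl; ring. }
    rewrite T1, T2.
    apply (vscal_inj A); [exact Anz|].
    replace (vscal A (vadd (vscal Q (vadd (vscal (inner F1 F1) F2) (vscal (- inner F1 F2) F1)))
      (vscal (- P) (vadd (vscal (inner F1 F2) F2) (vscal (- inner F2 F2) F1))))) with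
      (vadd (vscal (A * Q * inner F1 F1 - A * P * inner F1 F2) F2)
            (vscal (- (A * Q) * inner F1 F2 + A * P * inner F2 F2) F1)).
    2: { generalize (inner F1 F1) (inner F1 F2) (inner F2 F2). clear. intros.
         destruct F1 as [[] []], F2 as [[] []]. apply C2_eq; simpl; ring. }
    rewrite HP, HQ.
    replace ((inner F2 F2 * b1 - inner F1 F2 * b2) * inner F1 F1 -
      (inner F1 F2 * b1 - inner F1 F1 * b2) * inner F1 F2) with (A * A * b1)
      by (rewrite <- gA, gE; ring).
    replace (- (inner F2 F2 * b1 - inner F1 F2 * b2) * inner F1 F2 +
      (inner F1 F2 * b1 - inner F1 F1 * b2) * inner F2 F2) with (- (A * A * b2))
      by (rewrite <- gA, gE; ring).
    clear. destruct F1 as [[] []], F2 as [[] []]. apply C2_eq; simpl; ring.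
  - apply (Rmult_eq_reg_l j); [|exact jnz].
    apply (f_equal (fun w => inner f (J w))) in SX. rewrite J_vscal, inner_vscal_r in SX.
    rewrite SX, J_vadd, !J_vscal, inner_vadd_r, !inner_vscal_r.
    unfold j. rewrite B1, B2. field. exact anz.
  - apply (Rmult_eq_reg_l j); [|exact jnz].
    apply (f_equal (fun w => inner f (J w))) in SY. rewrite J_vscal, inner_vscal_r in SY.
    rewrite SY, J_vadd, !J_vscal, inner_vadd_r, !inner_vscal_r.
    rewrite B1, B2. ring.
  (* For conformal coordinates the area density [A] is the conformal factor [<X, X>] times the
     Jacobian [j]. The multiplier lets [A * P] and [A * Q] be substituted without division. *)
  - apply (Rmult_eq_reg_l (A * A * j)).
    2: { repeat apply Rmult_integral_contrapositive_currified; assumption. }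
    transitivity (A * A * inner (vscal j X) (vscal j X)).
    { rewrite inner_vscal_l, inner_vscal_r. ring. }
    rewrite SX, inner_vadd_l, !inner_vscal_l, !inner_vadd_r, !inner_vscal_r,
      (inner_sym F2 F1).
    transitivity ((A * Q) * (A * Q) * inner F1 F1 - 2 * (A * P) * (A * Q) * inner F1 F2 +
      (A * P) * (A * P) * inner F2 F2); [ring|].
    transitivity (A * A * (b1 * (A * Q) - b2 * (A * P))); [|unfold j; ring].
    rewrite HP, HQ, <- gA, gE. ring.
Qed.

Record local_data (a : R) (O : R * R -> Prop) (f : R * R -> C2) (b : R * R -> R) : Prop := {
  ld_open : open O;
  ld_smooth : smooth_C2 O f;
  ld_lagrangian : forall p, O p -> inner (V1 f p) (J (V2 f p)) = 0;
  ld_gdet : forall p, O p -> 0 < gdet f p;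
  ld_angle : lagrangian_angle O f b;
  ld_harmonic : forall p, O p -> laplacian f b p = 0;
  ld_self_similar : forall p, O p ->
    mean_curvature f p = vscal a (normal_part f p (f p))
}.

Lemma local_data_sub a (O O' : R * R -> Prop) f b :
  open O' -> (forall p, O' p -> O p) -> local_data a O f b -> local_data a O' f b.
Proof.
  intros oO' S [H1 H2 H3 H4 H5 H6 H7]. split; auto.
  - now apply (smooth_C2_sub O).
  - destruct H5 as [A B]. split; [now apply (smooth_sub O) | auto].
Qed.

(** The last clause is [|phi_x|^2 = 1 / |grad beta|^2] with the gradient written in the original
    chart; it is what later frees [kappa] from the choice of coordinates. *)
Lemma normal_coordinates a O f b p : a <> 0 -> local_data a O f b -> O p ->
  normal_sq f p <> 0 ->
  exists (O' : R * R -> Prop) r (h : R * R -> R * R) (psi : R * R -> C2),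
    0 < r /\ (forall q, O' q -> O q) /\ O' p /\ diffeomorphism O' (box (h p) r) h /\
    normal_form a (box (h p) r) psi /\
    forall q, O' q -> f q = psi (h q) /\
      inner (V1 psi (h q)) (V1 psi (h q)) * (4 * a * a * normal_sq f q) = 1.
Proof.
  intros anz LD Op nz.
  assert (SN := smooth_normal_sq O f (ld_open _ _ _ _ LD) (ld_smooth _ _ _ _ LD) (ld_gdet _ _ _ _ LD)).
  destruct (proj1 (locally_box p (fun q => O q /\ normal_sq f q <> 0))) as (r0 & r0p & H0).
  { apply filter_and; [now apply (ld_open _ _ _ _ LD)|].
    apply locally_nz; [|exact nz]. now apply (smooth_continuous O). }
  pose (U := box p r0).
  assert (oU : open U) by apply open_box.
  apply (local_data_sub a O U f b oU (fun q Bq => proj1 (H0 q Bq))) in LD.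
  assert (nzU : forall q, U q -> normal_sq f q <> 0) by (intros q Uq; now apply H0).
  assert (subU : forall q, U q -> O q) by (intros q Uq; now apply H0).
  clear SN. destruct LD as [_ SF LG GP AN HA SS].
  assert (Sb := proj1 AN).
  assert (Ap : forall q, U q -> 0 < area f q) by (intros q Uq; now apply sqrt_lt_R0, GP).
  assert (AA : forall q, U q -> gdet f q = area f q * area f q).
  { intros q Uq. symmetry. apply sqrt_sqrt, Rlt_le, GP, Uq. }
  assert (db : forall d q, U q -> DD d b q = 2 * a * liouville d f q).
  { intros d q Uq. apply (angle_self_similar U f a oU SF LG GP); auto. }
  (* [P du + Q dv] with [P = - P'] is the Hodge dual of [d b]; it is closed because the divergence
     inside [laplacian] vanishes. *)
  pose (Q := fun q => area f q * (gi11 f q * D1 b q + gi12 f q * D2 b q)).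
  pose (P' := fun q => area f q * (gi12 f q * D1 b q + gi22 f q * D2 b q)).
  pose (P := fun q => - P' q).
  assert (S1 := smooth_DD U b true Sb : smooth U (D1 b)).
  assert (S2 := smooth_DD U b false Sb : smooth U (D2 b)).
  assert (SQ : smooth U Q).
  { apply smooth_mult; auto using smooth_area. apply smooth_plus; auto; apply smooth_mult;
    auto using smooth_gi11, smooth_gi12. }
  assert (SP' : smooth U P').
  { apply smooth_mult; auto using smooth_area. apply smooth_plus; auto; apply smooth_mult;
    auto using smooth_gi22, smooth_gi12. }
  destruct (poincare p r0 P Q r0p) as (B & SB & DB).
  { now apply smooth_opp. }
  { exact SQ. }
  { intros q Uq. assert (L := HA q Uq). unfold laplacian in L. fold Q P' in L.
    assert (N : DD true Q q + DD false P' q = 0).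
    { assert (A := Ap q Uq). apply (Rmult_eq_reg_r (/ area f q)).
      - rewrite Rmult_0_l. exact L.
      - apply Rinv_neq_0_compat; lra. }
    rewrite (is_pd_unique false P q (- DD false P' q)); [lra|].
    apply is_pd_opp. now apply (smooth_pd U). }
  fold U in SB, DB.
  pose (h := fun q => (b q, B q)).
  assert (Sh : smooth_map U h) by now split.
  assert (HP : forall q, U q -> area f q * P q = g12 f q * D1 b q - g11 f q * D2 b q).
  { intros q Uq. unfold P, P', gi12, gi22. assert (A := Ap q Uq). rewrite (AA q Uq).
    field. lra. }
  assert (HQ : forall q, U q -> area f q * Q q = g22 f q * D1 b q - g12 f q * D2 b q).
  { intros q Uq. unfold Q, gi11, gi12. assert (A := Ap q Uq). rewrite (AA q Uq).
    field. lra. }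
  assert (DBt : forall q, U q -> DD true B q = P q) by (intros; now apply is_pd_unique, DB).
  assert (DBf : forall q, U q -> DD false B q = Q q) by (intros; now apply is_pd_unique, DB).
  assert (Jh : forall q, U q -> jac h q = D1 b q * Q q - D2 b q * P q).
  { intros q Uq. unfold jac, h; simpl.
    change (fun q => b q) with b. change (fun q => B q) with B.
    change D1 with (DD true). change D2 with (DD false).
    now rewrite DBt, DBf. }
  (* The Jacobian of [(b, B)] is [area * |grad b|^2], nonzero exactly where [phi^perp] is. *)
  assert (JN : forall q, U q -> D1 b q * Q q - D2 b q * P q = area f q * (4 * a * a * normal_sq f q)).
  { intros q Uq. assert (A := Ap q Uq).
    apply (Rmult_eq_reg_l (area f q)); [|lra].
    transitivity (D1 b q * (area f q * Q q) - D2 b q * (area f q * P q)); [ring|].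
    rewrite HP, HQ by exact Uq. rewrite <- Rmult_assoc, <- AA by exact Uq.
    assert (G := GP q Uq). unfold normal_sq.
    rewrite (db true q Uq : D1 b q = _), (db false q Uq : D2 b q = _). field. lra. }
  assert (jnz : forall q, U q -> D1 b q * Q q - D2 b q * P q <> 0).
  { intros q Uq. rewrite JN by exact Uq. assert (A := Ap q Uq). assert (N := nzU q Uq).
    apply Rmult_integral_contrapositive_currified; [lra|].
    apply Rmult_integral_contrapositive_currified; [|exact N].
    apply Rmult_integral_contrapositive_currified; [lra | exact anz]. }
  destruct (inverse_function U h p oU (box_center p r0 r0p) Sh) as (O' & r & rp & sub & O'p & DF).
  { intros q Uq. rewrite Jh by exact Uq. auto. }
  assert (DF' := DF).
  destruct DF' as (oO' & oW & Sh' & hW & k & Sk & kO & kh & hk).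
  pose (psi := fun w => f (k w)).
  set (W := box (h p) r) in *.
  assert (SF' : smooth_C2 O' f) by now apply (smooth_C2_sub U).
  assert (Spsi : smooth_C2 W psi).
  { destruct SF' as (A1 & A2 & A3 & A4).
    split4.
    - exact (smooth_comp W O' _ k oW oO' kO Sk A1).
    - exact (smooth_comp W O' _ k oW oO' kO Sk A2).
    - exact (smooth_comp W O' _ k oW oO' kO Sk A3).
    - exact (smooth_comp W O' _ k oW oO' kO Sk A4). }
  assert (fpsi : forall q, O' q -> f q = psi (h q)).
  { intros q Oq. unfold psi. now rewrite kh. }
  assert (KEY : forall q, O' q -> V2 psi (h q) = twist (b q) (V1 psi (h q)) /\
    inner (f q) (J (V1 psi (h q))) = 1 / (2 * a) /\ inner (f q) (J (V2 psi (h q))) = 0 /\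
    inner (V1 psi (h q)) (V1 psi (h q)) * (D1 b q * Q q - D2 b q * P q) = area f q).
  { intros q Oq. assert (Uq := sub q Oq).
    destruct (angle_det U f b q AN Uq) as [HR HI].
    assert (CH : forall d, VV d f q = vadd (vscal (DD d b q) (V1 psi (h q)))
                               (vscal (DD d B q) (V2 psi (h q)))).
    { intros d. rewrite (VV_ext_open d O' f (fun q => psi (h q))); auto.
      apply (VV_chain d O' W psi h q); auto. }
    apply (normal_form_pointwise a (b q) (area f q) (gdet f q) (f q) (V1 f q) (V2 f q)
       (V1 psi (h q)) (V2 psi (h q)) (D1 b q) (D2 b q) (P q) (Q q) anz (Ap q Uq) (AA q Uq)
       eq_refl (LG q Uq) HR HI (db true q Uq) (db false q Uq) (HP q Uq) (HQ q Uq) (jnz q Uq)).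
    - rewrite <- DBt by exact Uq. exact (CH true).
    - rewrite <- DBf by exact Uq. exact (CH false). }
  exists O', r, h, psi. split; [exact rp|]. split; [auto|]. split; [exact O'p|].
  split; [exact DF|]. split.
  - split; [exact Spsi|]. intros w Ww. fold W in Ww.
    destruct (KEY (k w) (kO w Ww)) as (K1 & K2 & K3 & _).
    assert (E : b (k w) = fst w) by (transitivity (fst (h (k w))); [reflexivity | now rewrite hk]).
    rewrite (hk w Ww), ?E in *. now repeat split.
  - intros q Oq. split; [auto|].
    destruct (KEY q Oq) as (_ & _ & _ & K). rewrite JN in K by auto.
    assert (A := Ap q (sub q Oq)).
    apply (Rmult_eq_reg_l (area f q)); [|lra].
    rewrite <- K at 2. ring.
Qed.

(** * The linear system in adapted coordinates *)

Lemma is_vpd_eq d F p L L' : is_vpd d F p L -> L = L' -> is_vpd d F p L'.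
Proof. now intros H <-. Qed.

Lemma is_vpd_twist d F p L : is_vpd d F p L ->
  is_vpd d (fun q => twist (fst q) (F q)) p
    (vadd (vscal (if d then 1 else 0) (J (twist (fst p) (F p)))) (twist (fst p) L)).
Proof.
  intros (A & B & C & D).
  assert (K := is_pd_cos d p _ _ (is_pd_fst d p)).
  assert (S := is_pd_sin d p _ _ (is_pd_fst d p)).
  split4; (eapply is_pd_eq; [eapply is_pd_ext|]).
  2: exact (is_pd_opp d p _ _ (is_pd_plus d p _ _ _ _ (is_pd_mult d p _ _ _ _ K C) (is_pd_mult d p _ _ _ _ S D))).
  4: exact (is_pd_minus d p _ _ _ _ (is_pd_mult d p _ _ _ _ K D) (is_pd_mult d p _ _ _ _ S C)).
  6: exact (is_pd_plus d p _ _ _ _ (is_pd_mult d p _ _ _ _ K A) (is_pd_mult d p _ _ _ _ S B)).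
  8: exact (is_pd_minus d p _ _ _ _ (is_pd_mult d p _ _ _ _ S A) (is_pd_mult d p _ _ _ _ K B)).
  all: try (intros q); simpl; unfold Re, Im; ring.
Qed.

Lemma sc1 x : sin x * sin x + cos x * cos x = 1.
Proof. exact (sin2_cos2 x). Qed.

Lemma twist_twist x v : twist x (twist x v) = vscal (-1) v.
Proof.
  destruct v as [[v1 v2] [v3 v4]]. assert (T := sc1 x).
  apply C2_eq; simpl; [transitivity (- v1 * (sin x * sin x + cos x * cos x)) |
    transitivity (- v2 * (sin x * sin x + cos x * cos x)) |
    transitivity (- v3 * (sin x * sin x + cos x * cos x)) |
    transitivity (- v4 * (sin x * sin x + cos x * cos x))]; try ring; rewrite T; ring.
Qed.

Lemma twist_J x v : twist x (J v) = vscal (-1) (J (twist x v)).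
Proof. destruct v as [[] []]; apply C2_eq; simpl; ring. Qed.

Lemma J_J v : J (J v) = vscal (-1) v.
Proof. destruct v as [[] []]; apply C2_eq; simpl; ring. Qed.

Lemma inner_twist x u v : inner (twist x u) v = - inner u (twist x v).
Proof. destruct u as [[] []], v as [[] []]. rewrite !inner_components; simpl; ring. Qed.

Lemma inner_twist_self x u : inner u (twist x u) = 0.
Proof. destruct u as [[] []]. rewrite !inner_components; simpl; ring. Qed.

Lemma inner_twist_J_self x u : inner u (J (twist x u)) = 0.
Proof. destruct u as [[] []]. rewrite !inner_components; simpl; ring. Qed.

Lemma inner_twist_twist x u v : inner (twist x u) (twist x v) = inner u v.
Proof. rewrite inner_twist, twist_twist, inner_vscal_r. ring. Qed.

Lemma vsub_vscal u v : vsub u v = vadd u (vscal (-1) v).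
Proof. destruct u as [[] []], v as [[] []]; apply C2_eq; simpl; ring. Qed.

(* [u], [J u], [T u], [J T u] is an orthogonal basis of [C^2]. *)
Lemma twist_basis x u w :
  vscal (inner u u) w =
  vadd (vadd (vscal (inner w u) u) (vscal (inner w (J u)) (J u)))
       (vadd (vscal (inner w (twist x u)) (twist x u))
             (vscal (inner w (J (twist x u))) (J (twist x u)))).
Proof.
  (* The projection onto the complex line of [T u] does not depend on the phase [x], which
     contributes only the factor [sin^2 + cos^2]. *)
  transitivity (vadd (vadd (vscal (inner w u) u) (vscal (inner w (J u)) (J u)))
       (vscal (sin x * sin x + cos x * cos x) (vadd (vscal (inner w (twist 0 u)) (twist 0 u))
             (vscal (inner w (J (twist 0 u))) (J (twist 0 u)))))).
  - rewrite sc1. destruct u as [[] []], w as [[] []]. rewrite !inner_components.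
    unfold twist, expi; rewrite cos_0, sin_0. apply C2_eq; simpl; ring.
  - destruct u as [[] []], w as [[] []]. rewrite !inner_components.
    unfold twist, expi; rewrite cos_0, sin_0. apply C2_eq; simpl; ring.
Qed.

Lemma vzero_l c u : vadd (vscal 0 u) c = c.
Proof. destruct u as [[] []], c as [[] []]; apply C2_eq; simpl; ring. Qed.

Lemma vzero_r c u : vadd c (vscal 0 u) = c.
Proof. destruct u as [[] []], c as [[] []]; apply C2_eq; simpl; ring. Qed.

Lemma vscal_1 u : vscal 1 u = u.
Proof. destruct u as [[] []]; apply C2_eq; simpl; ring. Qed.

(** The only factor for which [psi_xx = J psi_x + kappa psi] can hold, as pairing with [psi] shows:
    [<psi, psi_xx> = - |psi_x|^2] and [<psi, J psi_x> = 1 / (2 a)]. *)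
Definition kappa (a : R) (psi : R * R -> C2) (q : R * R) : R :=
  - (inner (V1 psi q) (V1 psi q) + 1 / (2 * a)) / inner (psi q) (psi q).

Section NormalForm.
Variables (a : R) (W : R * R -> Prop) (psi : R * R -> C2).
Hypothesis a_nz : a <> 0.
Hypothesis W_open : open W.
Hypothesis NF : normal_form a W psi.

Let X := V1 psi.
Let Y := V2 psi.
Let Xx := V1 (V1 psi).
Let Xy := V2 (V1 psi).

Lemma nf_psi_x q : W q -> is_vpd true psi q (X q).
Proof. apply (smooth_vpd W psi true), NF. Qed.
Lemma nf_psi_y q : W q -> is_vpd false psi q (Y q).
Proof. apply (smooth_vpd W psi false), NF. Qed.
Lemma nf_X_x q : W q -> is_vpd true X q (Xx q).
Proof. apply (smooth_vpd W X true). apply (smooth_VV W psi true), NF. Qed.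
Lemma nf_X_y q : W q -> is_vpd false X q (Xy q).
Proof. apply (smooth_vpd W X false). apply (smooth_VV W psi true), NF. Qed.

Lemma nf_Y q : W q -> Y q = twist (fst q) (X q).
Proof. intros Wq; now apply NF. Qed.

Lemma nf_Xy q : W q -> Xy q = vadd (J (twist (fst q) (X q))) (twist (fst q) (Xx q)).
Proof.
  intros Wq. unfold Xy.
  rewrite (VV_comm W psi q W_open (proj1 NF) Wq : V2 (V1 psi) q = V1 (V2 psi) q).
  rewrite (VV_ext_open true W (V2 psi) (fun q => twist (fst q) (X q)) q W_open Wq nf_Y
    : V1 (V2 psi) q = V1 (fun q => twist (fst q) (X q)) q).
  rewrite (is_vpd_unique true _ q _ (is_vpd_twist true X q _ (nf_X_x q Wq))
    : V1 (fun q => twist (fst q) (X q)) q = _).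
  now rewrite vscal_1.
Qed.

(** That is, [psi_xx + psi_yy = J psi_x]: the [y]-derivative of [psi_y = T psi_x], simplified by
    [T^2 = -1] and [T J = - J T]. *)
Lemma nf_Y_y q : W q -> is_vpd false Y q (vsub (J (X q)) (Xx q)).
Proof.
  intros Wq.
  assert (H : is_vpd false Y q (VV false Y q)).
  { apply (smooth_vpd W); [|exact Wq]. apply (smooth_VV W psi false), NF. }
  apply (is_vpd_eq _ _ _ _ _ H).
  rewrite (VV_ext_open false W Y (fun q => twist (fst q) (X q)) q W_open Wq nf_Y).
  rewrite (is_vpd_unique false _ q _ (is_vpd_twist false X q _ (nf_X_y q Wq))).
  rewrite vzero_l, nf_Xy by exact Wq.
  rewrite <- (vscal_1 (J (twist _ _))), <- (vscal_1 (twist _ (Xx q))), twist_linear, !vscal_1.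
  rewrite twist_J, !twist_twist, vsub_vscal.
  generalize (X q) (Xx q). intros [[] []] [[] []]. apply C2_eq; simpl; ring.
Qed.

Lemma is_pd_constant_on d f c q l : W q -> (forall z, W z -> f z = c) -> is_pd d f q l -> l = 0.
Proof.
  intros Wq E H. apply is_pd_unique in H. rewrite <- H.
  apply is_pd_unique, (is_pd_ext_open d W (fun _ => c)); auto.
  - intros; symmetry; auto.
  - apply is_pd_const.
Qed.

Lemma nf_liouville_x q : W q -> inner (psi q) (J (X q)) = 1 / (2 * a).
Proof. intros Wq; now apply NF. Qed.
Lemma nf_liouville_y q : W q -> inner (psi q) (J (Y q)) = 0.
Proof. intros Wq; now apply NF. Qed.

Lemma nf_psi_JXx q : W q -> inner (psi q) (J (Xx q)) = 0.
Proof.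
  intros Wq.
  assert (H := is_pd_inner true _ _ q _ _ (nf_psi_x q Wq) (is_vpd_J _ _ _ _ (nf_X_x q Wq))).
  apply (is_pd_constant_on true _ (1 / (2 * a)) q) in H; auto using nf_liouville_x.
  rewrite inner_J_self in H. lra.
Qed.

Lemma nf_psi_JXy q : W q -> inner (psi q) (J (Xy q)) = 0.
Proof.
  intros Wq.
  assert (H := is_pd_inner false _ _ q _ _ (nf_psi_y q Wq) (is_vpd_J _ _ _ _ (nf_X_y q Wq))).
  apply (is_pd_constant_on false _ (1 / (2 * a)) q) in H; auto using nf_liouville_x.
  rewrite nf_Y, inner_J_r, inner_twist_J_self in H by exact Wq. lra.
Qed.

(** A hidden constraint: with [psi_yy = J psi_x - psi_xx] and [<psi, J psi_xx> = 0], the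
    [y]-derivative of [<psi, J psi_y> = 0] becomes this one. In particular [|psi|] depends on [y]
    alone. *)
Lemma nf_psi_X q : W q -> inner (psi q) (X q) = 0.
Proof.
  intros Wq.
  assert (H := is_pd_inner false _ _ q _ _ (nf_psi_y q Wq) (is_vpd_J _ _ _ _ (nf_Y_y q Wq))).
  apply (is_pd_constant_on false _ 0 q) in H; auto using nf_liouville_y.
  rewrite inner_J_self, vsub_vscal, J_vadd, J_J, J_vscal, inner_vadd_r, !inner_vscal_r,
    nf_psi_JXx in H by exact Wq. lra.
Qed.

Lemma nf_psi_Xx q : W q -> inner (psi q) (Xx q) = - inner (X q) (X q).
Proof.
  intros Wq.
  assert (H := is_pd_inner true _ _ q _ _ (nf_psi_x q Wq) (nf_X_x q Wq)).
  apply (is_pd_constant_on true _ 0 q) in H; auto using nf_psi_X. lra.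
Qed.

Lemma nf_psi_Xy q : W q -> inner (psi q) (Xy q) = 0.
Proof.
  intros Wq.
  assert (H := is_pd_inner false _ _ q _ _ (nf_psi_y q Wq) (nf_X_y q Wq)).
  apply (is_pd_constant_on false _ 0 q) in H; auto using nf_psi_X.
  rewrite nf_Y, inner_sym, inner_twist_self in H by exact Wq. lra.
Qed.

(** At a zero of [psi] the product [<psi, J psi_x>] would be 0 instead of [1 / (2 a)]. *)
Lemma nf_psi_pos q : W q -> 0 < inner (psi q) (psi q).
Proof.
  intros Wq. assert (H := nf_liouville_x q Wq).
  destruct (Rle_lt_or_eq_dec _ _ (inner_pos (psi q))) as [l|e]; [exact l|exfalso].
  assert (nz : 1 / (2 * a) <> 0).
  { unfold Rdiv. rewrite Rmult_1_l. apply Rinv_neq_0_compat.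
    apply Rmult_integral_contrapositive; split; [lra | exact a_nz]. }
  apply nz. rewrite <- H. revert e. clear. generalize (psi q) (J (X q)).
  intros [[u1 u2] [u3 u4]] [[] []]. rewrite !inner_components; simpl. intros e.
  assert (u1 = 0) by nra. assert (u2 = 0) by nra. assert (u3 = 0) by nra.
  assert (u4 = 0) by nra. subst; ring.
Qed.

Let w q := vadd (Xx q) (vscal (-1) (J (X q))).

(** Expand [w = psi_xx - J psi_x] in the orthogonal basis [psi], [J psi], [T psi], [J T psi]. The
    differentiated constraints kill all components but the first; the last two use
    [psi_xy = T w]. *)
Lemma nf_w q : W q -> w q = vscal (kappa a psi q) (psi q).
Proof.
  intros Wq. assert (P := nf_psi_pos q Wq).
  assert (Xw : Xy q = twist (fst q) (w q)).
  { rewrite nf_Xy by exact Wq. unfold w.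
    rewrite <- (vscal_1 (Xx q)) at 2. rewrite twist_linear, twist_J.
    generalize (twist (fst q) (Xx q)) (J (twist (fst q) (X q))).
    intros [[] []] [[] []]. apply C2_eq; simpl; ring. }
  apply (vscal_inj (inner (psi q) (psi q))); [lra|].
  rewrite (twist_basis (fst q) (psi q) (w q)).
  assert (E1 : inner (w q) (psi q) = - (inner (X q) (X q) + 1 / (2 * a))).
  { unfold w. rewrite inner_vadd_l, inner_vscal_l, inner_sym, nf_psi_Xx by exact Wq.
    rewrite (inner_sym (J (X q))), nf_liouville_x by exact Wq. ring. }
  assert (E2 : inner (w q) (J (psi q)) = 0).
  { rewrite inner_J_r. unfold w. rewrite J_vadd, J_vscal, J_J, inner_vadd_r, !inner_vscal_r.
    rewrite nf_psi_JXx, nf_psi_X by exact Wq. ring. }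
  assert (E3 : inner (w q) (twist (fst q) (psi q)) = 0).
  { assert (H := nf_psi_Xy q Wq). rewrite Xw, inner_sym, inner_twist in H. lra. }
  assert (E4 : inner (w q) (J (twist (fst q) (psi q))) = 0).
  { assert (H := nf_psi_JXy q Wq). rewrite Xw in H.
    assert (Z : inner (w q) (J (twist (fst q) (psi q))) = - inner (psi q) (J (twist (fst q) (w q)))).
    { generalize (psi q) (w q). clear. intros [[] []] [[] []].
      rewrite !inner_components; simpl; ring. }
    lra. }
  rewrite E1, E2, E3, E4. unfold kappa. fold X.
  rewrite vscal_vscal, !vzero_r.
  f_equal. field. split; [exact a_nz | lra].
Qed.

Lemma nf_Xx q : W q -> Xx q = vadd (J (X q)) (vscal (kappa a psi q) (psi q)).
Proof.
  intros Wq. rewrite <- nf_w by exact Wq. unfold w. generalize (Xx q) (J (X q)).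
  intros [[] []] [[] []]. apply C2_eq; simpl; ring.
Qed.

Lemma nf_Xy_kappa q : W q -> Xy q = vscal (kappa a psi q) (twist (fst q) (psi q)).
Proof.
  intros Wq. rewrite nf_Xy, nf_Xx by exact Wq.
  rewrite <- (vscal_1 (J (X q))), twist_linear, twist_J, vscal_1.
  generalize (J (twist (fst q) (X q))) (vscal (kappa a psi q) (twist (fst q) (psi q))).
  intros [[] []] [[] []]. apply C2_eq; simpl; ring.
Qed.

Lemma nf_kappa q : W q ->
  inner (X q) (X q) + 1 / (2 * a) = - kappa a psi q * inner (psi q) (psi q).
Proof.
  intros Wq. assert (P := nf_psi_pos q Wq). unfold kappa, X. field. split; [exact a_nz | lra].
Qed.

(** In both directions the derivative of [|psi_x|^2] is [- kappa] times that of [|psi|^2], so the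
    quotient defining [kappa] is stationary. *)
Lemma nf_kappa_pd d q : W q -> is_pd d (kappa a psi) q 0.
Proof.
  intros Wq. assert (P := nf_psi_pos q Wq).
  assert (H : forall L M, is_vpd d X q L -> is_vpd d psi q M ->
    inner L (X q) = - kappa a psi q * inner M (psi q) -> is_pd d (kappa a psi) q 0).
  { intros L M HL HM E.
    assert (DE := is_pd_inner d _ _ q _ _ HL HL). assert (DF := is_pd_inner d _ _ q _ _ HM HM).
    assert (Z := is_pd_mult d q _ _ _ _
      (is_pd_opp d q _ _ (is_pd_plus d q _ _ _ _ DE (is_pd_const d q (1 / (2 * a)))))
      (is_pd_inv d q _ _ (Rgt_not_eq _ _ P) DF)).
    apply (is_pd_eq _ _ _ _ _ Z). cbv beta.
    rewrite (inner_sym (X q) L), (inner_sym (psi q) M), E.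
    rewrite (nf_kappa q Wq). field. lra. }
  destruct d.
  - apply (H _ _ (nf_X_x q Wq) (nf_psi_x q Wq)).
    rewrite nf_Xx, inner_vadd_l, inner_vscal_l, (inner_sym (J (X q))), inner_J_self,
      (inner_sym (X q)), nf_psi_X by exact Wq. ring.
  - apply (H _ _ (nf_X_y q Wq) (nf_psi_y q Wq)).
    rewrite nf_Xy_kappa, inner_vscal_l, inner_twist, <- nf_Y, (inner_sym (Y q)) by exact Wq. ring.
Qed.

(** Completing the square. The equality case [psi_x = J psi / 2] is the double root
    [lam = mu = 1 / 2]. *)
Lemma nf_kappa_defect q : W q ->
  inner (vadd (X q) (vscal (- / 2) (J (psi q)))) (vadd (X q) (vscal (- / 2) (J (psi q)))) =
  (1 / 4 - kappa a psi q) * inner (psi q) (psi q).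
Proof.
  intros Wq.
  transitivity (inner (X q) (X q) + inner (psi q) (J (X q)) + 1 / 4 * inner (psi q) (psi q)).
  - generalize (X q) (psi q). intros [[] []] [[] []]. rewrite !inner_components; simpl; field.
  - rewrite nf_liouville_x by exact Wq. generalize (nf_kappa q Wq). lra.
Qed.

Lemma nf_kappa_le q : W q -> kappa a psi q <= 1 / 4.
Proof.
  intros Wq. assert (H := nf_kappa_defect q Wq). assert (P := nf_psi_pos q Wq).
  assert (N := inner_pos (vadd (X q) (vscal (- / 2) (J (psi q))))). rewrite H in N.
  apply Rnot_lt_le; intros l. nra.
Qed.

End NormalForm.

(** * Uniqueness for the linear system *)

Lemma is_vpd_vadd d F G p L M : is_vpd d F p L -> is_vpd d G p M ->
  is_vpd d (fun q => vadd (F q) (G q)) p (vadd L M).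
Proof.
  intros (A & B & C & D) (A' & B' & C' & D').
  split4; apply is_pd_plus; assumption.
Qed.

Lemma is_vpd_vscal d f F p l L : is_pd d f p l -> is_vpd d F p L ->
  is_vpd d (fun q => vscal (f q) (F q)) p (vadd (vscal l (F p)) (vscal (f p) L)).
Proof.
  intros H (A & B & C & D).
  split4; (eapply is_pd_eq; [eapply is_pd_ext|]).
  2: exact (is_pd_mult d p _ _ _ _ H A).
  4: exact (is_pd_mult d p _ _ _ _ H B).
  6: exact (is_pd_mult d p _ _ _ _ H C).
  8: exact (is_pd_mult d p _ _ _ _ H D).
  all: try (intros q); simpl; unfold Re, Im; ring.
Qed.

Definition solves (k : R) (W : R * R -> Prop) (P X : R * R -> C2) : Prop :=
  forall q, W q -> is_vpd true P q (X q) /\ is_vpd false P q (twist (fst q) (X q)) /\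
    is_vpd true X q (vadd (J (X q)) (vscal k (P q))) /\
    is_vpd false X q (vscal k (twist (fst q) (P q))).

Lemma inner_bound u v : Rabs (2 * inner u v) <= inner u u + inner v v.
Proof.
  assert (H1 := inner_pos (vadd u v)). assert (H2 := inner_pos (vadd u (vscal (-1) v))).
  rewrite !inner_vadd_l, !inner_vadd_r in H1, H2.
  rewrite !inner_vscal_l, !inner_vscal_r, (inner_sym v u) in H2. rewrite (inner_sym v u) in H1.
  apply Rabs_le. lra.
Qed.

(** The energy [|P|^2 + |X|^2] grows at rate at most [|1 + k|] in [x] and [|1 - k|] in [y], so
    Gronwall applies along each leg of the path. *)
Lemma solves_zero k p r P X : 0 < r -> solves k (box p r) P X ->
  inner (P p) (P p) + inner (X p) (X p) = 0 ->
  forall q, box p r q -> inner (P q) (P q) + inner (X q) (X q) = 0.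
Proof.
  intros rp S Z. pose (s := fun q => inner (P q) (P q) + inner (X q) (X q)).
  pose (s' := fun (d : bool) q => if d then 2 * (1 + k) * inner (P q) (X q)
                     else 2 * (1 - k) * inner (P q) (twist (fst q) (X q))).
  assert (D : forall d q, box p r q -> is_pd d s q (s' d q)).
  { intros [] q Bq; destruct (S q Bq) as (A & B & C & E).
    - eapply is_pd_eq; [exact (is_pd_plus _ _ _ _ _ _ (is_pd_inner _ _ _ _ _ _ A A) (is_pd_inner _ _ _ _ _ _ C C))|].
      unfold s'. generalize (X q) (P q). intros [[] []] [[] []].
      rewrite !inner_components; simpl; ring.
    - eapply is_pd_eq; [exact (is_pd_plus _ _ _ _ _ _ (is_pd_inner _ _ _ _ _ _ B B) (is_pd_inner _ _ _ _ _ _ E E))|].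
      unfold s'. generalize (X q) (P q). intros [[] []] [[] []].
      rewrite !inner_components; simpl; ring. }
  assert (B : forall d q, 0 <= s q /\ Rabs (s' d q) <= (1 + Rabs k) * s q).
  { intros d q. assert (P1 := inner_pos (P q)). assert (P2 := inner_pos (X q)).
    split; [unfold s; lra|].
    assert (F : forall c m, Rabs (2 * m) <= s q -> Rabs c <= 1 + Rabs k ->
              Rabs (2 * c * m) <= (1 + Rabs k) * s q).
    { intros c m Hm Hc. replace (2 * c * m) with (c * (2 * m)) by ring. rewrite Rabs_mult.
      apply Rmult_le_compat; auto using Rabs_pos. }
    destruct d; apply F.
    - apply inner_bound.
    - eapply Rle_trans; [apply Rabs_triang|]. rewrite Rabs_R1; lra.
    - eapply Rle_trans; [apply inner_bound|]. rewrite inner_twist_twist. unfold s; lra.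
    - eapply Rle_trans; [apply Rabs_triang|]. rewrite Rabs_R1, Rabs_Ropp; lra. }
  apply (box_path_induction p r (fun q => s q = 0)); auto.
  - intros x Bx.
    apply (gronwall_zero (fun t => s (t, snd p)) (fun t => s' true (t, snd p)) (1 + Rabs k) (fst p) x).
    + intros t Ht. exact (D true (t, snd p) (box_between_fst p r x (snd p) t Bx Ht)).
    + intros t _. apply B.
    + rewrite <- surjective_pairing. exact Z.
  - intros x _ E y By.
    apply (gronwall_zero (fun t => s (x, t)) (fun t => s' false (x, t)) (1 + Rabs k) (snd p) y).
    + intros t Ht. exact (D false (x, t) (box_between_snd p r x y t By Ht)).
    + intros t _. apply B.
    + exact E.
Qed.

Lemma inner_zero u : inner u u = 0 -> u = vzero.
Proof.
  destruct u as [[u1 u2] [u3 u4]]. rewrite inner_components; simpl. intros E.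
  apply C2_eq; simpl; nra.
Qed.

Lemma solves_unique k p r P X P' X' : 0 < r ->
  solves k (box p r) P X -> solves k (box p r) P' X' -> P p = P' p -> X p = X' p ->
  forall q, box p r q -> P q = P' q.
Proof.
  intros rp S S' E1 E2 q Bq.
  assert (Z : forall u : C2, vadd u (vscal (-1) u) = vzero).
  { intros [[] []]; apply C2_eq; simpl; ring. }
  assert (Z' : inner vzero vzero = 0) by (rewrite inner_components; simpl; ring).
  assert (H := solves_zero k p r (fun q => vadd (P q) (vscal (-1) (P' q)))
                 (fun q => vadd (X q) (vscal (-1) (X' q))) rp).
  lapply H; [clear H; intros H|].
  - cbv beta in H. rewrite E1, E2, !Z, Z' in H. specialize (H ltac:(ring) q Bq).
    assert (N1 := inner_pos (vadd (P q) (vscal (-1) (P' q)))).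
    assert (N2 := inner_pos (vadd (X q) (vscal (-1) (X' q)))).
    assert (H1 : vadd (P q) (vscal (-1) (P' q)) = vzero) by (apply inner_zero; lra).
    generalize H1; clear. generalize (P q) (P' q). intros [[] []] [[] []]. 
    unfold vzero, vadd, vscal; simpl. intros E. injection E. intros.
    apply C2_eq; simpl; lra.
  - clear q Bq. intros q Bq. destruct (S q Bq) as (A & B & C & D).
    destruct (S' q Bq) as (A' & B' & C' & D').
    assert (LIN : forall d F F' L L', is_vpd d F q L -> is_vpd d F' q L' ->
      is_vpd d (fun q => vadd (F q) (vscal (-1) (F' q))) q (vadd L (vscal (-1) L'))).
    { intros d F F' L L' H1 H2.
      eapply is_vpd_eq; [exact (is_vpd_vadd _ _ _ _ _ _ H1
        (is_vpd_vscal _ _ _ _ _ _ (is_pd_const d q (-1)) H2))|].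
      cbv beta. now rewrite vzero_l. }
    split4.
    + exact (LIN _ _ _ _ _ A A').
    + eapply is_vpd_eq; [exact (LIN _ _ _ _ _ B B')|].
      rewrite <- (vscal_1 (X q)) at 2. now rewrite twist_linear, vscal_1.
    + eapply is_vpd_eq; [exact (LIN _ _ _ _ _ C C')|].
      generalize (P q) (P' q) (X q) (X' q). intros [[] []] [[] []] [[] []] [[] []].
      apply C2_eq; simpl; ring.
    + eapply is_vpd_eq; [exact (LIN _ _ _ _ _ D D')|].
      rewrite <- (vscal_1 (P q)) at 2. rewrite twist_linear, vscal_1.
      generalize (twist (fst q) (P q)) (twist (fst q) (P' q)). intros [[] []] [[] []].
      apply C2_eq; simpl; ring.
Qed.

(** * Separated solutions and the unitary frame they determine *)

Definition rot (t : R) (v : C2) : C2 := (expi t * fst v, expi t * snd v)%C.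

Lemma rot_inner t u v : inner (rot t u) (rot t v) = inner u v.
Proof.
  transitivity ((sin t * sin t + cos t * cos t) * inner u v); [|rewrite sc1; ring].
  destruct u as [[] []], v as [[] []]. rewrite !inner_components; simpl; ring.
Qed.

Lemma rot_rot s t v : rot s (rot t v) = rot (s + t) v.
Proof.
  destruct v as [[] []]; apply C2_eq; simpl; rewrite cos_plus, sin_plus; ring.
Qed.

Lemma rot_0 v : rot 0 v = v.
Proof.
  destruct v as [[] []]; apply C2_eq; simpl; rewrite cos_0, sin_0; ring.
Qed.

Lemma rot_J t v : rot t (J v) = J (rot t v).
Proof. destruct v as [[] []]; apply C2_eq; simpl; ring. Qed.

Lemma twist_rot x y v : twist (x + y) (rot x v) = rot y (twist 0 v).
Proof.
  transitivity (vscal (sin x * sin x + cos x * cos x) (rot y (twist 0 v))).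
  - destruct v as [[] []]; apply C2_eq; simpl; rewrite cos_plus, sin_plus, cos_0, sin_0; ring.
  - rewrite sc1. apply vscal_1.
Qed.

Lemma is_vpd_rot d (c : R) v p : is_vpd d (fun q => rot (c * fst q) v) p
  (vscal (if d then c else 0) (J (rot (c * fst p) v))).
Proof.
  destruct v as [[v1 v2] [v3 v4]].
  assert (H := is_pd_mult d p _ _ _ _ (is_pd_const d p c) (is_pd_fst d p)). cbv beta in H.
  assert (K := is_pd_cos d p _ _ H). assert (S := is_pd_sin d p _ _ H).
  assert (Cst := is_pd_const d p).
  split4; (eapply is_pd_eq; [eapply is_pd_ext|]).
  2: exact (is_pd_minus d p _ _ _ _ (is_pd_mult d p _ _ _ _ K (Cst v1)) (is_pd_mult d p _ _ _ _ S (Cst v2))).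
  4: exact (is_pd_plus d p _ _ _ _ (is_pd_mult d p _ _ _ _ K (Cst v2)) (is_pd_mult d p _ _ _ _ S (Cst v1))).
  6: exact (is_pd_minus d p _ _ _ _ (is_pd_mult d p _ _ _ _ K (Cst v3)) (is_pd_mult d p _ _ _ _ S (Cst v4))).
  8: exact (is_pd_plus d p _ _ _ _ (is_pd_mult d p _ _ _ _ K (Cst v4)) (is_pd_mult d p _ _ _ _ S (Cst v3))).
  all: try (intros q); simpl; destruct d; ring.
Qed.

Section Separated.
Variables (lam mu : R) (e1 e2 : C2) (A B : R -> R).
Hypothesis lam_mu : lam + mu = 1.
Hypothesis e12 : e2 = J (twist 0 e1).
Hypothesis dA : forall y : R, is_derive A y (mu * B y).
Hypothesis dB : forall y : R, is_derive B y (- lam * A y).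

Definition separated (q : R * R) : C2 :=
  vadd (vscal (A (snd q)) (rot (lam * fst q) e1)) (vscal (B (snd q)) (rot (mu * fst q) e2)).
Definition separated_x (q : R * R) : C2 :=
  J (vadd (vscal (lam * A (snd q)) (rot (lam * fst q) e1))
          (vscal (mu * B (snd q)) (rot (mu * fst q) e2))).

Lemma twist_0_e2 : twist 0 e2 = J e1.
Proof.
  rewrite e12, twist_J, twist_twist. destruct e1 as [[] []]; apply C2_eq; simpl; ring.
Qed.

(** [T] is antilinear, so it turns [e^(i lam x) e1] into [e^(i (1 - lam) x) T_0 e1]; as
    [lam + mu = 1] and [e2 = J T_0 e1], it exchanges the two exponentials up to [J]. This reduces
    the [y]-equation to the system for [A] and [B]. *)
Lemma twist_separated c1 c2 (q : R * R) :
  twist (fst q) (vadd (vscal c1 (rot (lam * fst q) e1)) (vscal c2 (rot (mu * fst q) e2))) =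
  J (vadd (vscal (- c1) (rot (mu * fst q) e2)) (vscal c2 (rot (lam * fst q) e1))).
Proof.
  rewrite twist_linear.
  replace (fst q) with (lam * fst q + mu * fst q) at 1 by (rewrite <- Rmult_plus_distr_r, lam_mu; ring).
  replace (fst q) with (mu * fst q + lam * fst q) at 4 by (rewrite <- Rmult_plus_distr_r, (Rplus_comm mu), lam_mu; ring).
  rewrite !twist_rot, twist_0_e2, rot_J.
  rewrite e12, rot_J, J_vadd, !J_vscal, J_J.
  generalize (rot (mu * fst q) (twist 0 e1)) (J (rot (lam * fst q) e1)).
  intros [[] []] [[] []]. apply C2_eq; simpl; ring.
Qed.

Lemma separated_solves W : solves (lam * mu) W separated separated_x.
Proof.
  intros q _.
  assert (Hs : forall (c : R) (G : R -> R) g d, is_derive G (snd q) g ->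
    is_pd d (fun q : R * R => c * G (snd q)) q (if d then 0 else c * g)).
  { intros c G g d HG.
    eapply is_pd_eq; [exact (is_pd_mult d q _ _ _ _ (is_pd_const d q c)
       (is_pd_comp d q G snd _ _ HG (is_pd_snd d q)))|]. destruct d; ring. }
  assert (GEN : forall c1 c2 d, is_vpd d (fun q => vadd (vscal (c1 * A (snd q)) (rot (lam * fst q) e1))
      (vscal (c2 * B (snd q)) (rot (mu * fst q) e2))) q
      (if d then J (vadd (vscal (c1 * lam * A (snd q)) (rot (lam * fst q) e1))
                         (vscal (c2 * mu * B (snd q)) (rot (mu * fst q) e2)))
       else (vadd (vscal (c1 * mu * B (snd q)) (rot (lam * fst q) e1))
                  (vscal (- (c2 * lam * A (snd q))) (rot (mu * fst q) e2))))).
  { intros c1 c2 d.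
    eapply is_vpd_eq; [exact (is_vpd_vadd _ _ _ _ _ _
      (is_vpd_vscal _ _ _ _ _ _ (Hs c1 A _ d (dA (snd q))) (is_vpd_rot d lam e1 q))
      (is_vpd_vscal _ _ _ _ _ _ (Hs c2 B _ d (dB (snd q))) (is_vpd_rot d mu e2 q)))|].
    cbv beta. generalize (rot (lam * fst q) e1) (rot (mu * fst q) e2).
    intros [[] []] [[] []]. destruct d; apply C2_eq; simpl; ring. }
  assert (GP : forall d, is_vpd d separated q
      (if d then J (vadd (vscal (1 * lam * A (snd q)) (rot (lam * fst q) e1))
                         (vscal (1 * mu * B (snd q)) (rot (mu * fst q) e2)))
       else (vadd (vscal (1 * mu * B (snd q)) (rot (lam * fst q) e1))
                  (vscal (- (1 * lam * A (snd q))) (rot (mu * fst q) e2))))).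
  { intros d. refine (is_vpd_ext d _ _ q _ _ (GEN 1 1 d)).
    intros z. unfold separated. now rewrite !Rmult_1_l. }
  split4.
  - eapply is_vpd_eq; [exact (GP true)|]. unfold separated_x. now rewrite !Rmult_1_l.
  - eapply is_vpd_eq; [exact (GP false)|]. unfold separated_x.
    rewrite twist_J, twist_separated, J_J, !Rmult_1_l.
    generalize (rot (lam * fst q) e1) (rot (mu * fst q) e2).
    intros [[] []] [[] []]. apply C2_eq; simpl; ring.
  - eapply is_vpd_eq; [exact (is_vpd_J _ _ _ _ (GEN lam mu true))|].
    unfold separated_x, separated. rewrite !J_J.
    replace mu with (1 - lam) by lra.
    generalize (rot (lam * fst q) e1) (rot ((1 - lam) * fst q) e2).
    intros [[] []] [[] []]. apply C2_eq; simpl; ring.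
  - eapply is_vpd_eq; [exact (is_vpd_J _ _ _ _ (GEN lam mu false))|].
    unfold separated. rewrite twist_separated.
    generalize (rot (lam * fst q) e1) (rot (mu * fst q) e2).
    intros [[] []] [[] []]. apply C2_eq; simpl; ring.
Qed.
End Separated.

Lemma rot_twist_orthogonal s t u : inner (rot s u) (rot t (J (twist 0 u))) = 0.
Proof.
  destruct u as [[] []]. rewrite inner_components; simpl. rewrite cos_0, sin_0. ring.
Qed.

Lemma inner_twist_0 u : inner (J (twist 0 u)) (J (twist 0 u)) = inner u u.
Proof.
  destruct u as [[] []]. rewrite !inner_components; simpl. rewrite cos_0, sin_0. ring.
Qed.

Lemma unit_vector v : 0 < inner v v -> exists n u, 0 < n /\ v = vscal n u /\ inner u u = 1.
Proof.
  intros p. assert (s := sqrt_lt_R0 _ p). exists (sqrt (inner v v)), (vscal (/ sqrt (inner v v)) v).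
  split; [exact s|]. split.
  - rewrite vscal_vscal, Rinv_r, vscal_1; [reflexivity|lra].
  - rewrite inner_vscal_l, inner_vscal_r. rewrite <- (sqrt_sqrt (inner v v)) at 3 by lra.
    field. lra.
Qed.

Lemma rot_inverse t v : rot t (rot (- t) v) = v.
Proof. rewrite rot_rot, Rplus_opp_r. apply rot_0. Qed.

(** Decompose [P] into eigencomponents of the [x]-evolution: [P = A + B] and [X = J (lam A + mu B)].
    The constraints force [B] into the real line of [J T A], which is what makes the coefficients
    real and the frame unitary. *)
Lemma separation_at_point lam mu c x0 (P X : C2) :
  0 < inner P P -> inner P X = 0 -> inner P (J X) = c -> inner P (J (twist x0 X)) = 0 ->
  inner X X + c = - (lam * mu) * inner P P -> lam + mu = 1 ->
  exists e1 A0 B0, inner e1 e1 = 1 /\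
    P = vadd (vscal A0 (rot (lam * x0) e1)) (vscal B0 (rot (mu * x0) (J (twist 0 e1)))) /\
    X = J (vadd (vscal (lam * A0) (rot (lam * x0) e1))
                (vscal (mu * B0) (rot (mu * x0) (J (twist 0 e1))))).
Proof.
  intros Pp PX PJX PJTX XX LM.
  destruct (Req_dec lam mu) as [eq|ne].
  - assert (lam = 1 / 2) by lra. assert (mu = 1 / 2) by lra.
    (* At the double root the completed square vanishes, so a single exponential suffices and
       [B0 = 0]. *)
    assert (Z : vadd X (vscal (- / 2) (J P)) = vzero).
    { apply inner_zero.
      transitivity (inner X X + inner P (J X) + 1 / 4 * inner P P).
      - clear. destruct X as [[] []], P as [[] []]. rewrite !inner_components; simpl; field.
      - rewrite PJX. subst lam mu. lra. }
    assert (XE : X = vscal (/ 2) (J P)).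
    { clear - Z. destruct X as [[] []], P as [[] []]. unfold vadd, vscal, vzero in Z; simpl in Z.
      injection Z; intros. apply C2_eq; simpl; lra. }
    destruct (unit_vector P Pp) as (n & u & np & E & U).
    exists (rot (- (lam * x0)) u), n, 0.
    rewrite rot_inner, rot_inverse, Rmult_0_r, !vzero_r.
    split; [exact U|]. split; [exact E|].
    rewrite XE, E, !J_vscal, vscal_vscal. f_equal. replace lam with (/ 2) by lra. ring.
  - assert (dn : lam - mu <> 0) by lra.
    pose (A := vscal (- / (lam - mu)) (vadd (J X) (vscal mu P))).
    pose (B := vscal (/ (lam - mu)) (vadd (J X) (vscal lam P))).
    assert (PAB : P = vadd A B).
    { unfold A, B. destruct X as [[] []], P as [[] []]. apply C2_eq; simpl; field; exact dn. }
    assert (XAB : X = J (vadd (vscal lam A) (vscal mu B))).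
    { unfold A, B. destruct X as [[] []], P as [[] []]. apply C2_eq; simpl; field; exact dn. }
    assert (AB : inner A B = 0).
    { unfold A, B. rewrite inner_vscal_l, inner_vscal_r.
      transitivity (- / (lam - mu) * (/ (lam - mu) *
        (inner X X + (lam + mu) * inner P (J X) + lam * mu * inner P P))).
      - do 2 f_equal. clear. destruct X as [[] []], P as [[] []].
        rewrite !inner_components; simpl; ring.
      - rewrite LM, PJX. replace (inner X X + 1 * c + lam * mu * inner P P) with 0 by lra. ring. }
    assert (AJB : inner A (J B) = 0).
    { unfold A, B. rewrite J_vscal, inner_vscal_l, inner_vscal_r.
      transitivity (- / (lam - mu) * (/ (lam - mu) * ((lam - mu) * inner P X))).
      - do 2 f_equal. clear. destruct X as [[] []], P as [[] []].
        rewrite !inner_components; simpl; ring.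
      - rewrite PX. ring. }
    (* The second Liouville condition enters here: [<P, J T X> = (lam - mu) <B, T A>]. With
       [<A, B> = <A, J B> = 0] only the direction [J T A] remains for [B]. *)
    assert (BTA : inner B (twist x0 A) = 0).
    { apply (Rmult_eq_reg_l (lam - mu)); [|exact dn]. rewrite Rmult_0_r, <- PJTX.
      rewrite XAB, twist_J, J_vscal, J_J, !inner_vscal_r, twist_linear, inner_vadd_r,
        !inner_vscal_r.
      rewrite PAB, !inner_vadd_l, !inner_twist_self, (inner_sym A), inner_twist. ring. }
    destruct (Rle_lt_or_eq_dec _ _ (inner_pos A)) as [Ap|Az].
    + destruct (unit_vector A Ap) as (n & u & np & E & U).
      exists (rot (- (lam * x0)) u), n, (inner B (J (twist x0 u))).
      assert (TW : rot (mu * x0) (J (twist 0 (rot (- (lam * x0)) u))) = J (twist x0 u)).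
      { rewrite rot_J, <- (twist_rot (lam * x0)), rot_inverse.
        now rewrite <- Rmult_plus_distr_r, LM, Rmult_1_l. }
      rewrite rot_inner, rot_inverse, TW, <- (vscal_vscal lam), <- (vscal_vscal mu), <- E.
      assert (BE : B = vscal (inner B (J (twist x0 u))) (J (twist x0 u))).
      { rewrite E in AB, AJB, BTA.
        rewrite inner_vscal_l in AB, AJB. rewrite twist_vscal, inner_vscal_r in BTA.
        assert (Z : forall z, n * z = 0 -> z = 0).
        { intros z Hz. apply (Rmult_eq_reg_l n); [|lra]. rewrite Hz; ring. }
        apply Z in AB, AJB, BTA.
        assert (H := twist_basis x0 u B).
        rewrite U, vscal_1, (inner_sym B u), AB, (inner_J_r B u), AJB, BTA,
          Ropp_0, !vzero_l in H.
        rewrite H at 1. generalize (vscal (inner B (J (twist x0 u))) (J (twist x0 u))) (J u).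
        intros [[] []] [[] []]; apply C2_eq; simpl; ring. }
      rewrite <- BE. auto.
    (* Without a [lam]-component the frame is built from [B]: the second frame vector is known, and
       the first is recovered as [e1 = - J T_0 e2]. *)
    + assert (A0 : A = vzero) by (apply inner_zero; lra).
      assert (PB : P = B).
      { rewrite PAB, A0. generalize B. intros [[] []]; apply C2_eq; simpl; ring. }
      destruct (unit_vector P Pp) as (n & u & np & E & U).
      exists (vscal (-1) (J (twist 0 (rot (- (mu * x0)) u)))), 0, n.
      assert (TW : J (twist 0 (vscal (-1) (J (twist 0 (rot (- (mu * x0)) u))))) =
                   rot (- (mu * x0)) u).
      { rewrite twist_vscal, twist_J, twist_twist. generalize (rot (- (mu * x0)) u).
        intros [[] []]; apply C2_eq; simpl; ring. }
      rewrite TW, rot_inverse, Rmult_0_r, !vzero_l, <- (vscal_vscal mu), <- E.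
      split; [|split; [reflexivity|]].
      * rewrite inner_vscal_l, inner_vscal_r, inner_twist_0, rot_inner, U. ring.
      * rewrite XAB, A0, <- PB. generalize P. intros [[] []]; apply C2_eq; simpl; ring.
Qed.

Definition frame (e : C2) (z : C2) : C2 :=
  (fst z * fst e + snd z * fst (J (twist 0 e)), fst z * snd e + snd z * snd (J (twist 0 e)))%C.

Lemma frame_isometry e : inner e e = 1 -> isometry (frame e).
Proof.
  intros U z w. unfold vnorm. f_equal.
  transitivity (inner e e * inner (vsub z w) (vsub z w)); [|rewrite U; ring].
  destruct e as [[] []], z as [[] []], w as [[] []]. rewrite !inner_components.
  unfold frame, twist, expi. rewrite cos_0, sin_0. simpl. ring.
Qed.

(** The quadratic relation is [<psi, J psi_x> = 1 / (2 a)] at the centre. [A] and [B] stay arbitrary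
    solutions with the right initial values, so that each model can supply explicit ones and
    uniqueness does the rest. *)
Lemma separation a p r psi lam mu : a <> 0 -> 0 < r -> normal_form a (box p r) psi ->
  lam + mu = 1 -> lam * mu = kappa a psi p ->
  exists e A0 B0, inner e e = 1 /\ lam * (A0 * A0) + mu * (B0 * B0) = - (1 / (2 * a)) /\
    forall A B : R -> R, A (snd p) = A0 -> B (snd p) = B0 ->
      (forall y : R, is_derive A y (mu * B y)) -> (forall y : R, is_derive B y (- lam * A y)) ->
      forall q, box p r q ->
        psi q = frame e (RtoC (A (snd q)) * expi (lam * fst q),
                         RtoC (B (snd q)) * expi (mu * fst q))%C.
Proof.
  intros anz rp NF LM K.
  assert (oW : open (box p r)) by apply open_box.
  assert (Wp := box_center p r rp).
  destruct (separation_at_point lam mu (1 / (2 * a)) (fst p) (psi p) (V1 psi p))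
    as (e & A0 & B0 & U & EP & EX).
  - now apply (nf_psi_pos a (box p r)).
  - now apply (nf_psi_X a (box p r)).
  - now apply (nf_liouville_x a (box p r)).
  - rewrite <- (nf_Y a (box p r) psi NF p Wp). now apply (nf_liouville_y a (box p r)).
  - rewrite (nf_kappa a (box p r) psi anz NF p Wp), K. ring.
  - exact LM.
  - exists e, A0, B0. split; [exact U|]. split.
    + assert (H := nf_liouville_x a (box p r) psi NF p Wp).
      rewrite EP, EX, J_J in H.
      assert (Uu := rot_inner (lam * fst p) e e).
      assert (Uv := rot_inner (mu * fst p) (J (twist 0 e)) (J (twist 0 e))).
      assert (Uo := rot_twist_orthogonal (lam * fst p) (mu * fst p) e).
      rewrite inner_twist_0 in Uv. rewrite U in Uu, Uv.
      rewrite !inner_vscal_r, !inner_vadd_l, !inner_vadd_r, !inner_vscal_l, !inner_vscal_r,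
        (inner_sym (rot (mu * fst p) _) (rot (lam * fst p) _)), Uu, Uv, Uo in H. lra.
    + intros A B EA EB dA dB q Bq.
      assert (S := separated_solves lam mu e (J (twist 0 e)) A B LM eq_refl dA dB (box p r)).
      rewrite (solves_unique (lam * mu) p r psi (V1 psi) (separated lam mu e (J (twist 0 e)) A B)
        (separated_x lam mu e (J (twist 0 e)) A B) rp); auto.
      * unfold separated, frame. destruct e as [[] []], (twist 0 _) as [[] []].
        apply C2_eq; simpl; ring.
      * intros z Wz.
        assert (KC : kappa a psi z = lam * mu).
        { rewrite K. apply (box_constant p r (kappa a psi)); auto.
          intros d y Wy. now apply (nf_kappa_pd a (box p r)). }
        rewrite <- KC. split4.
        -- now apply (nf_psi_x a (box p r)).
        -- rewrite <- (nf_Y a (box p r) psi NF z Wz). now apply (nf_psi_y a (box p r)).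
        -- rewrite <- (nf_Xx a (box p r) psi anz oW NF z Wz). now apply (nf_X_x a (box p r)).
        -- rewrite <- (nf_Xy_kappa a (box p r) psi anz oW NF z Wz). now apply (nf_X_y a (box p r)).
      * rewrite EP. unfold separated. now rewrite EA, EB.
      * rewrite EX. unfold separated_x. now rewrite EA, EB.
Qed.

(** * Comparison with the models *)

Lemma cosh_sinh_sq x : cosh x * cosh x = 1 + sinh x * sinh x.
Proof.
  unfold cosh, sinh.
  assert (E : exp x * exp (- x) = 1) by (rewrite <- exp_plus, Rplus_opp_r; apply exp_0).
  nra.
Qed.

Lemma cosh_pos x : 0 < cosh x.
Proof. unfold cosh. generalize (exp_pos x) (exp_pos (- x)). lra. Qed.

Lemma angle_exists x y : x * x + y * y = 1 -> exists s, cos s = x /\ sin s = y.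
Proof.
  intros H. assert (B : -1 <= x <= 1) by nra.
  assert (S : 1 - Rsqr x = Rsqr y) by (unfold Rsqr; lra).
  destruct (Rle_lt_dec 0 y) as [p|n].
  - exists (acos x). rewrite cos_acos, sin_acos, S, sqrt_Rsqr by assumption. auto.
  - exists (- acos x). rewrite cos_neg, sin_neg, cos_acos, sin_acos, S, Rsqr_neg, sqrt_Rsqr by lra.
    split; [reflexivity | ring].
Qed.

(** The nonvanishing profile of a model is positive; the sign of the initial value to be matched is
    moved into the isometry. *)
Lemma sign_exists x : exists e, e * e = 1 /\ e * Rabs x = x.
Proof.
  destruct (Rle_lt_dec 0 x).
  - exists 1. rewrite Rabs_pos_eq by assumption. split; ring.
  - exists (-1). rewrite Rabs_left by assumption. split; ring.
Qed.

Lemma abs_of_square x y : 0 <= y -> y * y = x * x -> y = Rabs x.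
Proof.
  intros p E. rewrite <- (Rabs_pos_eq y p). apply Rsqr_eq_abs_0. exact E.
Qed.

Lemma is_derive_scaled_affine (F F' : R -> R) k t0 c y0 y l :
  (forall x, derivable_pt_lim F x (F' x)) -> l = k * (c * F' (t0 + c * (y - y0))) ->
  is_derive (fun y => k * F (t0 + c * (y - y0))) y l.
Proof.
  intros H ->.
  apply (is_derive_scal (fun y => F (t0 + c * (y - y0)))).
  apply (is_derive_comp (K := R_AbsRing) (V := R_NormedModule) F).
  - apply is_derive_Reals, H.
  - auto_derive; [exact I | ring].
Qed.

Definition affine (m11 m12 m21 m22 c1 c2 : R) (q : R * R) : R * R :=
  (m11 * fst q + m12 * snd q + c1, m21 * fst q + m22 * snd q + c2).

(** In every model the phases are linear in one parameter and the profiles depend on the other, so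
    affine changes of the adapted coordinates suffice. *)
Definition congruent_on (W : R * R -> Prop) (psi model : R * R -> C2) : Prop :=
  exists m11 m12 m21 m22 c1 c2 (F : C2 -> C2), m11 * m22 - m12 * m21 <> 0 /\ isometry F /\
    forall q, W q -> psi q = F (model (affine m11 m12 m21 m22 c1 c2 q)).

Lemma isometry_comp F G : isometry F -> isometry G -> isometry (fun z : C2 => F (G z)).
Proof. intros HF HG z w. now rewrite HF, HG. Qed.

Lemma isometry_phases (c d : C) :
  Re c * Re c + Im c * Im c = 1 -> Re d * Re d + Im d * Im d = 1 ->
  isometry (fun z : C2 => (c * fst z, d * snd z)%C).
Proof.
  intros Hc Hd z w. unfold vnorm. f_equal.
  destruct c as [c1 c2], d as [d1 d2], z as [[z1 z2] [z3 z4]], w as [[w1 w2] [w3 w4]].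
  rewrite !inner_components; simpl in *.
  transitivity ((c1 * c1 + c2 * c2) * ((z1 - w1) * (z1 - w1) + (z2 - w2) * (z2 - w2)) +
     (d1 * d1 + d2 * d2) * ((z3 - w3) * (z3 - w3) + (z4 - w4) * (z4 - w4))); [ring|].
  rewrite Hc, Hd. ring.
Qed.

Lemma isometry_swap : isometry (fun z : C2 => (snd z, fst z)).
Proof.
  intros z w. unfold vnorm. f_equal. destruct z as [[] []], w as [[] []].
  rewrite !inner_components; simpl. ring.
Qed.

Section Models.
Variables (a : R) (p : R * R) (r : R) (psi : R * R -> C2) (lam mu : R).
Hypothesis a_nz : a <> 0.
Hypothesis r_pos : 0 < r.
Hypothesis NF : normal_form a (box p r) psi.
Hypothesis lam_mu : lam + mu = 1.
Hypothesis lam_mu_kappa : lam * mu = kappa a psi p.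

Let sep := separation a p r psi lam mu a_nz r_pos NF lam_mu lam_mu_kappa.

(** The condition gives [cosh^2 delta = - lam / mu], matching the ratio of the two frequencies.
    Since [lam A^2 + mu B^2 = - 1 / (2 a)] is negative while [mu < 0 < lam], it is [B] that cannot
    vanish and carries the [cosh]. *)
Lemma congruent_Phi delta : 0 < a -> 0 < delta -> mu < 0 ->
  sinh delta * sinh delta = - / mu -> 0 < sinh delta ->
  congruent_on (box p r) psi (Phi_model a delta).
Proof.
  intros ap dp mn Hs Sp.
  destruct sep as (e & A0 & B0 & U & Q & H).
  assert (Cp := cosh_pos delta). assert (HC := cosh_sinh_sq delta).
  set (S := sinh delta) in *. set (C := cosh delta) in *.
  assert (Kp : 0 < sqrt (2 * a)) by (apply sqrt_lt_R0; lra).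
  assert (KK : sqrt (2 * a) * sqrt (2 * a) = 2 * a) by (apply sqrt_sqrt; lra).
  set (K := sqrt (2 * a)) in *.
  assert (muS : mu * (S * S) = -1) by (rewrite Hs; field; lra).
  assert (muC : mu * (C * C) = - lam) by (rewrite HC; lra).
  destruct (sign_exists B0) as (s & ss & sB).
  (* [t0] is fitted to [A0]; the quadratic relation then gives [|B0|], and [s] accounts for its
     sign. *)
  pose (t0 := arcsinh (s * A0 * K * C / S)).
  pose (t := fun y => t0 + mu * C * (y - snd p)).
  assert (tp : t (snd p) = t0) by (unfold t; ring).
  assert (B0E : S * cosh t0 / K = Rabs B0).
  { apply abs_of_square.
    - apply Rlt_le, Rdiv_lt_0_compat; [apply Rmult_lt_0_compat; [exact Sp | apply cosh_pos] | exact Kp].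
    - transitivity (S * S * (cosh t0 * cosh t0) / (K * K)); [field; lra|].
      rewrite cosh_sinh_sq. unfold t0. rewrite sinh_arcsinh.
      apply (Rmult_eq_reg_l mu); [|lra].
      transitivity ((mu * (S * S) + (s * s) * (K * K) * (A0 * A0) * (mu * (C * C))) / (K * K));
        [field; lra|].
      rewrite muS, muC, ss, KK.
      replace (mu * (B0 * B0)) with (- (1 / (2 * a)) - lam * (A0 * A0)) by lra. field. lra. }
  (* The model lists the component of frequency [mu] first, hence the swap; the factor [- i s]
     removes the [i] of the model. *)
  exists (lam / C), 0, 0, (mu * C), 0, (t0 - mu * C * snd p),
    (fun z : C2 => frame e ((fun z : C2 => (RtoC s * fst z, (0, - s)%R * snd z)%C) (snd z, fst z))).
  split; [|split].
  - replace (lam / C * (mu * C) - 0 * 0) with (lam * mu) by (field; lra).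
    apply Rmult_integral_contrapositive_currified; nra.
  - apply isometry_comp with (F := frame e); [now apply frame_isometry|].
    apply isometry_comp with (F := fun z : C2 => (RtoC s * fst z, (0, - s)%R * snd z)%C) (G := fun z : C2 => (snd z, fst z));
      [apply isometry_phases; simpl; lra | apply isometry_swap].
  - intros q Bq.
    rewrite (H (fun y => s * (S / C) / K * sinh (t y)) (fun y => s * S / K * cosh (t y))); auto.
    + f_equal. unfold Phi_model, affine; simpl. fold S C K.
      replace (0 * fst q + mu * C * snd q + (t0 - mu * C * snd p)) with (t (snd q)) by (unfold t; ring).
      replace (C * (lam / C * fst q + 0 * snd q + 0)) with (lam * fst q) by (field; lra).
      replace (- ((lam / C * fst q + 0 * snd q + 0) / C)) with (mu * fst q).
      2: { replace mu with (- lam / (C * C)) by (rewrite <- muC; field; lra). field. lra. }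
      unfold tanh. fold S C. apply C2_eq; simpl; field; repeat split; lra.
    + rewrite tp. unfold t0. rewrite sinh_arcsinh.
      transitivity (s * s * A0); [field; repeat split; lra | rewrite ss; ring].
    + rewrite tp. transitivity (s * (S * cosh t0 / K)); [field; lra | now rewrite B0E].
    + intros y. apply (is_derive_scaled_affine sinh cosh); [apply derivable_pt_lim_sinh|].
      fold (t y). field. lra.
    + intros y. apply (is_derive_scaled_affine cosh sinh); [apply derivable_pt_lim_cosh|].
      fold (t y). replace lam with (- (mu * (C * C))) by lra. field. lra.
Qed.

(** Here [cos^2 gamma = - mu / lam] matches the frequencies. With [a < 0] the value of
    [lam A^2 + mu B^2] is positive, so now [A] cannot vanish and carries the [cosh]. *)
Lemma congruent_Upsilon gamma : a < 0 -> 0 < gamma < PI / 2 -> mu < 0 ->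
  sin gamma * sin gamma = / lam -> congruent_on (box p r) psi (Upsilon_model a gamma).
Proof.
  intros an gp mn Hs.
  destruct sep as (e & A0 & B0 & U & Q & H).
  assert (Sp : 0 < sin gamma) by (apply sin_gt_0; lra).
  assert (Cp : 0 < cos gamma) by (apply cos_gt_0; lra).
  assert (HC := sc1 gamma).
  set (S := sin gamma) in *. set (C := cos gamma) in *.
  assert (Kp : 0 < sqrt (- 2 * a)) by (apply sqrt_lt_R0; lra).
  assert (KK : sqrt (- 2 * a) * sqrt (- 2 * a) = - 2 * a) by (apply sqrt_sqrt; lra).
  set (K := sqrt (- 2 * a)) in *.
  assert (lamS : lam * (S * S) = 1) by (rewrite Hs; field; lra).
  assert (lamC : lam * (C * C) = - mu).
  { replace (C * C) with (1 - S * S) by lra. lra. }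
  destruct (sign_exists A0) as (s & ss & sA).
  pose (t0 := arcsinh (s * B0 * K * C / S)).
  pose (t := fun y => t0 + - (lam * C) * (y - snd p)).
  assert (tp : t (snd p) = t0) by (unfold t; ring).
  assert (A0E : S * cosh t0 / K = Rabs A0).
  { apply abs_of_square.
    - apply Rlt_le, Rdiv_lt_0_compat; [apply Rmult_lt_0_compat; [exact Sp | apply cosh_pos] | exact Kp].
    - transitivity (S * S * (cosh t0 * cosh t0) / (K * K)); [field; lra|].
      rewrite cosh_sinh_sq. unfold t0. rewrite sinh_arcsinh.
      apply (Rmult_eq_reg_l lam); [|lra].
      transitivity ((lam * (S * S) + (s * s) * (K * K) * (B0 * B0) * (lam * (C * C))) / (K * K));
        [field; lra|].
      rewrite lamS, lamC, ss, KK.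
      replace (lam * (A0 * A0)) with (- (1 / (2 * a)) - mu * (B0 * B0)) by lra. field. lra. }
  exists (lam * C), 0, 0, (- (lam * C)), 0, (t0 + lam * C * snd p),
    (fun z : C2 => frame e ((fun z : C2 => ((0, s)%R * fst z, RtoC s * snd z)%C) z)).
  split; [|split].
  - assert (0 < lam * C) by (apply Rmult_lt_0_compat; lra). nra.
  - apply isometry_comp with (F := frame e); [now apply frame_isometry|].
    apply isometry_phases; simpl; lra.
  - intros q Bq.
    rewrite (H (fun y => s * S / K * cosh (t y)) (fun y => s * (S / C) / K * sinh (t y))); auto.
    + f_equal. unfold Upsilon_model, affine; simpl. fold S C K.
      replace (0 * fst q + - (lam * C) * snd q + (t0 + lam * C * snd p)) with (t (snd q)) by (unfold t; ring).
      replace ((lam * C * fst q + 0 * snd q + 0) / C) with (lam * fst q) by (field; lra).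
      replace (- (C * (lam * C * fst q + 0 * snd q + 0))) with (mu * fst q).
      2: { replace mu with (- (lam * (C * C))) by lra. ring. }
      unfold tan. fold S C. apply C2_eq; simpl; field; repeat split; lra.
    + rewrite tp. transitivity (s * (S * cosh t0 / K)); [field; lra | now rewrite A0E].
    + rewrite tp. unfold t0. rewrite sinh_arcsinh.
      transitivity (s * s * B0); [field; repeat split; lra | rewrite ss; ring].
    + intros y. apply (is_derive_scaled_affine cosh sinh); [apply derivable_pt_lim_cosh|].
      fold (t y). replace mu with (- (lam * (C * C))) by lra. field. lra.
    + intros y. apply (is_derive_scaled_affine sinh cosh); [apply derivable_pt_lim_sinh|].
      fold (t y). field. lra.
Qed.

(** With both exponents positive, [(A, B)] moves on an ellipse, so the profiles are trigonometric;
    the condition means [lam * cosh^2 nu = 1] and [lam * sinh^2 nu = mu]. *)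
Lemma congruent_Psi nu : a < 0 -> 0 < lam -> 0 < mu -> 0 < sinh nu ->
  sinh nu * sinh nu = mu / lam -> congruent_on (box p r) psi (Psi_model a nu).
Proof.
  intros an lp mp Sp Hs.
  destruct sep as (e & A0 & B0 & U & Q & H).
  assert (Cp := cosh_pos nu). assert (HC := cosh_sinh_sq nu).
  set (S := sinh nu) in *. set (C := cosh nu) in *.
  assert (Kp : 0 < sqrt (- 2 * a)) by (apply sqrt_lt_R0; lra).
  assert (KK : sqrt (- 2 * a) * sqrt (- 2 * a) = - 2 * a) by (apply sqrt_sqrt; lra).
  set (K := sqrt (- 2 * a)) in *.
  assert (lamS : lam * (S * S) = mu) by (rewrite Hs; field; lra).
  assert (lamC : lam * (C * C) = 1) by (rewrite HC; lra).
  destruct (angle_exists (A0 * K / C) (B0 * K * S / C)) as (s0 & cs & sn).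
  { transitivity ((lam * (A0 * A0) + lam * (S * S) * (B0 * B0)) * (K * K) / (lam * (C * C))).
    - field. lra.
    - rewrite lamS, lamC, KK, Q. field. lra. }
  pose (t := fun y => s0 + - (lam * S) * (y - snd p)).
  assert (tp : t (snd p) = s0) by (unfold t; ring).
  (* In [Psi_model] the second parameter carries the phases, so the affine map exchanges the
     axes. *)
  exists 0, (- (lam * S)), (lam * S), 0, (s0 + lam * S * snd p), 0, (frame e).
  split; [|split].
  - assert (0 < lam * S) by (apply Rmult_lt_0_compat; lra). nra.
  - now apply frame_isometry.
  - intros q Bq.
    rewrite (H (fun y => C / K * cos (t y)) (fun y => C / S / K * sin (t y))); auto.
    + f_equal. unfold Psi_model, affine; simpl. fold S C K.
      replace (0 * fst q + - (lam * S) * snd q + (s0 + lam * S * snd p)) with (t (snd q)) by (unfold t; ring).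
      replace ((lam * S * fst q + 0 * snd q + 0) / S) with (lam * fst q) by (field; lra).
      replace (S * (lam * S * fst q + 0 * snd q + 0)) with (mu * fst q).
      2: { rewrite <- lamS. ring. }
      apply C2_eq; simpl; field; repeat split; lra.
    + rewrite tp, cs. field. lra.
    + rewrite tp, sn. field. lra.
    + intros y. apply (is_derive_scaled_affine cos (fun x => - sin x)); [apply derivable_pt_lim_cos|].
      fold (t y). rewrite <- lamS. field. lra.
    + intros y. apply (is_derive_scaled_affine sin cos); [apply derivable_pt_lim_sin|].
      fold (t y). field. lra.
Qed.

(** The system degenerates to [A' = 0], [B' = - A]: [A] is constant, of modulus equal to the radius
    by the quadratic relation, and [B] is affine. *)
Lemma congruent_cylinder : a < 0 -> mu = 0 ->
  congruent_on (box p r) psi (cylinder (1 / sqrt (- 2 * a))).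
Proof.
  intros an m0.
  destruct sep as (e & A0 & B0 & U & Q & H).
  assert (Kp : 0 < sqrt (- 2 * a)) by (apply sqrt_lt_R0; lra).
  assert (KK : sqrt (- 2 * a) * sqrt (- 2 * a) = - 2 * a) by (apply sqrt_sqrt; lra).
  set (K := sqrt (- 2 * a)) in *.
  assert (l1 : lam = 1) by lra.
  destruct (sign_exists A0) as (s & ss & sA).
  assert (A0E : 1 / K = Rabs A0).
  { apply abs_of_square.
    - apply Rlt_le, Rdiv_lt_0_compat; lra.
    - transitivity (1 / (K * K)); [field; lra|]. rewrite KK.
      replace (A0 * A0) with (- (1 / (2 * a))) by (rewrite <- Q, l1, m0; ring). field. lra. }
  exists 1, 0, 0, (- A0), 0, (B0 + A0 * snd p),
    (fun z : C2 => frame e ((fun z : C2 => (RtoC s * fst z, RtoC 1 * snd z)%C) z)).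
  split; [|split].
  - rewrite <- sA, <- A0E. intros E.
    assert (1 / K <> 0) by (apply Rgt_not_eq, Rdiv_lt_0_compat; lra). nra.
  - apply isometry_comp with (F := frame e); [now apply frame_isometry|].
    apply isometry_phases; simpl; lra.
  - intros q Bq.
    rewrite (H (fun y => A0) (fun y => B0 - A0 * (y - snd p))); auto.
    + f_equal. unfold cylinder, affine; simpl. fold K.
      rewrite l1, m0, Rmult_0_l. replace (1 * fst q + 0 * snd q + 0) with (1 * fst q) by ring.
      rewrite <- sA at 1. rewrite <- A0E.
      apply C2_eq; simpl; rewrite ?cos_0, ?sin_0; field; lra.
    + ring.
    + intros y. rewrite m0, Rmult_0_l.
      exact (is_derive_const (K := R_AbsRing) (V := R_NormedModule) A0 y).
    + intros y. auto_derive; [exact I|]. rewrite l1. ring.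
Qed.

End Models.

(** * Globalization *)

Lemma smooth_affine O m11 m12 m21 m22 c1 c2 :
  open O -> smooth_map O (affine m11 m12 m21 m22 c1 c2).
Proof.
  intros oO.
  assert (S1 : smooth O fst) by (intros n; now apply Ck_fst).
  assert (S2 : smooth O snd) by (intros n; now apply Ck_snd).
  split; apply smooth_plus; auto using smooth_const;
    apply smooth_plus; auto; apply smooth_mult; auto using smooth_const.
Qed.

Lemma diffeomorphism_affine O W h m11 m12 m21 m22 c1 c2 :
  m11 * m22 - m12 * m21 <> 0 -> diffeomorphism O W h ->
  exists W', diffeomorphism O W' (fun q => affine m11 m12 m21 m22 c1 c2 (h q)).
Proof.
  intros nz (oO & oW & Sh & hW & k & Sk & kO & kh & hk).
  set (d := m11 * m22 - m12 * m21) in *.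
  pose (inv := affine (m22 / d) (- m12 / d) (- m21 / d) (m11 / d)
         ((m12 * c2 - m22 * c1) / d) ((m21 * c1 - m11 * c2) / d)).
  assert (I1 : forall q, inv (affine m11 m12 m21 m22 c1 c2 q) = q).
  { intros [x y]. unfold inv, affine; simpl. f_equal; unfold d; field; exact nz. }
  assert (I2 : forall q, affine m11 m12 m21 m22 c1 c2 (inv q) = q).
  { intros [x y]. unfold inv, affine; simpl. f_equal; unfold d; field; exact nz. }
  assert (oT : open (fun _ : R * R => True)) by apply open_true.
  destruct (smooth_affine _ (m22 / d) (- m12 / d) (- m21 / d) (m11 / d)
         ((m12 * c2 - m22 * c1) / d) ((m21 * c1 - m11 * c2) / d) oT) as [A1 A2].
  fold inv in A1, A2.
  pose (W' := fun w => W (inv w)).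
  assert (oW' : open W').
  { enough (X : forall w : R * R, W' w -> locally w W') by exact X.
    intros w Ww. apply oW, locally_box in Ww. destruct Ww as (r & rp & H).
    assert (P := open_preimage_box (fun _ => True) inv (inv w) r oT).
    assert (L : locally w (fun q => True /\ box (inv w) r (inv q))).
    { apply P.
      - intros; now apply (smooth_continuous (fun _ => True)).
      - intros; now apply (smooth_continuous (fun _ => True)).
      - split; [exact I | now apply box_center]. }
    revert L. apply filter_imp. intros q [_ Bq]. now apply H. }
  assert (CM : forall (O1 O2 : R * R -> Prop) g h, open O1 -> open O2 ->
    (forall q, O1 q -> O2 (h q)) -> smooth_map O1 h -> smooth_map O2 g ->
    smooth_map O1 (fun q => g (h q))).
  { intros O1 O2 g h' o1 o2 m S [G1 G2]. split.
    - now apply (smooth_comp O1 O2 (fun q => fst (g q))).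
    - now apply (smooth_comp O1 O2 (fun q => snd (g q))). }
  exists W'. split; [exact oO|]. split; [exact oW'|]. split; [|split].
  - apply (CM O W); auto. now apply smooth_affine.
  - intros q Oq. unfold W'. rewrite I1. auto.
  - exists (fun w => k (inv w)). split; [|split; [|split]].
    + apply (CM W' W); auto. split; now apply (smooth_sub (fun _ => True)).
    + intros w Ww. now apply kO.
    + intros q Oq. rewrite I1. auto.
    + intros w Ww. rewrite hk by exact Ww. apply I2.
Qed.

(** The hypotheses are the real and imaginary parts of [(w, F1) = (w, F2) = 0]; a nonzero
    determinant makes [F1, F2] a complex basis, and Cramer's rule gives [w = 0]. *)
Lemma frame_annihilator (w F1 F2 : C2) :
  inner w F1 = 0 -> inner w (J F1) = 0 -> inner w F2 = 0 -> inner w (J F2) = 0 ->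
  Re (dz1_dz2 F1 F2) * Re (dz1_dz2 F1 F2) + Im (dz1_dz2 F1 F2) * Im (dz1_dz2 F1 F2) <> 0 ->
  w = vzero.
Proof.
  intros A B C D.
  set (dr := Re (dz1_dz2 F1 F2)). set (di := Im (dz1_dz2 F1 F2)). intros nz.
  assert (K : forall x y, dr * x + di * y = 0 -> dr * y - di * x = 0 -> x = 0 /\ y = 0).
  { intros x y E1 E2. split; apply (Rmult_eq_reg_l (dr * dr + di * di)); auto.
    - transitivity (dr * (dr * x + di * y) - di * (dr * y - di * x)); [ring|].
      rewrite E1, E2; ring.
    - transitivity (di * (dr * x + di * y) + dr * (dr * y - di * x)); [ring|].
      rewrite E1, E2; ring. }
  assert (K1 : Re (fst w) = 0 /\ Im (fst w) = 0).
  { apply K.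
    - transitivity (inner w F1 * Re (snd F2) + inner w (J F1) * Im (snd F2)
        - inner w F2 * Re (snd F1) - inner w (J F2) * Im (snd F1)).
      + unfold dr, di. clear. c2; ring.
      + rewrite A, B, C, D; ring.
    - transitivity (inner w (J F1) * Re (snd F2) - inner w F1 * Im (snd F2)
        - inner w (J F2) * Re (snd F1) + inner w F2 * Im (snd F1)).
      + unfold dr, di. clear. c2; ring.
      + rewrite A, B, C, D; ring. }
  assert (K2 : Re (snd w) = 0 /\ Im (snd w) = 0).
  { apply K.
    - transitivity (- (inner w F1 * Re (fst F2) + inner w (J F1) * Im (fst F2)
        - inner w F2 * Re (fst F1) - inner w (J F2) * Im (fst F1))).
      + unfold dr, di. clear. c2; ring.
      + rewrite A, B, C, D; ring.
    - transitivity (- (inner w (J F1) * Re (fst F2) - inner w F1 * Im (fst F2)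
        - inner w (J F2) * Re (fst F1) + inner w F2 * Im (fst F1))).
      + unfold dr, di. clear. c2; ring.
      + rewrite A, B, C, D; ring. }
  destruct K1, K2. now apply C2_eq.
Qed.

(** [normal_sq] is a positive definite form in the Liouville components. When they vanish,
    [phi^perp] is orthogonal to the tangent plane and to its image under [J], which together span
    [C^2]. *)
Lemma normal_sq_zero (O : R * R -> Prop) f p :
  (forall q, O q -> inner (V1 f q) (J (V2 f q)) = 0) -> (forall q, O q -> 0 < gdet f q) ->
  O p -> normal_sq f p = 0 -> normal_part f p (f p) = vzero.
Proof.
  intros LG GP Op Z. assert (G := GP p Op).
  assert (g1 : 0 <= g11 f p) by apply inner_pos.
  assert (g2 : 0 <= g22 f p) by apply inner_pos.
  assert (L : liouville true f p = 0 /\ liouville false f p = 0).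
  { unfold normal_sq in Z.
    set (x := liouville true f p) in *. set (y := liouville false f p) in *.
    assert (N : g22 f p * (x * x) - 2 * g12 f p * (x * y) + g11 f p * (y * y) = 0).
    { apply (Rmult_eq_reg_r (/ gdet f p)); [|apply Rinv_neq_0_compat; lra].
      rewrite Rmult_0_l. exact Z. }
    unfold gdet in G.
    assert (g1p : 0 < g11 f p) by nra. assert (g2p : 0 < g22 f p) by nra.
    split.
    (* Completing the square in the quadratic form multiplied by [g11]. *)
    - assert (E : gdet f p * (x * x) + (g11 f p * y - g12 f p * x) * (g11 f p * y - g12 f p * x) = 0).
      { transitivity (g11 f p * (g22 f p * (x * x) - 2 * g12 f p * (x * y) + g11 f p * (y * y)));
          [unfold gdet; ring | rewrite N; ring]. }
      assert (0 <= (g11 f p * y - g12 f p * x) * (g11 f p * y - g12 f p * x)) by apply Rle_0_sqr.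
      assert (S := Rle_0_sqr x). unfold Rsqr in S. fold (gdet f p) in G.
      assert (x * x = 0) by nra. now apply Rsqr_0_uniq.
    - assert (E : gdet f p * (y * y) + (g22 f p * x - g12 f p * y) * (g22 f p * x - g12 f p * y) = 0).
      { transitivity (g22 f p * (g22 f p * (x * x) - 2 * g12 f p * (x * y) + g11 f p * (y * y)));
          [unfold gdet; ring | rewrite N; ring]. }
      assert (0 <= (g22 f p * x - g12 f p * y) * (g22 f p * x - g12 f p * y)) by apply Rle_0_sqr.
      assert (S := Rle_0_sqr y). unfold Rsqr in S. fold (gdet f p) in G.
      assert (y * y = 0) by nra. now apply Rsqr_0_uniq. }
  apply (frame_annihilator _ (V1 f p) (V2 f p)).
  - unfold normal_part, tangent_part. rewrite inner_vsub_l, inner_vadd_l, !inner_vscal_l.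
    rewrite (inner_sym (V2 f p)). fold (g11 f p) (g12 f p). unfold gi11, gi12, gi22.
    unfold gdet in *. field. lra.
  - etransitivity; [exact (inner_normal_J O f LG p (f p) true Op) | apply L].
  - unfold normal_part, tangent_part. rewrite inner_vsub_l, inner_vadd_l, !inner_vscal_l.
    fold (g12 f p) (g22 f p). unfold gi11, gi12, gi22.
    unfold gdet in *. field. lra.
  - etransitivity; [exact (inner_normal_J O f LG p (f p) false Op) | apply L].
  - rewrite det_norm, LG by exact Op. unfold gdet, g11, g12, g22 in G. lra.
Qed.

(* [1 / (4 a^2 normal_sq)] is the conformal factor [E], so this vanishes iff
   [k |phi|^2 = - (E + 1 / (2 a))], i.e. iff [k] is the constant [kappa]. *)
Definition kappa_equation (a k : R) (f : R * R -> C2) (p : R * R) : R :=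
  4 * a * a * normal_sq f p * inner (f p) (f p) * k + 2 * a * normal_sq f p + 1.

Lemma kappa_equation_nz a k f p : kappa_equation a k f p = 0 -> normal_sq f p <> 0.
Proof. unfold kappa_equation. intros E Z. rewrite Z in E. lra. Qed.

Lemma kappa_equation_unique a k k' f p : a <> 0 -> 0 < inner (f p) (f p) ->
  kappa_equation a k f p = 0 -> kappa_equation a k' f p = 0 -> k = k'.
Proof.
  intros anz P E E'. assert (N := kappa_equation_nz _ _ _ _ E). unfold kappa_equation in *.
  apply (Rmult_eq_reg_l (4 * a * a * normal_sq f p * inner (f p) (f p))); [lra|].
  apply Rmult_integral_contrapositive_currified; [|lra].
  apply Rmult_integral_contrapositive_currified; [|exact N].
  apply Rmult_integral_contrapositive_currified; [lra | exact anz].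
Qed.

Definition local_normal_form (a k : R) (O : R * R -> Prop) (f : R * R -> C2) (p : R * R) : Prop :=
  exists (O' : R * R -> Prop) r (h : R * R -> R * R) (psi : R * R -> C2),
    0 < r /\ (forall q, O' q -> O q) /\ O' p /\ diffeomorphism O' (box (h p) r) h /\
    normal_form a (box (h p) r) psi /\ (forall q, O' q -> f q = psi (h q)) /\
    kappa a psi (h p) = k /\ forall q, O' q -> kappa_equation a k f q = 0.

Lemma local_normal_form_exists a O f b p : a <> 0 -> local_data a O f b -> O p ->
  normal_sq f p <> 0 -> exists k, local_normal_form a k O f p.
Proof.
  intros anz LD Op nz.
  destruct (normal_coordinates a O f b p anz LD Op nz) as
    (O' & r & h & psi & rp & sub & O'p & DF & NF & H).
  exists (kappa a psi (h p)). exists O', r, h, psi.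
  split; [exact rp|]. split; [exact sub|]. split; [exact O'p|]. split; [exact DF|].
  split; [exact NF|]. split; [intros q Oq; now apply H|]. split; [reflexivity|].
  intros q Oq. destruct (H q Oq) as [E1 E2].
  assert (oW : open (box (h p) r)) by apply open_box.
  assert (Wq : box (h p) r (h q)) by (now apply DF).
  assert (KC : kappa a psi (h q) = kappa a psi (h p)).
  { apply (box_constant (h p) r (kappa a psi)); auto.
    intros d z Wz. now apply (nf_kappa_pd a (box (h p) r)). }
  unfold kappa_equation. rewrite <- KC, E1.
  assert (K := nf_kappa a (box (h p) r) psi anz NF (h q) Wq).
  set (E := inner (V1 psi (h q)) (V1 psi (h q))) in *.
  set (n := normal_sq f q) in *. set (F := inner (psi (h q)) (psi (h q))) in *.
  transitivity (- (4 * a * a * n * (- kappa a psi (h q) * F)) + 2 * a * n + 1); [ring|].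
  rewrite <- K.
  transitivity (- (E * (4 * a * a * n)) + 1); [field; exact anz | rewrite E2; ring].
Qed.

Lemma local_normal_form_pos a k O f p : a <> 0 -> local_normal_form a k O f p ->
  0 < inner (f p) (f p).
Proof.
  intros anz (O' & r & h & psi & rp & _ & O'p & _ & NF & E & _). rewrite (E p O'p).
  apply (nf_psi_pos a (box (h p) r)); auto. now apply box_center.
Qed.

(** At a point the equation is affine in [k] with nonzero slope, so every normal form there has this
    very [k]. *)
Lemma local_normal_form_at a k O f b p : a <> 0 -> local_data a O f b -> O p ->
  kappa_equation a k f p = 0 -> local_normal_form a k O f p.
Proof.
  intros anz LD Op E.
  destruct (local_normal_form_exists a O f b p anz LD Op (kappa_equation_nz _ _ _ _ E)) as [k' H].
  assert (P := local_normal_form_pos _ _ _ _ _ anz H).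
  assert (E' : kappa_equation a k' f p = 0).
  { destruct H as (O' & r & h & psi & rp & _ & O'p & _ & _ & _ & _ & K). now apply K. }
  now rewrite (kappa_equation_unique a k k' f p anz P E E').
Qed.

Lemma kappa_equation_open a k O f b p : a <> 0 -> local_data a O f b -> O p ->
  kappa_equation a k f p = 0 -> locally p (fun q => kappa_equation a k f q = 0).
Proof.
  intros anz LD Op E.
  destruct (local_normal_form_at a k O f b p anz LD Op E) as
    (O' & r & h & psi & rp & _ & O'p & (oO' & _) & _ & _ & _ & K).
  apply (filter_imp O'); [exact K | now apply oO'].
Qed.

Lemma kappa_equation_continuous a k O f b p : local_data a O f b -> O p ->
  continuous (kappa_equation a k f) p.
Proof.
  intros [oO SF LG GP _ _ _] Op. apply (smooth_continuous O); [|exact Op].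
  assert (SN := smooth_normal_sq O f oO SF GP).
  apply smooth_plus; auto using smooth_const. apply smooth_plus; auto.
  - apply smooth_mult; auto using smooth_const. apply smooth_mult; auto using smooth_inner.
    apply smooth_mult; auto using smooth_const.
  - apply smooth_mult; auto using smooth_const.
Qed.

(* [kappa] is locally constant where [H <> 0], and [kappa_equation] cannot hold in the
   limit at a point with [H = 0]; hence zeros of [H] do not accumulate nonzeros. *)
Lemma normal_sq_nonvanishing a f b p q r : a <> 0 -> 0 < r ->
  local_data a (box p r) f b -> box p r q -> normal_sq f q <> 0 -> normal_sq f p <> 0.
Proof.
  intros anz rp LD Bq nz.
  destruct (local_normal_form_exists a _ f b q anz LD Bq nz) as (k & H).
  assert (Eq : kappa_equation a k f q = 0).
  { destruct H as (O' & r' & h & psi & _ & _ & O'p & _ & _ & _ & _ & K). now apply K. }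
  apply (kappa_equation_nz a k).
  pose (g := fun t => (fst q + t * (fst p - fst q), snd q + t * (snd p - snd q))).
  assert (gB : forall t, 0 <= t <= 1 -> box p r (g t)).
  { intros t Ht. destruct Bq as [B1 B2]. unfold g; split; simpl.
    - replace (fst q + t * (fst p - fst q) - fst p) with ((1 - t) * (fst q - fst p)) by ring.
      rewrite Rabs_mult, (Rabs_pos_eq (1 - t)) by lra. generalize (Rabs_pos (fst q - fst p)). nra.
    - replace (snd q + t * (snd p - snd q) - snd p) with ((1 - t) * (snd q - snd p)) by ring.
      rewrite Rabs_mult, (Rabs_pos_eq (1 - t)) by lra. generalize (Rabs_pos (snd q - snd p)). nra. }
  assert (gC : forall t, continuous g t).
  { intros t. apply (continuous_comp_2 (fun t => fst q + t * (fst p - fst q))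
      (fun t => snd q + t * (snd p - snd q)) (fun x y => (x, y))).
    - apply (ex_derive_continuous (K := R_AbsRing) (V := R_NormedModule)
        (fun t => fst q + t * (fst p - fst q))). now auto_derive.
    - apply (ex_derive_continuous (K := R_AbsRing) (V := R_NormedModule)
        (fun t => snd q + t * (snd p - snd q))). now auto_derive.
    - apply (continuous_ext (fun x => x)); [now intros []|]. apply continuous_id. }
  assert (g1 : g 1 = p).
  { apply injective_projections; simpl; ring. }
  assert (g0 : g 0 = q).
  { apply injective_projections; simpl; ring. }
  (* Along the segment from [q] to [p] the equation for the fixed [k] persists, and at [p] it
     excludes [normal_sq f p = 0]. *)
  rewrite <- g1. apply (open_closed_interval (fun t => kappa_equation a k f (g t))).
  - intros t Ht. apply (continuous_comp g (kappa_equation a k f)); [apply gC|].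
    apply (kappa_equation_continuous a k (box p r) f b); auto.
  - now rewrite g0.
  - intros t Ht E. apply (gC t (fun z => kappa_equation a k f z = 0)).
    apply (kappa_equation_open a k (box p r) f b); auto.
Qed.

Lemma immersion_gdet f p :
  (forall X, Defs.differential f p X = vzero -> X = (0, 0)) -> 0 < gdet f p.
Proof.
  intros H.
  assert (D : forall x y, (x <> 0 \/ y <> 0) ->
    0 < inner (Defs.differential f p (x, y)) (Defs.differential f p (x, y))).
  { intros x y ne. destruct (Rle_lt_or_eq_dec _ _ (inner_pos (Defs.differential f p (x, y)))) as [l|e];
      [exact l|exfalso].
    assert (Z : (x, y) = (0, 0)) by (apply H, inner_zero; auto).
    injection Z; intros; tauto. }
  assert (E : forall x y, inner (Defs.differential f p (x, y)) (Defs.differential f p (x, y)) =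
    x * x * g11 f p + 2 * (x * y) * g12 f p + y * y * g22 f p).
  { intros x y. unfold Defs.differential; simpl.
    rewrite !inner_vadd_l, !inner_vadd_r, !inner_vscal_l, !inner_vscal_r,
      (inner_sym (V2 f p) (V1 f p)). unfold g11, g12, g22. ring. }
  assert (G : 0 < g11 f p).
  { assert (X := D 1 0 (or_introl R1_neq_R0)). rewrite E in X. lra. }
  (* The tangent vector with these components has squared length [g11 * gdet]. *)
  assert (X := D (- g12 f p) (g11 f p) (or_intror (Rgt_not_eq _ _ G))). rewrite E in X.
  unfold gdet. nra.
Qed.

(** The quotient is the squared norm of a covector: numerator and denominator both scale by the
    square of the determinant of the change of frame. *)
Lemma normal_sq_change_of_frame (f F1 F2 G1 G2 : C2) m11 m12 m21 m22 :
  F1 = vadd (vscal m11 G1) (vscal m12 G2) -> F2 = vadd (vscal m21 G1) (vscal m22 G2) ->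
  let n (A B : C2) :=
    (inner B B * (inner f (J A) * inner f (J A))
     - 2 * inner A B * (inner f (J A) * inner f (J B))
     + inner A A * (inner f (J B) * inner f (J B))) /
    (inner A A * inner B B - inner A B * inner A B) in
  inner F1 F1 * inner F2 F2 - inner F1 F2 * inner F1 F2 <> 0 -> n F1 F2 = n G1 G2.
Proof.
  intros -> -> n nz. unfold n. clear n.
  rewrite !J_vadd, !J_vscal, !inner_vadd_l, !inner_vadd_r, !inner_vscal_l, !inner_vscal_r,
    (inner_sym G2 G1) in *.
  set (x := inner f (J G1)). set (y := inner f (J G2)).
  set (g11 := inner G1 G1) in *. set (g12 := inner G1 G2) in *. set (g22 := inner G2 G2) in *.
  set (d := m11 * m22 - m12 * m21). set (g := g11 * g22 - g12 * g12).
  match type of nz with ?l <> 0 => assert (E : l = d * d * g) by (unfold d, g; ring) end.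
  rewrite E in nz |- *.
  assert (dz : d <> 0) by (intros Z; apply nz; rewrite Z; ring).
  assert (gz : g <> 0) by (intros Z; apply nz; rewrite Z; ring).
  match goal with |- ?l / _ = ?r / _ =>
    assert (N : l = d * d * r) by (unfold d; ring) end.
  rewrite N. field. auto.
Qed.

Section Surface.
Variables (M : surface) (phi : M -> C2) (a : R).
Hypothesis phi_immersion : immersion M phi.
Hypothesis phi_lagrangian : lagrangian M phi.
Hypothesis phi_stationary : hamiltonian_stationary M phi.
Hypothesis a_nz : a <> 0.
Hypothesis phi_self_similar : self_similar M phi a.
Hypothesis phi_nontrivial : nowhere_minimal M phi.

Lemma chart_local_data i p : dom i p ->
  exists O b, O p /\ (forall q, O q -> dom i q) /\ local_data a O (in_chart M phi i) b.
Proof.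
  intros Dp. destruct (phi_stationary i p Dp) as (O & b & oO & Op & sub & AN & HA).
  exists O, b. split; [exact Op|]. split; [exact sub|].
  assert (LG : forall q, dom i q ->
    inner (V1 (in_chart M phi i) q) (J (V2 (in_chart M phi i) q)) = 0).
  { intros q Dq. assert (H := phi_lagrangian i q Dq (1, 0) (0, 1)).
    rewrite kahler_inner in H. rewrite <- (Ropp_involutive (inner _ _)).
    rewrite <- Ropp_0. f_equal. rewrite <- H. do 2 f_equal.
    - unfold Defs.differential; simpl. now rewrite vzero_r, vscal_1.
    - unfold Defs.differential; simpl. now rewrite vzero_l, vscal_1. }
  split; try assumption.
  - apply (smooth_C2_sub (dom i)); [exact sub | apply phi_immersion].
  - intros q Oq. apply LG; auto.
  - intros q Oq. apply immersion_gdet, phi_immersion. auto.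
  - intros q Oq. apply (phi_self_similar i q). auto.
Qed.

(** Every small square around [p] contains a point with [H <> 0], and constancy of [kappa] along a
    segment carries this to the centre. *)
Lemma chart_normal_sq_nz i p : dom i p -> normal_sq (in_chart M phi i) p <> 0.
Proof.
  intros Dp. destruct (chart_local_data i p Dp) as (O & b & Op & sub & LD).
  destruct (proj1 (locally_box p O) (ld_open _ _ _ _ LD p Op)) as (r & rp & H).
  apply (local_data_sub a O (box p r)) in LD; [|apply open_box | exact H].
  destruct (phi_nontrivial i (box p r)) as (q & Bq & nz).
  - apply open_box.
  - auto.
  - exists p. now apply box_center.
  - apply (normal_sq_nonvanishing a _ b p q r); auto.
    intros Z. apply nz.
    rewrite (ld_self_similar _ _ _ _ LD q Bq).
    rewrite (normal_sq_zero (box p r)); auto.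
    + apply C2_eq; simpl; ring.
    + apply (ld_lagrangian _ _ _ _ LD).
    + apply (ld_gdet _ _ _ _ LD).
Qed.

(** The equation involves only [|phi|^2] and [|phi^perp|^2], which do not see the chart; thus
    [kappa] becomes a quantity on [M]. *)
Lemma chart_change k i j p q : dom i p -> dom j q -> par i p = par j q ->
  kappa_equation a k (in_chart M phi i) p = kappa_equation a k (in_chart M phi j) q.
Proof.
  intros Dp Dq E.
  destruct (transition M i j) as [oO (h & Sh & H)]. cbv zeta in *.
  set (O := fun p => _ /\ _) in *.
  assert (Op : O p) by (split; [exact Dp | exists q; auto]).
  assert (hp : h p = q).
  { destruct (H p Op) as [Dh Eh]. apply (par_inj M j); auto. now rewrite Eh. }
  assert (FE : forall z, O z -> in_chart M phi i z = in_chart M phi j (h z)).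
  { intros z Oz. unfold in_chart. f_equal. symmetry. now apply H. }
  assert (CH : forall d, VV d (in_chart M phi i) p =
    vadd (vscal (DD d (fun q => fst (h q)) p) (V1 (in_chart M phi j) q))
         (vscal (DD d (fun q => snd (h q)) p) (V2 (in_chart M phi j) q))).
  { intros d. rewrite (VV_ext_open d O _ (fun z => in_chart M phi j (h z)) p oO Op FE), <- hp.
    apply (VV_chain d O (dom j)); auto.
    - apply dom_open.
    - apply phi_immersion.
    - now apply H. }
  assert (V0 : in_chart M phi i p = in_chart M phi j q) by (unfold in_chart; now rewrite E).
  assert (N : normal_sq (in_chart M phi i) p = normal_sq (in_chart M phi j) q).
  { assert (X := normal_sq_change_of_frame (in_chart M phi i p) (V1 (in_chart M phi i) p)
      (V2 (in_chart M phi i) p) _ _ _ _ _ _ (CH true) (CH false)).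
    cbv zeta in X. unfold normal_sq, liouville, gdet, g11, g12, g22.
    rewrite <- V0. apply X.
    apply Rgt_not_eq. apply (immersion_gdet (in_chart M phi i) p), phi_immersion, Dp. }
  unfold kappa_equation. now rewrite N, V0.
Qed.

Lemma chart_kappa_exists i p : dom i p -> exists k, kappa_equation a k (in_chart M phi i) p = 0.
Proof.
  intros Dp. destruct (chart_local_data i p Dp) as (O & b & Op & sub & LD).
  destruct (local_normal_form_exists a O _ b p a_nz LD Op (chart_normal_sq_nz i p Dp))
    as (k & O' & r & h & psi & _ & _ & O'p & _ & _ & _ & _ & K).
  exists k. now apply K.
Qed.

Lemma kappa_constant (A : M -> Prop) i0 p0 k : connected_subset M A ->
  dom i0 p0 -> A (par i0 p0) -> kappa_equation a k (in_chart M phi i0) p0 = 0 ->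
  forall i p, dom i p -> A (par i p) -> kappa_equation a k (in_chart M phi i) p = 0.
Proof.
  intros CA D0 A0 E0 i p Dp Ap. apply NNPP; intros nz.
  (* For the fixed [k], the zero set is open because [kappa] is locally constant, and its complement
     [V] is open by continuity; connectedness of [A] excludes that it meets both. *)
  pose (U := fun m => exists i p, dom i p /\ par i p = m /\
               kappa_equation a k (in_chart M phi i) p = 0).
  pose (V := fun m => exists i p, dom i p /\ par i p = m /\
               kappa_equation a k (in_chart M phi i) p <> 0).
  assert (LOC : forall (i : chart M) (P : R * R -> Prop), (forall p, dom i p -> P p -> locally p P) ->
    open (fun p : R * R => dom i p /\ P p)).
  { intros j P HP.
    enough (X : forall p : R * R, dom j p /\ P p -> locally p (fun p => dom j p /\ P p)) by exact X.
    intros z [Dz Pz]. apply filter_and; [now apply (dom_open M j) | auto]. }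
  assert (EXT : forall (i : chart M) (P Q : R * R -> Prop), (forall p, dom i p -> (P p <-> Q p)) ->
    open (fun p : R * R => dom i p /\ P p) -> open (fun p : R * R => dom i p /\ Q p)).
  { intros j P Q E oP. apply (open_ext (fun p : R * R => dom j p /\ P p)); [|exact oP].
    intros z; generalize (E z); tauto. }
  assert (oU : surface_open M U).
  { intros j. apply (EXT j (fun p => kappa_equation a k (in_chart M phi j) p = 0)).
    - intros z Dz. split.
      + intros Z. now exists j, z.
      + intros (j' & z' & Dz' & Ez & Z). rewrite <- Z. now apply chart_change.
    - apply LOC. intros z Dz Z. destruct (chart_local_data j z Dz) as (O & b & Oz & sub & LD).
      now apply (kappa_equation_open a k O _ b). }
  assert (oV : surface_open M V).
  { intros j. apply (EXT j (fun p => kappa_equation a k (in_chart M phi j) p <> 0)).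
    - intros z Dz. split.
      + intros Z. now exists j, z.
      + intros (j' & z' & Dz' & Ez & Z). now rewrite <- (chart_change k j' j z' z).
    - apply LOC. intros z Dz Z. destruct (chart_local_data j z Dz) as (O & b & Oz & sub & LD).
      apply locally_nz; [|exact Z]. now apply (kappa_equation_continuous a k O _ b). }
  destruct (CA U V oU oV) as (m & Am & (i1 & p1 & D1 & E1 & Z1) & (i2 & p2 & D2 & E2 & Z2)).
  - intros m Am. destruct (par_cover M m) as (j & z & Dz & Ez).
    destruct (Req_dec (kappa_equation a k (in_chart M phi j) z) 0).
    + left. now exists j, z.
    + right. now exists j, z.
  - exists (par i0 p0). split; [exact A0|]. now exists i0, p0.
  - exists (par i p). split; [exact Ap|]. now exists i, p.
  - apply Z2. rewrite <- Z1. symmetry. apply chart_change; congruence.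
Qed.

Lemma locally_congruent_model (A : M -> Prop) k model :
  (forall i p, dom i p -> A (par i p) -> kappa_equation a k (in_chart M phi i) p = 0) ->
  (forall p r psi, 0 < r -> normal_form a (box p r) psi -> kappa a psi p = k ->
     congruent_on (box p r) psi model) ->
  locally_congruent_on M A phi model.
Proof.
  intros HK HM m Am. destruct (par_cover M m) as (i & p & Dp & <-).
  destruct (chart_local_data i p Dp) as (O & b & Op & sub & LD).
  destruct (local_normal_form_at a k O _ b p a_nz LD Op (HK i p Dp Am)) as
    (O' & r & h & psi & rp & sub' & O'p & DF & NF & E & K & _).
  destruct (HM (h p) r psi rp NF K) as (m11 & m12 & m21 & m22 & c1 & c2 & F & dz & IF & EF).
  destruct (diffeomorphism_affine O' _ h m11 m12 m21 m22 c1 c2 dz DF) as [W' DF'].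
  exists i, O', W', (fun q => affine m11 m12 m21 m22 c1 c2 (h q)), F.
  split; [auto|]. split; [now exists p|]. split; [exact DF'|]. split; [exact IF|].
  intros q Oq. change (phi (par i q)) with (in_chart M phi i q). rewrite (E q Oq).
  apply EF. now apply DF.
Qed.

(** From [|psi_x|^2 + 1 / (2 a) = - kappa |psi|^2]: for [a > 0] the left side is positive. *)
Lemma kappa_bounds i p k : dom i p -> kappa_equation a k (in_chart M phi i) p = 0 ->
  k <= 1 / 4 /\ (0 < a -> k < 0).
Proof.
  intros Dp E. destruct (chart_local_data i p Dp) as (O & b & Op & sub & LD).
  destruct (local_normal_form_at a k O _ b p a_nz LD Op E) as
    (O' & r & h & psi & rp & _ & O'p & _ & NF & _ & K & _).
  assert (Wp := box_center (h p) r rp). rewrite <- K. split.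
  - apply (nf_kappa_le a (box (h p) r)); auto.
  - intros ap.
    assert (X := nf_kappa a (box (h p) r) psi a_nz NF (h p) Wp).
    assert (P := nf_psi_pos a (box (h p) r) psi a_nz NF (h p) Wp).
    assert (Q := inner_pos (V1 psi (h p))).
    assert (0 < 1 / (2 * a)) by (apply Rdiv_lt_0_compat; lra). nra.
Qed.

End Surface.

(** Roots of [z^2 - z + k], real by the bound. The ordering forces [lam > 0], so that the sign of
    [mu] alone distinguishes the self-shrinkers. *)
Lemma roots_exist k : k <= 1 / 4 -> exists lam mu, lam + mu = 1 /\ lam * mu = k /\ mu <= lam.
Proof.
  intros H. exists ((1 + sqrt (1 - 4 * k)) / 2), ((1 - sqrt (1 - 4 * k)) / 2).
  assert (S := sqrt_sqrt (1 - 4 * k) ltac:(lra)). assert (P := sqrt_pos (1 - 4 * k)).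
  split; [field|]. split; [nra | lra].
Qed.

Lemma arcsinh_pos x : 0 < x -> 0 < arcsinh x.
Proof. intros H. rewrite <- arcsinh_0. now apply arcsinh_lt. Qed.

Theorem theorem1 (M : surface) (phi : M -> C2) (a : R)
    (phi_immersion : immersion M phi)
    (phi_lagrangian : lagrangian M phi)
    (phi_stationary : hamiltonian_stationary M phi)
    (a_neq0 : a <> 0)
    (phi_self_similar : self_similar M phi a)
    (phi_nontrivial : nowhere_minimal M phi) :
  (0 < a ->
    forall A : M -> Prop, connected_subset M A ->
      exists delta : R, 0 < delta /\
        locally_congruent_on M A phi (Phi_model a delta)) /\
  (a < 0 ->
    forall A : M -> Prop, connected_subset M A ->
      locally_congruent_on M A phi (cylinder (1 / sqrt (- 2 * a))) \/
      locally_congruent_on M A phi (torus (1 / sqrt (- 2 * a))) \/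
      (exists gamma : R, 0 < gamma < PI / 2 /\
        locally_congruent_on M A phi (Upsilon_model a gamma)) \/
      (exists nu : R, 0 < nu /\
        locally_congruent_on M A phi (Psi_model a nu))).
Proof.
  (* One pair of exponents serves all of [A], since [kappa] is constant there; this is why the model
     and its parameter do not vary from point to point. *)
  assert (KEY : forall A : M -> Prop, connected_subset M A -> (exists m, A m) ->
    exists lam mu, lam + mu = 1 /\ mu <= lam /\ (0 < a -> lam * mu < 0) /\
    forall model, (forall p r psi, 0 < r -> normal_form a (box p r) psi ->
       lam * mu = kappa a psi p -> congruent_on (box p r) psi model) ->
       locally_congruent_on M A phi model).
  { intros A CA (m & Am). destruct (par_cover M m) as (i & p & Dp & <-).
    destruct (chart_kappa_exists M phi a phi_immersion phi_lagrangian phi_stationary a_neq0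
      phi_self_similar phi_nontrivial i p Dp) as (k & E).
    destruct (kappa_bounds M phi a phi_immersion phi_lagrangian phi_stationary a_neq0
      phi_self_similar i p k Dp E) as [K1 K2].
    destruct (roots_exist k K1) as (lam & mu & S & P & L).
    exists lam, mu. rewrite P. split; [exact S|]. split; [exact L|]. split; [exact K2|].
    intros model HM.
    apply (locally_congruent_model M phi a phi_immersion phi_lagrangian phi_stationary a_neq0
      phi_self_similar A k).
    - apply (kappa_constant M phi a phi_immersion phi_lagrangian phi_stationary a_neq0
        phi_self_similar A i p k); auto.
    - intros; apply HM; auto. }
  (* [connected_subset] admits the empty set, which provides no point at which to read off
     [kappa]. *)
  assert (EMPTY : forall A : M -> Prop, ~ (exists m, A m) ->
    forall model, locally_congruent_on M A phi model).
  { intros A ne model m Am. exfalso. apply ne. now exists m. }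
  split.
  - intros ap A CA. destruct (classic (exists m, A m)) as [ne|em].
    + destruct (KEY A CA ne) as (lam & mu & S & L & N & H). specialize (N ap).
      assert (mn : mu < 0) by nra.
      assert (ip : 0 < - / mu) by (generalize (Rinv_lt_0_compat _ mn); lra).
      assert (sp := sqrt_lt_R0 _ ip).
      exists (arcsinh (sqrt (- / mu))). split; [now apply arcsinh_pos|].
      apply H. intros p r psi rp NF K.
      apply (congruent_Phi a p r psi lam mu); auto.
      * now apply arcsinh_pos.
      * rewrite sinh_arcsinh. apply sqrt_sqrt. lra.
      * now rewrite sinh_arcsinh.
    + exists 1. split; [lra | now apply EMPTY].
  - intros an A CA. destruct (classic (exists m, A m)) as [ne|em].
    2: { left. now apply EMPTY. }
    destruct (KEY A CA ne) as (lam & mu & S & L & _ & H).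
    assert (lp : 0 < lam) by lra.
    destruct (total_order_T mu 0) as [[mn|m0]|mp].
    + right; right; left.
      assert (l1 : 1 < lam) by lra.
      assert (i1 : 0 < / lam < 1).
      { split; [now apply Rinv_0_lt_compat | rewrite <- Rinv_1; now apply Rinv_lt_contravar; lra]. }
      assert (ss := sqrt_sqrt (/ lam) ltac:(lra)). assert (sp := sqrt_lt_R0 _ (proj1 i1)).
      assert (s1 : sqrt (/ lam) < 1) by nra.
      assert (B := asin_bound_lt (sqrt (/ lam)) ltac:(lra)).
      assert (E := sin_asin (sqrt (/ lam)) ltac:(lra)).
      exists (asin (sqrt (/ lam))).
      assert (gp : 0 < asin (sqrt (/ lam))).
      { apply Rnot_le_lt; intros le.
        assert (sin (asin (sqrt (/ lam))) <= 0).
        { rewrite <- (Ropp_involutive (asin _)), sin_neg.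
          assert (0 <= sin (- asin (sqrt (/ lam)))); [|lra].
          apply sin_ge_0; generalize PI_RGT_0; lra. }
        lra. }
      split; [lra|]. apply H. intros p r psi rp NF K.
      apply (congruent_Upsilon a p r psi lam mu); auto; [lra|].
      now rewrite E.
    + left. apply H. intros p r psi rp NF K.
      now apply (congruent_cylinder a p r psi lam mu).
    (* The double root [mu = lam] falls here too, with [sinh nu = 1]. *)
    + right; right; right.
      assert (qp : 0 < mu / lam) by (apply Rdiv_lt_0_compat; lra).
      assert (sp := sqrt_lt_R0 _ qp).
      exists (arcsinh (sqrt (mu / lam))). split; [now apply arcsinh_pos|].
      apply H. intros p r psi rp NF K.
      apply (congruent_Psi a p r psi lam mu); auto.
      * now rewrite sinh_arcsinh.
      * rewrite sinh_arcsinh. apply sqrt_sqrt. lra.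
Qed.
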